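(* There exists an algorithm $\mathcal{A}$ which, given an $n$-node graph $G$ and a privacy parameter $\varepsilon>0$, is $\varepsilon$-node-private and runs in time polynomial in $n$, and which satisfies the following. Let $\Delta^*$ be the smallest possible maximum degree of a spanning forest of $G$. If $E(G)\neq\emptyset$, then with probability $1-o(1)$ (as $n\to\infty$) the output satisfies $$|\mathcal{A}(G)-f_{\mathrm{sf}}(G)|\le \Delta^*\cdot \widetilde{O}\Big(\frac{\ln\ln n}{\varepsilon}\Big).$$
   Context: Graphs are finite, undirected and unweighted. Two graphs $G,G'$ are node-neighbors if one can be obtained from the other by removing a single vertex together with all its incident edges. A randomized algorithm $\mathcal{A}$ is $\varepsilon$-node-private if for all node-neighboring graphs $G,G'$ and all events $S$ in the output space, $\Pr[\mathcal{A}(G)\in S]\le e^{\varepsilon}\Pr[\mathcal{A}(G')\in S]$. A spanning forest of $G$ is a subgraph that is a forest on vertex set $V(G)$ having the same connected components as $G$. $f_{\mathrm{sf}}(G)$ denotes the number of edges in a spanning forest of $G$, i.e. $f_{\mathrm{sf}}(G)=|V(G)|-f_{\mathrm{cc}}(G)$ where $f_{\mathrm{cc}}(G)$ is the number of connected components of $G$. $\widetilde{O}$ hides polylogarithmic factors in its argument. *)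

(* Defs.v *)
From HB Require Import structures.
From mathcomp Require Import all_boot all_order all_algebra.
From mathcomp Require Import all_classical all_reals all_analysis.

Set Implicit Arguments.
Unset Strict Implicit.
Unset Printing Implicit Defensive.

Import Order.TTheory GRing.Theory Num.Theory.
Import numFieldNormedType.Exports.

Local Open Scope classical_set_scope.
Local Open Scope ring_scope.

(** * Graphs *)

(* Simple undirected graphs on the vertex set {0, ..., n-1}. *)
Record graph (n : nat) := Graph {
  adj :> rel 'I_n;
  adj_sym : symmetric adj;
  adj_irr : irreflexive adj
}.

Definition edges n (G : graph n) : {set {set 'I_n}} :=
  [set a | [exists x, exists y, G x y && (a == [set x; y]%SET)]]%SET.

(* Since vertices are always numbered 0, ..., n-1, the graph obtained by
   deleting v is taken up to an arbitrary renumbering f of the remaining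
   vertices. *)
Definition node_removal n n' (G : graph n) (G' : graph n') : Prop :=
  exists (v : 'I_n) (f : 'I_n' -> 'I_n),
    [/\ injective f,
        forall x, (x \in codom f) = (x != v) &
        forall x y, G' x y = G (f x) (f y)].

Definition node_neighbors n n' (G : graph n) (G' : graph n') : Prop :=
  node_removal G G' \/ node_removal G' G.

Definition fcc n (G : graph n) : nat := n_comp G 'I_n.

Definition fsf n (G : graph n) : nat := (n - fcc G)%N.

(* [ucycle F p] is a closed walk without repeated vertices; those with at most
   two vertices are not cycles of a simple graph. *)
Definition forest n (F : graph n) : Prop :=
  forall p : seq 'I_n, ucycle F p -> (size p <= 2)%N.

Definition spanning_forest n (G F : graph n) : Prop :=
  [/\ subrel F G, forest F & connect F =2 connect G].

Definition max_degree n (F : graph n) : nat :=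
  \max_(x < n) #|[set y | F x y]%SET|.

Definition min_spanning_forest_degree n (G : graph n) (D : nat) : Prop :=
  (exists2 F : graph n, spanning_forest G F & max_degree F = D) /\
  (forall F : graph n, spanning_forest G F -> (D <= max_degree F)%N).

(** * Randomized algorithms: a real RAM with uniform samples *)

(* There are two memories, one holding natural numbers and one holding exact
   real numbers.  A memory is a family of unbounded two-dimensional arrays; the
   array name is fixed in the program text, the two indices are computed.
   Uniformity of the model matters for "polynomial time":
   - a program is one finite text for all input sizes, and its only constants
     are natural numbers, so it cannot carry advice;
   - naturals have unit-cost + and truncated - only (no multiplication), and
     reals cannot be rounded to naturals: with unit-cost multiplication and
     rounding, polynomial time would already contain PSPACE.
   Reals have exact unit-cost + - * /, exp, ln and comparison. *)
Definition loc := (nat * nat * nat)%type.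

Inductive nexp :=
| NConst of nat
| NGet of nat & nexp & nexp
| NAdd of nexp & nexp
| NSub of nexp & nexp.

Inductive rexp :=
| ROfNat of nexp
| RGet of nat & nexp & nexp
| RAdd of rexp & rexp
| RSub of rexp & rexp
| RMul of rexp & rexp
| RDiv of rexp & rexp
| RExp of rexp
| RLn of rexp.

Inductive bexp :=
| NLe of nexp & nexp
| RLe of rexp & rexp
| BNot of bexp
| BAnd of bexp & bexp.

Inductive cmd :=
| Skip
| NSet of nat & nexp & nexp & nexp   (* array, row, column, value *)
| RSet of nat & nexp & nexp & rexp
| Sample of nat & nexp & nexp        (* store a fresh uniform sample *)
| Seq of cmd & cmd
| If of bexp & cmd & cmd
| While of bexp & cmd.

Section semantics.
Variable R : realType.

Record state := State {
  nmem : loc -> nat;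
  rmem : loc -> R;
  nsamples : nat      (* number of random samples consumed so far *)
}.

Definition upd V (m : loc -> V) (l : loc) (v : V) : loc -> V :=
  fun l' => if l' == l then v else m l'.

Fixpoint neval (s : state) (e : nexp) : nat :=
  match e with
  | NConst k => k
  | NGet a i j => nmem s (a, neval s i, neval s j)
  | NAdd e1 e2 => (neval s e1 + neval s e2)%N
  | NSub e1 e2 => (neval s e1 - neval s e2)%N
  end.

Fixpoint reval (s : state) (e : rexp) : R :=
  match e with
  | ROfNat k => (neval s k)%:R
  | RGet a i j => rmem s (a, neval s i, neval s j)
  | RAdd e1 e2 => reval s e1 + reval s e2
  | RSub e1 e2 => reval s e1 - reval s e2
  | RMul e1 e2 => reval s e1 * reval s e2
  | RDiv e1 e2 => reval s e1 / reval s e2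
  | RExp e1 => expR (reval s e1)
  | RLn e1 => ln (reval s e1)
  end.

Fixpoint beval (s : state) (b : bexp) : bool :=
  match b with
  | NLe e1 e2 => (neval s e1 <= neval s e2)%N
  | RLe e1 e2 => reval s e1 <= reval s e2
  | BNot b1 => ~~ beval s b1
  | BAnd b1 b2 => beval s b1 && beval s b2
  end.

(* The list of commands still to be executed, and the current state. *)
Definition config := (seq cmd * state)%type.

(* One time step, [u] being the random tape.  Expressions occurring in a given
   program have bounded size, hence charging one step per command is accurate
   up to a constant factor. *)
Definition step (u : nat -> R) (c : config) : config :=
  let: (k, s) := c in
  match k with
  | [::] => ([::], s)
  | Skip :: k' => (k', s)
  | NSet a i j e :: k' =>
      (k', State (upd (nmem s) (a, neval s i, neval s j) (neval s e))
                 (rmem s) (nsamples s))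
  | RSet a i j e :: k' =>
      (k', State (nmem s)
                 (upd (rmem s) (a, neval s i, neval s j) (reval s e))
                 (nsamples s))
  | Sample a i j :: k' =>
      (k', State (nmem s)
                 (upd (rmem s) (a, neval s i, neval s j) (u (nsamples s)))
                 (nsamples s).+1)
  | Seq c1 c2 :: k' => (c1 :: c2 :: k', s)
  | If b c1 c2 :: k' => ((if beval s b then c1 else c2) :: k', s)
  | While b c1 :: k' =>
      (if beval s b then c1 :: While b c1 :: k' else k', s)
  end.

(* Input: natural array 0 holds n at (0, 0), natural array 1 holds the
   adjacency matrix, real array 0 holds eps at (0, 0); all other cells are 0. *)
Definition init_nmem n (G : graph n) (l : loc) : nat :=
  let: (a, i, j) := l in
  match a with
  | 0%N => if (i == 0%N) && (j == 0%N) then n else 0%N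
  | 1%N => if insub i is Some x then
             if insub j is Some y then nat_of_bool (G x y) else 0%N
           else 0%N
  | _ => 0%N
  end.

Definition init_rmem (eps : R) (l : loc) : R :=
  if l == (0%N, 0%N, 0%N) then eps else 0.

Definition run (p : cmd) n (G : graph n) (eps : R) (u : nat -> R) (t : nat) :
    config :=
  iter t (step u) ([:: p], State (init_nmem G) (init_rmem eps) 0).

Definition halts_within (p : cmd) n (G : graph n) (eps : R) (u : nat -> R)
    (t : nat) : Prop :=
  (run p G eps u t).1 = [::].

(* The output is the cell (0, 0) of real array 1. *)
Definition output (p : cmd) n (G : graph n) (eps : R) (u : nat -> R)
    (t : nat) : R :=
  rmem (run p G eps u t).2 (1%N, 0%N, 0%N).

(* The probability of [E] for [m] independent uniform samples in [0, 1], as the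
   iterated integral of the indicator of [E]; for measurable [E] this is the
   m-fold product of the uniform measure (Tonelli). *)
Fixpoint tape_prob (m : nat) (E : set (seq R)) : \bar R :=
  match m with
  | 0%N => (\1_E [::])%:E
  | m'.+1 => (\int[uniform_prob (@ltr01 R)]_u
               tape_prob m' [set s | E (u :: s)])%E
  end.

(* Probability that the output after [t] steps lies in [S].  At most [t]
   samples are read in [t] steps, so a tape of length [t] suffices. *)
Definition law (p : cmd) (t : nat) (eps : R) n (G : graph n) (S : set R) :
    \bar R :=
  tape_prob t [set s | S (output p G eps (nth 0 s) t)].

Definition runs_in_time (p : cmd) (T : nat -> nat) : Prop :=
  forall n (G : graph n) (eps : R) (u : nat -> R),
    0 < eps -> (forall i, 0 <= u i <= 1) -> halts_within p G eps u (T n).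

(** * Privacy and asymptotics *)

Definition node_private (eps : R)
    (M : forall n, graph n -> set R -> \bar R) : Prop :=
  forall n n' (G : graph n) (G' : graph n'), node_neighbors G G' ->
  forall S : set R, measurable S ->
    (M n G S <= (expR eps)%:E * M n' G' S)%E.

(* The bound C x log^k x.  The argument of the logarithm is shifted so that the
   polylogarithmic factor is well behaved for all x >= 0; as x tends to 0 it
   tends to a constant. *)
Definition softO (C : R) (k : nat) (x : R) : R := C * x * ln (2 + x) ^+ k.

End semantics.

Definition polynomially_bounded (T : nat -> nat) : Prop :=
  exists c k : nat, forall n, (T n <= c * n ^ k + c)%N.

(* Main.v *)
(* For y in [0,1]^V and the edge set s of a forest, put
     Lag_D(y, s) = D * (sum of y_v over v) + (sum of 1 - y_u - y_v over uv in s)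
   and f_D = min over y of the max over s of Lag_D(y, s).  By LP duality f_D is
   the largest total weight of a point of the forest polytope all of whose
   degrees are at most D, but only the dual form is used.
   - Putting y_v = 1 at a new vertex shows that f_D does not decrease, and
     grows by at most D, when a vertex is added.
   - f_D = f_sf as soon as D >= Delta, the least maximum degree of a spanning
     forest: bound the maximum from below by a spanning forest of degree Delta.
   - f_D is concave in D, as Lag is affine in D.
   - The inner maximum is a maximum weight forest, found by Kruskal's algorithm,
     so projected subgradient descent on y approximates f_D within 1/(16n) in
     polynomially many steps.  Rounding to f_sf when that close makes the value
     exact for D >= Delta, where f_D is an integer.

   A level D = 2^i is drawn by an exponential mechanism on the slopes
   q_i = (f_{2^(i+1)} - f_{2^i}) / 2^i, which have bounded sensitivity: it
   penalizes q_i above and q_(i-1) below a threshold tau of order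
   ln ln (n + 1/eps) / eps.  If q_i <= 2 tau, concavity gives
   f_sf - f_{2^i} = O(tau Delta), and q_(i-1) > 0 forces 2^i < 2 Delta, so that
   noise of order 2^i / eps is affordable.  When 1/eps exceeds n, the 1/eps
   inside tau is absorbed by the polylogarithmic factor.

   The number of vertices is itself private, so the range of levels must not
   depend on n.  There are infinitely many levels, all equal from n + 1 on: a
   continuous variable p in [0, 1) is drawn, with density proportional to the
   weight of level floor(p / (1 - p)), and then logistic noise of scale
   4 2^(p / (1 - p)) / eps is added.  Both p and the noise are obtained by inverting distribution
   functions, so two uniform samples suffice. *)

Require Import Defs.
From HB Require Import structures.
From mathcomp Require Import all_boot all_order all_algebra.
From mathcomp Require Import all_classical all_reals all_analysis.
From mathcomp Require Import measurable_realfun.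
From mathcomp Require Import zify ring lra.

Set Implicit Arguments.
Unset Strict Implicit.
Unset Printing Implicit Defensive.

Import Order.TTheory GRing.Theory Num.Theory.
Import numFieldNormedType.Exports.

Local Open Scope classical_set_scope.
Local Open Scope ring_scope.

(** * Acyclic lists of edges *)

(** For an equivalence [r] this is the equivalence that also merges the classes of [u] and [v]. A
    path needs the new link at most once, so no transitive closure is taken. *)
Definition join (T : Type) (r : rel T) (u v : T) : rel T :=
  fun a b => [|| r a b, r a u && r v b | r a v && r u b].

Definition joins (T : Type) (r : rel T) (s : seq (T * T)) : rel T :=
  foldl (fun r e => join r e.1 e.2) r s.

(* A list of edges is acyclic relatively to [r] when each edge connects two
   classes that neither [r] nor the previous edges connect. *)
Fixpoint acyclic (T : Type) (r : rel T) (s : seq (T * T)) : bool :=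
  if s is e :: s' then ~~ r e.1 e.2 && acyclic (join r e.1 e.2) s' else true.

Lemma acyclic_sub (T : Type) (r r' : rel T) s :
  subrel r' r -> acyclic r s -> acyclic r' s.
Proof.
elim: s r r' => //= e s IH r r' h /andP[re ac]; apply/andP; split.
  by apply: contra re; exact: h.
apply: IH ac => a b; rewrite /join.
case/or3P => [/h ->//|/andP[/h -> /h ->]|/andP[/h -> /h ->]]; by rewrite ?orbT.
Qed.

Lemma eq_acyclic (T : Type) (r r' : rel T) s : r =2 r' -> acyclic r s = acyclic r' s.
Proof. by move=> h; apply/idP/idP; apply: acyclic_sub => a b; rewrite h. Qed.

Lemma join_sub (T : Type) (r : rel T) u v : subrel r (join r u v).
Proof. by move=> a b h; rewrite /join h. Qed.

Lemma equiv_sym (T : Type) (r : rel T) : equivalence_rel r -> symmetric r.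
Proof.
move=> er a b; have rr x : r x x by have [] := er x x x.
by apply/idP/idP => h; [have [_ /(_ h) <-] := er a b a | have [_ /(_ h) <-] := er b a b].
Qed.

Lemma equiv_trans (T : Type) (r : rel T) : equivalence_rel r -> transitive r.
Proof. by move=> er b a c ab; have [_ /(_ ab) ->] := er a b c. Qed.

Lemma join_equiv (T : Type) (r : rel T) u v :
  equivalence_rel r -> equivalence_rel (join r u v).
Proof.
move=> er; have rr a : r a a by have [] := er a a a.
have rs := equiv_sym er.
have rt a b c : r a b -> r a c = r b c by move=> h; have [_ ->] := er a b c.
have sym a b : join r u v a b = join r u v b a.
  rewrite /join (rs a b) (rs a u) (rs v b) (rs a v) (rs u b).
  by rewrite [r u a && _]andbC [r v a && _]andbC; congr (_ || _); rewrite orbC.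
have tr a b c : join r u v a b -> join r u v b c -> join r u v a c.
  rewrite /join; case/or3P => [ab|/andP[au vb]|/andP[av ub]].
  - by rewrite !(rt _ _ _ ab).
  - rewrite -(rt _ _ _ vb) au /= (rs b u) (rs b v) vb.
    case/or3P => [->|/andP[ub vc]|/andP[_ uc]]; rewrite ?orbT //.
      by rewrite vc !orbT.
    by rewrite (rt _ _ _ au) uc.
  - rewrite -(rt _ _ _ ub) av /= (rs b u) (rs b v) ub.
    case/or3P => [->|/andP[_ vc]|/andP[vb uc]]; rewrite ?orbT //.
      by rewrite (rt _ _ _ av) vc.
    by rewrite uc !orbT.
move=> a b c; split; first by rewrite /join rr.
move=> ab; apply/idP/idP; last exact: tr.
by apply: tr; rewrite sym.
Qed.

Lemma joins_equiv (T : Type) (r : rel T) s :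
  equivalence_rel r -> equivalence_rel (joins r s).
Proof. by elim: s r => //= e s IH r er; apply/IH/join_equiv. Qed.

Lemma joins_rcons (T : Type) (r : rel T) s e :
  joins r (rcons s e) = join (joins r s) e.1 e.2.
Proof. by rewrite /joins foldl_rcons. Qed.

Lemma acyclic_rcons (T : Type) (r : rel T) s e :
  acyclic r (rcons s e) = acyclic r s && ~~ joins r s e.1 e.2.
Proof. by elim: s r => [|x s IH] r /=; rewrite ?andbT // IH andbA. Qed.

Lemma acyclic_notin (T : eqType) (r : rel T) s e :
  acyclic r s -> e \in s -> ~~ r e.1 e.2.
Proof.
elim: s r => //= x s IH r /andP[rx ac]; rewrite inE => /orP[/eqP->//|es].
by apply: contra (IH _ ac es); exact: join_sub.
Qed.

Lemma join_link (T : Type) (r : rel T) u v : equivalence_rel r -> join r u v u v.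
Proof.
by move=> er; have rr z : r z z by [have [] := er z z z]; rewrite /join !rr !orbT.
Qed.

Lemma join_comm (T : Type) (r : rel T) u v a b : equivalence_rel r ->
  join (join r u v) a b =2 join (join r a b) u v.
Proof.
suff H (u' v' a' b' : T) : equivalence_rel r ->
    subrel (join (join r u' v') a' b') (join (join r a' b') u' v').
  by move=> er x y; apply/idP/idP; exact: H.
move=> er x y.
have eqj := join_equiv u' v' (join_equiv a' b' er).
set j := join (join r a' b') u' v' in eqj *.
have js := equiv_sym eqj; have jt := equiv_trans eqj.
have rr z : r z z by have [] := er z z z.
have jr p q : r p q -> j p q by move=> h; apply/join_sub/join_sub.
have ja : j a' b' by exact/join_sub/join_link.
have ju : j u' v' by exact/join_link/join_equiv.
have j1 p q : join r u' v' p q -> j p q.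
  case/or3P => [/jr//|/andP[/jr h /jr h']|/andP[/jr h /jr h']].
    exact: jt h (jt _ _ _ ju h').
  by rewrite js in ju; exact: jt h (jt _ _ _ ju h').
case/or3P => [/j1//|/andP[/j1 h /j1 h']|/andP[/j1 h /j1 h']].
  exact: jt h (jt _ _ _ ja h').
by rewrite js in ja; exact: jt h (jt _ _ _ ja h').
Qed.

(** A link merges exactly two classes. If linking [u] and [v] connects the separate [a] and [b],
    these lie one in each of the two classes, so linking [a] and [b] merges the same pair. *)
Lemma join_absorb (T : Type) (r : rel T) u v a b : equivalence_rel r ->
  ~~ r a b -> join r u v a b -> join r a b =2 join r u v.
Proof.
move=> er rab juv.
have eq1 := join_equiv u v er; have eq2 := join_equiv a b er.
have rr z : r z z by have [] := er z z z.
have rs := equiv_sym er.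
have jab : join r a b u v.
  move: juv; rewrite /join (negbTE rab) /=.
  by case/orP => /andP[h h']; [rewrite (rs u a) (rs b v) h h' orbT|rewrite h h' !orbT].
have aux p q p' q' : join r p q p' q' -> subrel (join r p' q') (join r p q).
  have eqj := join_equiv p q er; have js := equiv_sym eqj; have jt := equiv_trans eqj.
  move=> h x y /or3P[|/andP[xa yb]|/andP[xa yb]]; first exact: join_sub.
    exact: jt (join_sub _ _ xa) (jt _ _ _ h (join_sub _ _ yb)).
  by rewrite js in h; exact: jt (join_sub _ _ xa) (jt _ _ _ h (join_sub _ _ yb)).
by move=> x y; apply/idP/idP; apply: aux.
Qed.

(* Matroid exchange: contracting one more edge costs at most one edge. *)
Lemma acyclic_exchange (T : Type) (r : rel T) u v s : equivalence_rel r ->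
  acyclic r s ->
  acyclic (join r u v) s \/
  exists s1 e s2, s = s1 ++ e :: s2 /\ acyclic (join r u v) (s1 ++ s2).
Proof.
elim: s r => [|e s IH] r er /=; first by left.
case/andP=> re ac.
(* If the contraction already connects the ends of the head, the head is the edge to give up.
   Otherwise it is kept and the two links are swapped. *)
case juv : (join r u v e.1 e.2).
  right; exists [::], e, s; split=> //=.
  by rewrite -(eq_acyclic _ (join_absorb er re juv)).
case: (IH _ (join_equiv e.1 e.2 er) ac) => [h|[s1 [f [s2 [-> h]]]]].
  by left; rewrite (eq_acyclic _ (join_comm _ _ _ _ er)).
right; exists (e :: s1), f, s2; split=> //=.
by rewrite juv (eq_acyclic _ (join_comm _ _ _ _ er)).
Qed.

Lemma acyclic_subseq (T : eqType) (r : rel T) s s' :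
  subseq s' s -> acyclic r s -> acyclic r s'.
Proof.
elim: s s' r => [|e s IH] [|e' s'] r //=.
case: eqP => [<-|_] h /andP[re ac].
  by rewrite re /=; exact: IH ac.
rewrite -[_ && _]/(acyclic r (e' :: s')).
apply: (acyclic_sub (@join_sub _ r e.1 e.2)); exact: IH ac.
Qed.

Lemma acyclic_map (T T' : Type) (f : T -> T') (r : rel T) (r' : rel T') s :
  (forall x y, r' (f x) (f y) = r x y) ->
  acyclic r' [seq (f e.1, f e.2) | e <- s] = acyclic r s.
Proof.
elim: s r r' => //= e s IH r r' h; rewrite h; congr (_ && _); apply: IH => x y.
by rewrite /join !h.
Qed.

Section labels.
Variables (T : Type) (U : eqType).
Definition same_label (L : T -> U) : rel T := fun a b => L a == L b.
(** Kruskal's algorithm stores classes as labels; this is its union operation. *)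
Lemma same_label_relabel L u v :
  same_label (fun a => if L a == L u then L v else L a) =2 join (same_label L) u v.
Proof.
move=> a b; rewrite /same_label /join /=.
have [au|au] := eqVneq (L a) (L u); have [bu|bu] := eqVneq (L b) (L u).
- by rewrite au bu !eqxx.
- by rewrite au (eq_sym (L u) (L b)) (negbTE bu) andbF orbF.
- by rewrite bu (negbTE au) andbT.
- by rewrite andbF !orbF.
Qed.
End labels.

(** * Counting the classes of equivalence relations *)

Section components.
Variable n : nat.
Implicit Types (r : rel 'I_n) (s : seq ('I_n * 'I_n)).

Lemma equiv_connect r : equivalence_rel r -> connect r =2 r.
Proof.
move=> er a b; apply/idP/idP; last exact: connect1.
case/connectP => p + ->; elim: p a => [|x p IH] a /=; first by have [] := er a a a.
by case/andP => ax /IH; exact: equiv_trans ax.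
Qed.

(** [A] has exactly one point in each class, so taking roots maps it bijectively onto the roots. *)
Lemma n_comp_transversal r (A : {set 'I_n}) : equivalence_rel r ->
  (forall x, exists2 y, y \in A & r x y) ->
  {in A &, forall y z, r y z -> y = z} -> n_comp r 'I_n = #|A|.
Proof.
move=> er ex un.
have cs : connect_sym r by move=> a b; rewrite !equiv_connect // equiv_sym.
rewrite /n_comp_mem -(card_in_imset (f := fingraph.root r) (D := A)); last first.
  move=> y z yA zA /eqP; rewrite root_connect // equiv_connect //; exact: un.
apply: eq_card => x; rewrite !inE andbT; apply/eqP/imsetP.
  move=> rx; have [y yA xy] := ex x; exists y => //; rewrite -rx; apply/eqP.
  by rewrite root_connect // equiv_connect.
by case=> y _ ->; rewrite root_root.
Qed.

Lemma n_comp_join r u v : equivalence_rel r -> ~~ r u v ->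
  n_comp r 'I_n = (n_comp (join r u v) 'I_n).+1.
Proof.
move=> er ruv.
have cs : connect_sym r by move=> a b; rewrite !equiv_connect // equiv_sym.
have rs := equiv_sym er; have rt := equiv_trans er.
have rr x : r x (fingraph.root r x) by rewrite -equiv_connect // connect_root.
pose A := [set x | fingraph.root r x == x]%SET.
have tA x y : x \in A -> y \in A -> r x y -> x = y.
  rewrite !inE => /eqP xA /eqP yA xy; rewrite -xA -yA; apply/eqP.
  by rewrite root_connect // equiv_connect.
have rA x : fingraph.root r x \in A by rewrite inE root_root.
rewrite (n_comp_transversal (A := A) er); first last.
- by move=> x y xA yA; exact: tA.
- by move=> x; exists (fingraph.root r x).
(* Without the root of [u], the root of [v] represents the merged class. *)
rewrite (n_comp_transversal (A := (A :\ fingraph.root r u)%SET)); last first.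
- move=> x y; rewrite !in_setD1 => /andP[xu xA] /andP[yu yA].
  case/or3P => [|/andP[h _]|/andP[_ h]]; first exact: tA.
    by case/eqP: xu; apply: tA => //; exact: rt h _.
  by case/eqP: yu; apply: tA => //; rewrite rs; apply: rt h; rewrite rs.
- move=> x; have [xu|xu] := eqVneq (fingraph.root r x) (fingraph.root r u).
    exists (fingraph.root r v).
      rewrite in_setD1 rA andbT; apply: contra ruv => /eqP vu.
      by apply: rt (rr u) _; rewrite -vu rs.
    apply/or3P; apply: Or32; apply/andP; split; last exact: rr.
    by apply: rt (rr x) _; rewrite xu rs.
  exists (fingraph.root r x); first by rewrite in_setD1 xu rA.
  exact/join_sub/rr.
- exact: join_equiv.
by rewrite (cardsD1 (fingraph.root r u) A) rA.
Qed.

(** Every root of the coarser relation is the image, under its root map, of a root of the finer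
    one. *)
Lemma n_comp_le r r' : equivalence_rel r -> equivalence_rel r' -> subrel r r' ->
  (n_comp r' 'I_n <= n_comp r 'I_n)%N.
Proof.
move=> er er' sub.
have cs' : connect_sym r' by move=> a b; rewrite !equiv_connect // equiv_sym.
have cs : connect_sym r by move=> a b; rewrite !equiv_connect // equiv_sym.
rewrite /n_comp_mem; set B := predI (fingraph.roots r) _.
apply: leq_trans (leq_image_card (fingraph.root r') B); apply: subset_leq_card.
apply/fintype.subsetP => x; rewrite !inE andbT => /eqP rx.
apply/fintype.imageP; exists (fingraph.root r x); first by rewrite !inE andbT roots_root.
rewrite -{1}rx; apply/eqP; rewrite root_connect // equiv_connect //; apply: sub.
by rewrite -equiv_connect // connect_root.
Qed.

Lemma acyclic_size r s : equivalence_rel r -> acyclic r s ->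
  (size s + n_comp (joins r s) 'I_n = n_comp r 'I_n)%N.
Proof.
elim: s r => //= e s IH r er /andP[re ac].
by rewrite (n_comp_join er re) -(IH _ (join_equiv _ _ er) ac).
Qed.

Lemma eqop_equiv : equivalence_rel (@eq_op 'I_n).
Proof. by move=> a b c; split=> // /eqP ->. Qed.

Lemma n_comp_eqop : n_comp (@eq_op 'I_n) 'I_n = n.
Proof.
rewrite (n_comp_transversal (A := finset.setT) eqop_equiv).
- by rewrite cardsT card_ord.
- by move=> x; exists x.
- by move=> x y _ _ /eqP.
Qed.

End components.

(** * The Lagrangian dual *)

Section forests.
Variable n : nat.
Implicit Types (G F : graph n) (s : seq ('I_n * 'I_n)).

Definition edge_forest G s : bool :=
  all (fun e => G e.1 e.2) s && acyclic eq_op s.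

Definition incidences s (v : 'I_n) : nat :=
  (\sum_(e <- s) ((e.1 == v) + (e.2 == v)))%N.

Definition other (v : 'I_n) (e : 'I_n * 'I_n) : option 'I_n :=
  if e.1 == v then Some e.2 else if e.2 == v then Some e.1 else None.

(** An acyclic list has neither loops nor repeated edges, so incidences of [v] are distinct
    neighbors. The middle clause strengthens the induction: it prevents the neighbor met at the head
    from occurring again. *)
Lemma other_uniq r s v : equivalence_rel r -> acyclic r s ->
  [/\ uniq (pmap (other v) s), forall x, x \in pmap (other v) s -> ~~ r v x
    & incidences s v = size (pmap (other v) s)].
Proof.
elim: s r => [|[a b] s IH] r er /=; first by split=> //; rewrite /incidences big_nil.
case/andP => rab ac; have er' := join_equiv a b er; have lk := join_link a b er.
have [u ni sz] := IH _ er' ac.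
have nr x : x \in pmap (other v) s -> ~~ r v x.
  by move=> xs; apply: contra (ni _ xs); exact: join_sub.
have ab : (a == b) = false.
  by apply: contraNF rab => /eqP ->; have [] := er b b b.
have oE : other v (a, b) = if a == v then Some b else if b == v then Some a else None by [].
rewrite /incidences big_cons -/(incidences s v) sz /= oE {oE}.
have [av|av] := eqVneq a v; last have [bv|bv] := eqVneq b v.
- subst v; rewrite (eq_sym b) ab /= u andbT; split=> //.
    by apply/negP => h; have := ni _ h; rewrite lk.
  by move=> x; rewrite inE => /orP[/eqP ->//|]; exact: nr.
- subst v; rewrite /= u andbT; split=> //.
    by apply/negP => h; have := ni _ h; rewrite (equiv_sym er') lk.
  move=> x; rewrite inE => /orP[/eqP ->|]; last exact: nr.
  by rewrite (equiv_sym er).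
- by [].
Qed.

Lemma incidences_le s v : acyclic eq_op s -> (incidences s v <= n)%N.
Proof.
move=> ac; have [u _ ->] := other_uniq v (@eqop_equiv n) ac.
by rewrite -(card_uniqP u) -[leqRHS](card_ord n) max_card.
Qed.

Lemma edge_forest_deg G s v : edge_forest G s -> (incidences s v <= max_degree G)%N.
Proof.
case/andP => /allP aG ac; have [u _ ->] := other_uniq v (@eqop_equiv n) ac.
apply: leq_trans (leq_bigmax v); rewrite -(card_uniqP u); apply: subset_leq_card.
apply/fintype.subsetP => x; rewrite mem_pmap inE => /mapP[[a b] /aG /= gab].
rewrite /other /=; have [<-|_] := eqVneq a v; first by case=> ->.
by have [<-|_] := eqVneq b v => // -[->]; rewrite adj_sym.
Qed.

Lemma joins_edges r s (q : rel 'I_n) : equivalence_rel q -> subrel r q ->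
  all (fun e => q e.1 e.2) s -> subrel (joins r s) q.
Proof.
move=> eq; elim: s r => //= -[a b] s IH r rq /andP[/= qab al]; apply: IH => //.
have qt := equiv_trans eq; have qs := equiv_sym eq.
move=> x y /or3P[/rq//|/andP[/rq xa /rq by_]|/andP[/rq xb /rq ay]].
  exact: qt xa (qt _ _ _ qab by_).
by rewrite qs in qab; exact: qt xb (qt _ _ _ qab ay).
Qed.

Lemma connect_equiv G : equivalence_rel (connect G).
Proof.
have cs : connect_sym G by apply: sym_connect_sym; exact: adj_sym.
move=> a b c; split; first exact: connect0.
by move=> ab; apply/idP/idP; apply: connect_trans => //; rewrite cs.
Qed.

(** Each edge of an acyclic list lowers the number of classes by one, and the final classes refine
    the components of [G]. *)
Lemma edge_forest_size G s : edge_forest G s -> (size s <= fsf G)%N.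
Proof.
case/andP => aG ac; have := acyclic_size (@eqop_equiv n) ac.
rewrite n_comp_eqop => sz; rewrite /fsf leq_subRL; last first.
  rewrite -[leqRHS]n_comp_eqop /fcc.
  have -> : n_comp G 'I_n = n_comp (connect G) 'I_n.
    apply: eq_n_comp => x y; rewrite (equiv_connect (connect_equiv G)) //.
  apply: n_comp_le; [exact: eqop_equiv|exact: connect_equiv|].
  by move=> x y /eqP ->; exact: connect0.
have -> : fcc G = n_comp (connect G) 'I_n.
  by apply: eq_n_comp => x y; rewrite (equiv_connect (connect_equiv G)).
rewrite addnC -[leqRHS]sz leq_add2l.
apply: n_comp_le; [|exact: connect_equiv|].
  exact/joins_equiv/eqop_equiv.
apply: joins_edges; [exact: connect_equiv| |].
  by move=> x y /eqP ->; exact: connect0.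
by apply: sub_all aG => e; exact: connect1.
Qed.

Lemma spanning_edge_forest G F : subrel F G -> connect F =2 connect G ->
  exists s, [/\ edge_forest F s, edge_forest G s & size s = fsf G].
Proof.
move=> FG FGc.
suff [s [aF ac cl]] : exists s, [/\ all (fun e => F e.1 e.2) s, acyclic eq_op s
    & forall x y, F x y -> joins eq_op s x y].
  have aG : all (fun e => G e.1 e.2) s by apply: sub_all aF => e; exact: FG.
  exists s; split; [by rewrite /edge_forest aF|by rewrite /edge_forest aG|].
  have := acyclic_size (@eqop_equiv n) ac; rewrite n_comp_eqop.
  have ej := joins_equiv s (@eqop_equiv n).
  have -> : n_comp (joins eq_op s) 'I_n = fcc G.
    apply: eq_n_comp => x y; rewrite -FGc (equiv_connect ej); apply/idP/idP.
      apply: joins_edges; [exact: connect_equiv| |].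
        by move=> a b /eqP ->; exact: connect0.
      by apply: sub_all aF => e; exact: connect1.
    by rewrite -(equiv_connect ej) => h; apply: connect_sub h => a b /cl /connect1.
  by rewrite /fsf => sz; rewrite -[X in (X - _)%N]sz addnK.
(* Induction over a list of pairs: an edge of [F] is appended whenever its ends are not yet joined.
   The list of all pairs gives the claim. *)
suff H (l : seq ('I_n * 'I_n)) : exists s, [/\ all (fun e => F e.1 e.2) s,
    acyclic eq_op s & forall e, e \in l -> F e.1 e.2 -> joins eq_op s e.1 e.2].
  have [s [h1 h2 h3]] := H (enum {: 'I_n * 'I_n}); exists s; split=> // x y.
  by apply: (h3 (x, y)); rewrite mem_enum.
elim: l => [|e l [s [h1 h2 h3]]]; first by exists [::].
have [Fe|nFe] := boolP (F e.1 e.2); last first.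
  exists s; split=> // f; rewrite inE => /orP[/eqP ->|]; last exact: h3.
  by rewrite (negbTE nFe).
have [je|nje] := boolP (joins eq_op s e.1 e.2).
  by exists s; split=> // f; rewrite inE => /orP[/eqP ->//|]; exact: h3.
exists (rcons s e); split; first by rewrite all_rcons Fe.
  by rewrite acyclic_rcons h2.
move=> f; rewrite inE joins_rcons => /orP[/eqP -> _|fl /(h3 _ fl)].
  exact/join_link/joins_equiv/eqop_equiv.
exact: join_sub.
Qed.

End forests.

Section lagrangian.
Variables (R : realType).

Definition in_box n (y : 'I_n -> R) := forall v, 0 <= y v <= 1.

Definition lagr n (D : R) (y : 'I_n -> R) (s : seq ('I_n * 'I_n)) : R :=
  D * (\sum_v y v) + \sum_(e <- s) (1 - y e.1 - y e.2).

(* The least such [M] is the value of the linear program maximizing the total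
   weight over the forest polytope under the constraints "degree at most [D]". *)
Definition dual_bound n (G : graph n) (D M : R) :=
  exists2 y : 'I_n -> R, in_box y & forall s, edge_forest G s -> lagr D y s <= M.

Lemma sum_incidences n (s : seq ('I_n * 'I_n)) (y : 'I_n -> R) :
  \sum_(e <- s) (1 - y e.1 - y e.2) = (size s)%:R - \sum_v (incidences s v)%:R * y v.
Proof.
elim: s => [|e s IH].
  by rewrite big_nil big1 ?subr0 // => v _; rewrite /incidences big_nil mul0r.
rewrite big_cons IH /=.
have -> : \sum_v (incidences (e :: s) v)%:R * y v =
   y e.1 + y e.2 + \sum_v (incidences s v)%:R * y v.
  under eq_bigr do rewrite /incidences big_cons -/(incidences s _) !natrD !mulrDl.
  rewrite !big_split /=; congr (_ + _ + _).
    rewrite (bigD1 e.1) //= eqxx mul1r big1 ?addr0 // => i /negbTE.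
    by rewrite eq_sym => ->; rewrite mul0r.
  rewrite (bigD1 e.2) //= eqxx mul1r big1 ?addr0 // => i /negbTE.
  by rewrite eq_sym => ->; rewrite mul0r.
rewrite -natr1; lra.
Qed.

Lemma lagr_incidences n D (y : 'I_n -> R) s :
  lagr D y s = (size s)%:R + \sum_v (D - (incidences s v)%:R) * y v.
Proof.
rewrite /lagr sum_incidences; under [in RHS]eq_bigr do rewrite mulrBl.
rewrite sumrB mulr_sumr; lra.
Qed.

Lemma dual_bound_fsf n (G : graph n) D : dual_bound G D (fsf G)%:R.
Proof.
exists (fun=> 0); first by move=> v; rewrite lexx ler01.
move=> s fs; rewrite lagr_incidences big1 ?addr0; last by move=> v _; rewrite mulr0.
by rewrite ler_nat edge_forest_size.
Qed.

(** Weak duality: an edge forest spanning inside [F] has degrees at most [D], so every coefficient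
    in [lagr_incidences] is nonnegative and its size is below every dual value. *)
Lemma dual_bound_ge n (G F : graph n) (D M : R) : subrel F G ->
  connect F =2 connect G -> (max_degree F)%:R <= D ->
  dual_bound G D M -> (fsf G)%:R <= M.
Proof.
move=> FG FGc dF [y yb ub]; have [s [fF fG sz]] := spanning_edge_forest FG FGc.
apply: le_trans (ub _ fG); rewrite lagr_incidences sz lerDl sumr_ge0 // => v _.
have /andP[y0 _] := yb v; rewrite mulr_ge0 // subr_ge0 (le_trans _ dF) //.
by rewrite ler_nat edge_forest_deg.
Qed.

Lemma max_degree_le n (G : graph n) : (max_degree G <= n)%N.
Proof.
apply/bigmax_leqP => v _; rewrite -[leqRHS](card_ord n); exact: max_card.
Qed.

(** Concavity in [D]: the same [y] serves for every [D'], with a value affine in [D']. The sum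
    [sigma] of [y] acts as a supergradient. *)
Lemma dual_bound_slope n (G : graph n) D M : dual_bound G D M ->
  exists2 sigma, 0 <= sigma & forall D', dual_bound G D' (M + (D' - D) * sigma).
Proof.
case=> y yb ub; exists (\sum_v y v); first by apply: sumr_ge0 => v _; case/andP: (yb v).
move=> D'; exists y => // s /ub; rewrite /lagr; lra.
Qed.

(** * Effect of a vertex removal on the dual bounds *)

Section removal.
Variables (n n' : nat) (G : graph n) (G' : graph n') (v : 'I_n) (f : 'I_n' -> 'I_n).
Hypotheses (f_inj : injective f) (f_codom : forall x, (x \in codom f) = (x != v))
  (f_edge : forall x y, G' x y = G (f x) (f y)).

Let lift (s : seq ('I_n' * 'I_n')) := [seq (f e.1, f e.2) | e <- s].

Lemma edge_forest_lift s : edge_forest G (lift s) = edge_forest G' s.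
Proof.
rewrite /edge_forest (acyclic_map (r := eq_op)); last by move=> x y; rewrite inj_eq.
by rewrite all_map; congr (_ && _); apply: eq_all => e /=; rewrite f_edge.
Qed.

Lemma sum_removal (y : 'I_n -> R) : \sum_x y x = y v + \sum_x y (f x).
Proof.
rewrite (bigD1 v) //=; congr (_ + _).
rewrite -(big_map f xpredT y) /= -[RHS]big_filter filter_predT.
rewrite -big_filter; apply: perm_big; apply: uniq_perm.
- by rewrite filter_uniq // index_enum_uniq.
- by rewrite map_inj_uniq // index_enum_uniq.
- move=> x; rewrite mem_filter mem_index_enum andbT -f_codom.
  apply/fintype.imageP/mapP => -[z _ ->]; exists z => //.
  by rewrite mem_index_enum.
Qed.

(** Forests of [G'] lift to [G], and restricting [y] only drops the nonnegative term of [v]. *)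
Lemma dual_bound_remove D M : 0 <= D -> dual_bound G D M -> dual_bound G' D M.
Proof.
move=> D0 [y yb ub]; exists (y \o f); first by move=> x; exact: yb.
move=> s; rewrite -edge_forest_lift => /ub; apply: le_trans.
rewrite /lagr sum_removal /lift big_map /= mulrDr.
rewrite lerD2r lerDr mulr_ge0 //; by case/andP: (yb v).
Qed.

(** When [y] is extended by 1 at [v], edges at [v] get weight at most 0. A forest of [G] may thus be
    stripped of them, and the new vertex costs [D]. *)
Lemma dual_bound_insert D M : dual_bound G' D M -> dual_bound G D (M + D).
Proof.
case=> y yb ub.
pose g x : option 'I_n' := [pick z | f z == x].
have gf x : g (f x) = Some x.
  rewrite /g; case: pickP => [z /eqP /f_inj -> //|/(_ x)]; by rewrite eqxx.
have fg x : x != v -> exists2 z, x = f z & g x = Some z.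
  by rewrite -f_codom => /fintype.imageP[z _ ->]; exists z.
have gv : g v = None.
  rewrite /g; case: pickP => // z /eqP fz.
  by have := f_codom v; rewrite eqxx -fz codom_f.
pose y' x := if g x is Some z then y z else 1.
have y'b : in_box y' by move=> x; rewrite /y'; case: (g x) => [z|]; [exact: yb|rewrite lexx ler01].
exists y' => // s fs.
pose off e := (e.1 != v) && (e.2 != v) : bool.
have [s' es'] : exists s', seq.filter off s = lift s'.
  elim: s {fs} => [|e s [s' IH]]; first by exists [::].
  rewrite /= {1}/off; case: ifP => [/andP[h1 h2]|_]; last by exists s'.
  have [a ea _] := fg _ h1; have [b eb _] := fg _ h2.
  by exists ((a, b) :: s'); rewrite IH /lift /= -ea -eb; case: (e).
have fs' : edge_forest G' s'.
  rewrite -edge_forest_lift -es'; case/andP: fs => aG ac; apply/andP; split.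
    by apply/allP => e; rewrite mem_filter => /andP[_ es]; move/allP: aG; apply.
  exact: acyclic_subseq (filter_subseq _ _) ac.
have := ub _ fs'; rewrite /lagr (sum_removal y').
have -> : y' v = 1 by rewrite /y' gv.
under [in X in _ -> X]eq_bigr do rewrite /y' gf.
rewrite (bigID off) /=; set X := \sum_(e <- s | off e) _; set Y := \sum_(e <- s | _) _.
have -> : X = \sum_(e <- s') (1 - y e.1 - y e.2).
  by rewrite /X -big_filter es' /lift big_map /=; apply: eq_bigr => e _; rewrite /y' !gf.
suff : Y <= 0 by lra.
apply: sumr_le0 => e; have /andP[h1 h2] := y'b e.1; have /andP[h3 h4] := y'b e.2.
rewrite /off negb_and !negbK => /orP[]/eqP ev; move: h1 h2 h3 h4; rewrite ev /y' gv; lra.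
Qed.

End removal.

(** * Optimality of greedy forests *)

Section greedy.
Variables (n : nat) (G : graph n) (w : 'I_n * 'I_n -> R).

(** Invariant of Kruskal's algorithm after contracting the classes of [r] at total weight [val]: no
    forest has lost anything by the choices made so far. *)
Definition greedy_bound (r : rel 'I_n) (val : R) :=
  forall s, edge_forest G s -> exists s', [/\ all (fun e => G e.1 e.2) s', acyclic r s'
    & \sum_(e <- s) w e <= val + \sum_(e <- s') w e].

Lemma greedy_init : greedy_bound eq_op 0.
Proof. by move=> s /andP[aG ac]; exists s; rewrite add0r. Qed.

(** By exchange, the contraction costs a competing forest at most one edge, which weighs no more
    than [(a, b)]. If it costs none, [0 <= w (a, b)] suffices. *)
Lemma greedy_step r val a b : equivalence_rel r -> 0 <= w (a, b) ->
  (forall e, G e.1 e.2 -> ~~ r e.1 e.2 -> w e <= w (a, b)) ->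
  greedy_bound r val -> greedy_bound (join r a b) (val + w (a, b)).
Proof.
move=> er w0 wmax gb s /gb[s' [aG ac ws]].
have [ac'|[s1 [e [s2 [es' ac']]]]] := acyclic_exchange a b er ac.
  exists s'; split=> //; lra.
exists (s1 ++ s2); split=> //.
  by move: aG; rewrite es' !all_cat /= => /and3P[-> _ ->].
have : w e <= w (a, b).
  apply: wmax; last by apply: (acyclic_notin ac); rewrite es' mem_cat inE eqxx orbT.
  by move/allP: aG; apply; rewrite es' mem_cat inE eqxx orbT.
move: ws; rewrite es' !big_cat big_cons /=; lra.
Qed.

Lemma greedy_end r val : (forall e, G e.1 e.2 -> ~~ r e.1 e.2 -> w e <= 0) ->
  greedy_bound r val -> forall s, edge_forest G s -> \sum_(e <- s) w e <= val.
Proof.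
move=> w0 gb s /gb[s' [aG ac]]; suff : \sum_(e <- s') w e <= 0 by lra.
rewrite big_seq; apply: sumr_le0 => e es; apply: w0; last exact: acyclic_notin ac es.
by move/allP: aG; apply.
Qed.

End greedy.

(** * Projected subgradient steps *)

Definition clip (x : R) : R := if x <= 0 then 0 else if 1 <= x then 1 else x.

Lemma clip_box x : 0 <= clip x <= 1.
Proof.
rewrite /clip; case: ifP => [_|/negbT]; first by rewrite lexx ler01.
by rewrite -ltNge => x0; case: ifP => [_|/negbT]; rewrite ?lexx ?ler01 // -ltNge; lra.
Qed.

Lemma clip_dist x z : 0 <= z <= 1 -> (clip x - z) ^+ 2 <= (x - z) ^+ 2.
Proof.
move=> /andP[z0 z1]; rewrite /clip; case: ifP => [x0|_]; first nra.
by case: ifP => // x1; nra.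
Qed.

(** Projection onto the box does not increase the distance to [z]. Since [lagr] is affine in [y]
    with gradient [D] minus the incidences, expanding the square leaves only a term in [h ^+ 2]. The
    [n] coordinates of the gradient are at most [n] in absolute value, whence [n ^ 3]. *)
Lemma subgradient_step n (y z : 'I_n -> R) s D h : 0 <= h -> 0 <= D <= n%:R ->
  acyclic eq_op s -> in_box z ->
  \sum_v (clip (y v - h * (D - (incidences s v)%:R)) - z v) ^+ 2 <=
  \sum_v (y v - z v) ^+ 2 - 2 * h * (lagr D y s - lagr D z s) + h ^+ 2 * n%:R ^+ 3.
Proof.
move=> h0 /andP[D0 Dn] ac zb; rewrite !lagr_incidences.
have -> : 2 * h * ((size s)%:R + \sum_v (D - (incidences s v)%:R) * y v -
   ((size s)%:R + \sum_v (D - (incidences s v)%:R) * z v)) =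
   \sum_v 2 * h * ((D - (incidences s v)%:R) * (y v - z v)).
  rewrite -mulr_sumr; congr (_ * _); under [RHS]eq_bigr do rewrite mulrBr.
  rewrite sumrB; lra.
have -> : h ^+ 2 * n%:R ^+ 3 = \sum_(v < n) h ^+ 2 * n%:R ^+ 2.
  by rewrite sumr_const card_ord -[RHS]mulr_natr -mulrA -exprSr.
rewrite -sumrB -big_split /=; apply: ler_sum => v _.
apply: le_trans (clip_dist _ (zb v)) _.
set d := (incidences s v)%:R; have d0 : 0 <= d by rewrite ler0n.
have dn : d <= n%:R by rewrite ler_nat incidences_le.
have : (D - d) ^+ 2 <= n%:R ^+ 2 by nra.
move: (D - d) => g; have := sqr_ge0 h => hh gg.
have : h ^+ 2 * g ^+ 2 <= h ^+ 2 * n%:R ^+ 2 by rewrite ler_wpM2l.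
lra.
Qed.

End lagrangian.

(** * Quantile functions of the uniform distribution *)

Section domination.
Context {R : realType}.
Implicit Types mu nu : probability (measurableTypeR R) R.

Let ray mu (r : R) : R := fine (mu `]-oo, r]%classic).

Let ray_nd mu : nondecreasing (ray mu).
Proof.
move=> r s rs; rewrite /ray fine_le ?fin_num_measure //.
by rewrite le_measure ?inE //; exact: subitvPr.
Qed.

Let idR : measurableTypeR R -> R := idfun.
#[local] HB.instance Definition _ :=
  @isMeasurableFun.Build _ _ _ _ idR (@measurable_id _ _ setT).

Let ray_rc mu : right_continuous (ray mu).
Proof.
move=> a; apply: fine_cvg; rewrite fineK ?fin_num_measure //.
have := @cdf_right_continuous _ _ _ mu (idR : {RV mu >-> R}) a.
by rewrite /cdf /distribution /pushforward /= preimage_id.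
Qed.

Let ray_ocitv mu a b : a <= b -> mu `]a, b]%classic = (ray mu b - ray mu a)%:E.
Proof.
move=> ab; rewrite EFinB /ray !fineK ?fin_num_measure //.
have : `]a, b]%classic = `]-oo, b] `\` `]-oo, a] => [|->].
  by rewrite -[RHS]setCK setCD setCitvl setUC -[LHS]setCK setCitv.
rewrite measureD ?setIidr //; first exact: subset_itvl.
by rewrite -ge0_fin_numE // fin_num_measure.
Qed.

(** The hypothesis makes [H], the difference of [K] times the distribution function of [nu] and that
    of [mu], nondecreasing. By uniqueness on half-open intervals, [K] times [nu] is then [mu] plus
    the Lebesgue-Stieltjes measure [rho] of [H], whose integrals of nonnegative functions are
    nonnegative. *)
Lemma itv_domination_integral mu nu (K : {nonneg R}) :
  (forall a b : R, a <= b ->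
     (mu `]a, b]%classic <= K%:num%:E * nu `]a, b]%classic)%E) ->
  forall f : R -> \bar R, measurable_fun [set: R] f ->
  (forall x, (0 <= f x)%E) ->
  (\int[mu]_x f x <= K%:num%:E * \int[nu]_x f x)%E.
Proof.
move=> dom f mf f0.
pose FK r := K%:num * ray nu r.
pose H r := FK r - ray mu r.
have FKnd : nondecreasing FK by move=> a b ab; rewrite ler_wpM2l // ray_nd.
have FKrc : right_continuous FK by move=> a; apply: cvgMr; exact: ray_rc.
have Hnd : nondecreasing H.
  move=> a b ab; have := dom _ _ ab; rewrite !ray_ocitv // -EFinM lee_fin /H /FK; lra.
have Hrc : right_continuous H by move=> a; apply: cvgB; [exact: FKrc|exact: ray_rc].
pose FKm := isCumulative.Build R _ R FK FKnd FKrc.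
pose FKc : cumulative R R := HB.pack FK FKm.
pose Hm := isCumulative.Build R _ R H Hnd Hrc.
pose Hc : cumulative R R := HB.pack H Hm.
pose rho := lebesgue_stieltjes_measure Hc.
have ls (C : cumulative R R) (a b : R) : a <= b ->
    lebesgue_stieltjes_measure C `]a, b]%classic = (C b - C a)%:E.
  move=> ab; rewrite /lebesgue_stieltjes_measure /measure_extension /=.
  by rewrite measurable_mu_extE /= ?wlength_itv_bnd //; exact: is_ocitv.
have e1 A : measurable A -> lebesgue_stieltjes_measure FKc A = mscale K nu A.
  move=> mA; apply: lebesgue_stieltjes_measure_unique => // _ [[a b] _ <-] /=.
  have [ab|ba] := leP a b; last first.
    by rewrite set_itv_ge ?measure0 // bnd_simp -leNgt ltW.
  transitivity (FK b - FK a)%:E; first exact: ls.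
  transitivity (K%:num%:E * (ray nu b - ray nu a)%:E)%E.
    by rewrite -EFinM /FK mulrBr.
  by congr (_ * _)%E; exact/esym/ray_ocitv.
have e2 A : measurable A -> lebesgue_stieltjes_measure FKc A = measure_add mu rho A.
  move=> mA; apply: lebesgue_stieltjes_measure_unique => // _ [[a b] _ <-] /=.
  have [ab|ba] := leP a b; last first.
    by rewrite set_itv_ge ?measure0 // bnd_simp -leNgt ltW.
  transitivity (FK b - FK a)%:E; first exact: ls.
  transitivity ((ray mu b - ray mu a)%:E + (H b - H a)%:E)%E.
    by rewrite -EFinD /H; congr EFin; lra.
  apply/esym; apply: (etrans (measure_addE _ _ _)).
  by congr (_ + _)%E; [exact: ray_ocitv|exact: ls].
rewrite -ge0_integral_mscale //.
rewrite (@eq_measure_integral _ _ _ setT (measure_add mu rho) (mscale K nu)); last first.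
  by move=> A mA _; apply: (etrans (esym (e1 _ mA))); exact: e2.
by rewrite ge0_integral_measure_add // leeDl // integral_ge0.
Qed.

End domination.

(** * Variables obtained by inverting a distribution function *)

Section quantile.
Context {R : realType}.
Let P : probability (measurableTypeR R) R := uniform_prob (@ltr01 R).

Lemma uniform_ocitv (a b : R) : 0 <= a <= b -> b <= 1 ->
  P `]a, b]%classic = (b - a)%:E.
Proof.
move=> /andP[a0 ab] b1.
change ((\int[lebesgue_measure]_(x in `]a, b]) (uniform_pdf 0 1 x)%:E)%E = (b - a)%:E).
rewrite (eq_integral (fun=> 1%E)); last first.
  move=> x; rewrite inE /= in_itv /= => /andP[ax xb].
  rewrite /uniform_pdf subr0 invr1 ifT // (le_trans _ (ltW ax)) //=.
  exact: le_trans xb b1.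
rewrite integral_cst //= mul1e lebesgue_measure_itv /= lte_fin.
by case: ltgtP ab => // -> _; rewrite ?subrr.
Qed.

Lemma uniform_oointerval : P `]0, 1[%classic = 1%E.
Proof.
change ((\int[lebesgue_measure]_(x in `]0%R, 1%R[) (uniform_pdf (0 : R) 1 x)%:E)%E = 1%E).
rewrite (eq_integral (fun=> 1%E)); last first.
  move=> x; rewrite inE /= in_itv /= => /andP[ax xb].
  by rewrite /uniform_pdf subr0 invr1 ifT // (ltW ax) ltW.
by rewrite integral_cst //= mul1e lebesgue_measure_itv /= lte_fin ltr01 sube0.
Qed.

Lemma uniform_setI01 (A : set R) : measurable A -> P (A `&` `]0, 1[%classic) = P A.
Proof.
move=> mA; rewrite -[in RHS](setIT A) -(setUv `]0, 1[%classic) setIUr measureU //=.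
- rewrite [X in (_ + X)%E](_ : _ = 0%E) ?adde0 //; apply/eqP.
  rewrite -measure_le0; apply: (@le_trans _ _ (P (~` `]0, 1[%classic))).
    by apply: le_measure; rewrite ?inE //; [apply: measurableI => //|]; exact: measurableC.
  by rewrite probability_setC // uniform_oointerval subee.
- exact: measurableI.
- by apply: measurableI => //; exact: measurableC.
- by rewrite setIACA setICr setI0.
Qed.

Variables (X F : R -> R) (c : R).
Hypothesis X_out : forall u, ~~ (0 < u < 1) -> X u = c.
Hypothesis X_quantile : forall u b, 0 < u < 1 -> (X u <= b) = (u <= F b).

(** The preimage of the open ray above [r] is the part of [(0, 1)] above [F r], together with all or
    nothing of the outside, where [X] is constant. *)
Lemma quantile_measurable : measurable_fun [set: R] X.
Proof.
apply: (measurability (@RGenOInfty.G R)) => [|/= _ [_] [r] -> <-].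
  exact: RGenOInfty.measurableE.
rewrite setTI [X in measurable X](_ : _ =
   (`]0, 1[%classic `&` `]F r, +oo[%classic) `|`
   (if r < c then ~` `]0, 1[%classic else set0)); last first.
  apply/seteqP; split=> u; rewrite /= !in_itv /= !andbT.
    have [u01|u01] := boolP (0 < u < 1).
      by rewrite ltNge X_quantile // -ltNge; left.
    rewrite X_out // => ->; right => /=; rewrite in_itv /=; exact/negP.
  case=> [[u01]|]; first by rewrite ltNge -X_quantile // -ltNge.
  case: ifP => //= rc; rewrite in_itv /= => /negP u01; by rewrite X_out.
apply: measurableU; first exact: measurableI.
by case: ifP => // _; exact: measurableC.
Qed.

Hypothesis F_nd : nondecreasing F.
Hypothesis F01 : forall b, 0 <= F b <= 1.

Lemma quantile_ocitv a b : a <= b ->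
  pushforward P X `]a, b]%classic = (F b - F a)%:E.
Proof.
move=> ab; rewrite /pushforward -uniform_setI01; last first.
  by rewrite -[X in measurable X]setTI; exact: quantile_measurable.
have /andP[Fa0 _] := F01 a; have /andP[_ Fb1] := F01 b.
rewrite -uniform_ocitv ?Fa0 ?F_nd // -[RHS]uniform_setI01 //; congr (P _).
apply/seteqP; split=> u; rewrite /= !in_itv /= => -[/andP[h1 h2] u01].
  by rewrite ltNge -X_quantile // -ltNge h1 -X_quantile // h2.
by rewrite ltNge X_quantile // -ltNge h1 X_quantile // h2.
Qed.

End quantile.

Section quantile_domination.
Context {R : realType}.
Let P : probability (measurableTypeR R) R := uniform_prob (@ltr01 R).
Variables (X F X' F' : R -> R) (c c' : R) (K : {nonneg R}).
Hypothesis X_out : forall u, ~~ (0 < u < 1) -> X u = c.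
Hypothesis X_quantile : forall u b, 0 < u < 1 -> (X u <= b) = (u <= F b).
Hypothesis X'_out : forall u, ~~ (0 < u < 1) -> X' u = c'.
Hypothesis X'_quantile : forall u b, 0 < u < 1 -> (X' u <= b) = (u <= F' b).
Hypothesis F_nd : nondecreasing F.
Hypothesis F01 : forall b, 0 <= F b <= 1.
Hypothesis F'_nd : nondecreasing F'.
Hypothesis F'01 : forall b, 0 <= F' b <= 1.
Hypothesis F_dom : forall a b, a <= b -> F b - F a <= K%:num * (F' b - F' a).

(** Pushing the uniform law forward by [X] and [X'] turns the hypothesis on [F] and [F'] into
    domination of their laws on intervals. *)
Lemma quantile_domination (f : R -> \bar R) : measurable_fun [set: R] f ->
  (forall x, (0 <= f x)%E) ->
  (\int[P]_u f (X u) <= K%:num%:E * \int[P]_u f (X' u))%E.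
Proof.
move=> mf f0.
have mX := quantile_measurable X_out X_quantile.
have mX' := quantile_measurable X'_out X'_quantile.
pose Y : measurableTypeR R -> measurableTypeR R := X.
pose Y' : measurableTypeR R -> measurableTypeR R := X'.
have mY : measurable_fun setT Y by exact: mX.
have mY' : measurable_fun setT Y' by exact: mX'.
pose Ym := isMeasurableFun.Build _ _ _ _ Y mY.
pose Xp : {mfun measurableTypeR R >-> measurableTypeR R} := HB.pack Y Ym.
pose Y'm := isMeasurableFun.Build _ _ _ _ Y' mY'.
pose X'p : {mfun measurableTypeR R >-> measurableTypeR R} := HB.pack Y' Y'm.
have -> : (\int[P]_u f (X u) = \int[distribution P Xp]_y f y)%E.
  by apply/esym; exact: (@ge0_integral_distribution _ _ _ _ _ P Xp f mf f0).
have -> : (\int[P]_u f (X' u) = \int[distribution P X'p]_y f y)%E.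
  by apply/esym; exact: (@ge0_integral_distribution _ _ _ _ _ P X'p f mf f0).
apply: itv_domination_integral => // a b ab.
have := quantile_ocitv X_out X_quantile F_nd F01 ab.
have := quantile_ocitv X'_out X'_quantile F'_nd F'01 ab.
move=> e' e; apply: (@le_trans _ _ (F b - F a)%:E); first by rewrite -e.
apply: (@le_trans _ _ (K%:num%:E * (F' b - F' a)%:E)%E).
  by rewrite -EFinM lee_fin F_dom.
by rewrite -e'.
Qed.

End quantile_domination.

(** * Selection of a level *)

Section selection.
Context {R : realType}.
Implicit Types (e : nat -> R) (p : R).

(* The selection variable [p] ranges over [0, 1); piece [i] is
   [brk i, brk (i + 1)), so that [p / (1 - p)] lies in [i, i + 1) there. *)
Definition brk (i : nat) : R := i%:R / i.+1%:R.

Lemma brk0 : brk 0 = 0. Proof. by rewrite /brk mul0r. Qed.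

Lemma brk_lt1 i : brk i < 1.
Proof. by rewrite /brk ltr_pdivrMr ?ltr0n // mul1r ltr_nat. Qed.

Lemma brk_ge0 i : 0 <= brk i.
Proof. by rewrite /brk divr_ge0. Qed.

Lemma brkB i : brk i.+1 - brk i = (i.+1%:R * i.+2%:R)^-1.
Proof.
rewrite /brk -(natr1 i.+1) -(natr1 i); have : 0 <= i%:R :> R by rewrite ler0n.
move: (i%:R) => x x0.
have h1 : x + 1 != 0 by lra. have h2 : x + 1 + 1 != 0 by lra.
by field; rewrite h1 h2.
Qed.

Lemma brk_ltS i : brk i < brk i.+1.
Proof. by rewrite -subr_gt0 brkB invr_gt0 mulr_gt0 ?ltr0n. Qed.

Lemma brk_le i j : (i <= j)%N -> brk i <= brk j.
Proof.
elim: j => [|j IH]; first by rewrite leqn0 => /eqP ->.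
rewrite leq_eqVlt => /orP[/eqP -> //|]; rewrite ltnS => /IH h.
exact: le_trans h (ltW (brk_ltS j)).
Qed.

Lemma brk_odds i p : p < 1 -> (brk i <= p) = (i%:R <= p / (1 - p)).
Proof.
move=> p1; rewrite /brk ler_pdivrMr ?ltr0n // ler_pdivlMr ?subr_gt0 //.
by rewrite -natr1; apply/idP/idP; lra.
Qed.

(** The length of the part of [[lo, hi]] that lies below [p]. *)
Definition len (lo hi p : R) : R := Num.max 0 (Num.min p hi - lo).

Lemma len_nd lo hi : nondecreasing (len lo hi).
Proof.
move=> p q pq; rewrite /len /Num.max /Num.min.
by do ![case: ifPn]; rewrite -?leNgt; lra.
Qed.

Lemma len_below lo hi p : p <= lo -> len lo hi p = 0.
Proof. by rewrite /len /Num.max /Num.min => ?; do ![case: ifPn]; rewrite -?leNgt; lra. Qed.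

Lemma len_above lo hi p : lo <= hi -> hi <= p -> len lo hi p = hi - lo.
Proof. by rewrite /len /Num.max /Num.min => ??; do ![case: ifPn]; rewrite -?leNgt; lra. Qed.

Lemma len_mid lo hi p : lo <= p -> p <= hi -> len lo hi p = p - lo.
Proof. by rewrite /len /Num.max /Num.min => ??; do ![case: ifPn]; rewrite -?leNgt; lra. Qed.

Lemma len_split lo mid hi p : lo <= mid -> mid <= hi ->
  len lo mid p + len mid hi p = len lo hi p.
Proof. by rewrite /len /Num.max /Num.min => ??; do ![case: ifPn]; rewrite -?leNgt; lra. Qed.

(** Unnormalized distribution function of the selection variable. The last term gives density [e J]
    to the whole remainder up to 1, which stands for infinitely many levels of equal weight. *)
Definition mass e (J : nat) p : R :=
  \sum_(i < J) e i * len (brk i) (brk i.+1) p + e J * len (brk J) 1 p.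

Lemma mass_cst c J p : mass (fun=> c) J p = c * len 0 1 p.
Proof.
rewrite /mass -mulr_sumr -mulrDr; congr (_ * _).
elim: J => [|J IH]; first by rewrite big_ord0 add0r brk0.
rewrite big_ord_recr /= -addrA len_split //; first exact/ltW/brk_ltS.
exact/ltW/brk_lt1.
Qed.

Lemma massS e J p : e J.+1 = e J -> mass e J.+1 p = mass e J p.
Proof.
move=> h; rewrite /mass big_ord_recr /= h -addrA -mulrDr len_split //.
  exact/ltW/brk_ltS.
exact/ltW/brk_lt1.
Qed.

(** Graphs of different sizes come with different [J]; this brings them to a common number of
    pieces. *)
Lemma mass_extend e J d p : (forall i, (J <= i)%N -> e i = e J) ->
  mass e (J + d) p = mass e J p.
Proof.
move=> h; elim: d => [|d IH]; first by rewrite addn0.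
by rewrite addnS massS // !h ?leq_addr // -addnS leq_addr.
Qed.

Lemma mass_dom e e' k J a b : (forall i, (i <= J)%N -> e i <= k * e' i) -> a <= b ->
  mass e J b - mass e J a <= k * (mass e' J b - mass e' J a).
Proof.
move=> h ab.
have E f : mass f J b - mass f J a =
    \sum_(i < J) f i * (len (brk i) (brk i.+1) b - len (brk i) (brk i.+1) a)
    + f J * (len (brk J) 1 b - len (brk J) 1 a).
  rewrite /mass opprD addrACA -sumrB -mulrBr; congr (_ + _).
  by apply: eq_bigr => i _; rewrite mulrBr.
have l0 lo hi : 0 <= len lo hi b - len lo hi a by rewrite subr_ge0 len_nd.
rewrite !E [leRHS]mulrDr; apply: lerD; last by rewrite mulrA ler_wpM2r // h.
rewrite mulr_sumr; apply: ler_sum => i _.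
by rewrite mulrA ler_wpM2r // h // ltnW.
Qed.

(** Inversion of [mass] by walking over the pieces: [m] bounds the steps left, [i] is the current
    piece, [t] the mass still to be spent. The loop [walk] of the program computes it. *)
Fixpoint sel e (m i : nat) (t : R) : nat * R :=
  if m is m'.+1 then
    if e i * (brk i.+1 - brk i) <= t then sel e m' i.+1 (t - e i * (brk i.+1 - brk i))
    else (i, t)
  else (i, t).

Lemma selP e m i t : 0 <= t ->
  let r := sel e m i t in
  [/\ (i <= r.1 <= i + m)%N, 0 <= r.2,
      ((r.1 < i + m)%N -> r.2 < e r.1 * (brk r.1.+1 - brk r.1)) &
      t = \sum_(i <= j < r.1) e j * (brk j.+1 - brk j) + r.2].
Proof.
elim: m i t => [|m IH] i t t0 /=.
  by rewrite addn0 leqnn ltnn big_geq // add0r.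
case: (leP (e i * (brk i.+1 - brk i)) t) => h; last first.
  by rewrite leqnn leq_addr /= big_geq // add0r.
have t1 : 0 <= t - e i * (brk i.+1 - brk i) by rewrite subr_ge0.
have [/andP[h1 h2] h3 h4 h5] := IH i.+1 _ t1.
split=> //; first by rewrite ltnW //= -addSnnS.
  by rewrite -addSnnS.
rewrite big_ltn // -addrA -h5; lra.
Qed.

(* Samples outside (0, 1) have probability zero, but the program must also halt
   on the samples 0 and 1. *)
Definition guard (u : R) : R := if 0 < u < 1 then u else 2^-1.

Lemma guard01 u : 0 < guard u < 1.
Proof. by rewrite /guard; case: ifPn => // _; lra. Qed.

Definition pick_piece e J u := sel e J 0 (guard u * mass e J 1).

(** The density is constant on the piece reached, so the mass left divided by it is the length
    left. *)
Definition pick e J u : R :=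
  let r := pick_piece e J u in brk r.1 + r.2 / e r.1.

Section pick.
Variables (e : nat -> R) (J : nat).
Hypothesis e_gt0 : forall i, 0 < e i.

Lemma mass0 p : p <= 0 -> mass e J p = 0.
Proof.
move=> p0; rewrite /mass big1 ?len_below ?mulr0 ?addr0 //.
  exact: le_trans p0 (brk_ge0 _).
by move=> i _; rewrite len_below ?mulr0 // (le_trans p0) ?brk_ge0.
Qed.

Lemma mass_nd : nondecreasing (mass e J).
Proof.
move=> a b ab; have := @mass_dom (fun=> 0) e 1 J a b; rewrite !mass_cst => h.
have : 0 * len 0 1 b - 0 * len 0 1 a <= 1 * (mass e J b - mass e J a).
  by apply: h => // i _; rewrite mul1r ltW.
lra.
Qed.

Lemma mass1E : mass e J 1 =
  \sum_(i < J) e i * (brk i.+1 - brk i) + e J * (1 - brk J).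
Proof.
rewrite /mass; congr (_ + _).
  apply: eq_bigr => i _; rewrite len_above //; first exact/ltW/brk_ltS.
  exact/ltW/brk_lt1.
rewrite len_above //; exact/ltW/brk_lt1.
Qed.

Lemma mass1_gt0 : 0 < mass e J 1.
Proof.
rewrite mass1E; apply: ltr_wpDl; last by rewrite mulr_gt0 // subr_gt0 brk_lt1.
by apply: sumr_ge0 => i _; rewrite mulr_ge0 ?ltW // subr_gt0 brk_ltS.
Qed.

Lemma mass_ge1 p : 1 <= p -> mass e J p = mass e J 1.
Proof.
move=> p1; rewrite /mass; congr (_ + _).
  apply: eq_bigr => i _; have h := ltW (brk_lt1 i.+1); have l := ltW (brk_ltS i).
  by rewrite !(len_above l) // (le_trans h).
by rewrite !(len_above (ltW (brk_lt1 J))).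
Qed.

Lemma mass_01 p : 0 <= mass e J p / mass e J 1 <= 1.
Proof.
have Z0 := mass1_gt0.
have m0 : 0 <= mass e J p.
  have [p0|/ltW p0] := leP p 0; first by rewrite mass0.
  by rewrite -(mass0 (lexx 0)) mass_nd.
rewrite divr_ge0 ?(ltW Z0) //= ler_pdivrMr // mul1r.
have [p1|/ltW p1] := leP p 1; first exact: mass_nd.
by rewrite mass_ge1.
Qed.

Lemma mass_strict a b : a < b -> 0 < b <= 1 -> mass e J a < mass e J b.
Proof.
move=> ab /andP[b0 b1].
(* A common lower bound on finitely many densities reduces the strict inequality to a constant
   density. *)
have [c c0 ce] : exists2 c, 0 < c & forall i, (i <= J)%N -> c <= e i.
  elim: J => [|m [c c0 ce]].
    by exists (e 0%N) => // i; rewrite leqn0 => /eqP ->.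
  exists (Num.min c (e m.+1)); first by rewrite lt_min c0 e_gt0.
  move=> i; rewrite leq_eqVlt => /orP[/eqP ->|/ce h]; rewrite ge_min ?lexx ?orbT //.
  by rewrite h.
have := @mass_dom (fun=> c) e 1 J a b; rewrite !mass_cst => h.
have {}h : c * len 0 1 b - c * len 0 1 a <= 1 * (mass e J b - mass e J a).
  by apply: h; [move=> i iJ; rewrite mul1r ce|exact: ltW].
have : len 0 1 a < len 0 1 b.
  rewrite (len_mid (ltW b0)) // subr0; have [a0|/ltW a0] := leP a 0.
    by rewrite len_below.
  by rewrite len_mid ?subr0 // (le_trans (ltW ab)).
move=> l; have : c * len 0 1 a < c * len 0 1 b by rewrite ltr_pM2l.
lra.
Qed.

Lemma pickP u : let i := (pick_piece e J u).1 in
  [/\ (i <= J)%N, brk i <= pick e J u < 1,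
     (i < J)%N -> pick e J u < brk i.+1 &
     mass e J (pick e J u) = guard u * mass e J 1].
Proof.
have /andP[g0 g1] := guard01 u; have Z0 := mass1_gt0.
rewrite /pick; move: (selP e J 0 (mulr_ge0 (ltW g0) (ltW Z0))).
rewrite -/(pick_piece e J u); case: (pick_piece e J u) => i t /=.
rewrite add0n => -[iJ t0 tlt teq].
have ei := e_gt0 i; have te : e i * (t / e i) = t by rewrite mulrC divfK // gt_eqF.
have te0 : 0 <= t / e i by rewrite divr_ge0 // ltW.
have big j : (j < i)%N -> brk j.+1 <= brk i + t / e i.
  by move=> ji; rewrite -[leLHS]addr0 lerD // brk_le.
have mid : (i < J)%N -> brk i + t / e i < brk i.+1.
  by move=> /tlt; rewrite -ltrBrDl ltr_pdivrMr // mulrC.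
(* At piece [J] the walk stops for want of steps; there it is [guard u < 1] that keeps the point
   below 1. *)
have last : i = J -> brk i + t / e i < 1.
  move=> iE; rewrite -ltrBrDl ltr_pdivrMr // mulrC iE.
  have : guard u * mass e J 1 < mass e J 1 by rewrite gtr_pMl.
  rewrite teq mass1E iE big_mkord; lra.
have lt1 : brk i + t / e i < 1.
  have [/mid h|] := ltnP i J; first exact: lt_trans h (brk_lt1 _).
  by move=> Ji; apply: last; apply/eqP; rewrite eqn_leq iJ.
split=> //; first by rewrite lerDl te0.
rewrite teq /mass; have [iJ'|Ji] := ltnP i J; last first.
  have iE : i = J by apply/eqP; rewrite eqn_leq iJ.
  rewrite iE in big lt1 te te0 *; rewrite big_mkord; congr (_ + _).
    by apply: eq_bigr => j _; rewrite len_above ?big // ltW ?brk_ltS.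
  by rewrite len_mid ?lerDl ?(ltW lt1) // addrC addKr.
rewrite (@len_below (brk J)) ?mulr0 ?addr0; last first.
  by apply: ltW; apply: lt_le_trans (mid iJ') (brk_le _).
rewrite -(big_mkord xpredT (fun j => e j * len (brk j) (brk j.+1) (brk i + t / e i))).
rewrite (big_cat_nat (n := i)) //=; congr (_ + _).
  by rewrite !big_nat; apply: eq_bigr => j /andP[_ ji]; rewrite len_above ?big // ltW ?brk_ltS.
rewrite big_ltn // len_mid ?lerDl ?(ltW (mid iJ')) // [_ - brk i]addrC addKr te.
rewrite big_nat big1 ?addr0 // => j /andP[ij jJ].
by rewrite len_below ?mulr0 // (le_trans (ltW (mid iJ'))) // brk_le.
Qed.

Lemma pick_quantile u b : 0 < u < 1 ->
  (pick e J u <= b) = (u <= mass e J b / mass e J 1).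
Proof.
move=> u01; have [_ /andP[pl pr] _ mE] := pickP u.
have Z0 := mass1_gt0; have gE : guard u = u by rewrite /guard u01.
rewrite ler_pdivlMr // -[X in X * _]gE -mE; apply/idP/idP; first exact: mass_nd.
apply: contraTT; rewrite -!ltNge => bp; apply: mass_strict => //.
rewrite (ltW pr) andbT ltNge; apply/negP => /mass0 m0.
have /andP[u0 _] := u01; move: mE; rewrite m0 gE => /esym/eqP.
by rewrite gt_eqF // mulr_gt0.
Qed.

Lemma pick_out u : ~~ (0 < u < 1) -> pick e J u = pick e J 0.
Proof.
move=> u01; rewrite /pick /pick_piece; suff -> : guard u = guard 0 by [].
by rewrite /guard (negbTE u01) ltxx.
Qed.

End pick.

Section step_function.
Variable a : nat -> R.

Fixpoint stepf (J : nat) p : R :=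
  if J is J'.+1 then if brk J <= p then a J else stepf J' p else a 0%N.

Lemma stepf_piece J i p : (i <= J)%N -> brk i <= p ->
  ((i < J)%N -> p < brk i.+1) -> stepf J p = a i.
Proof.
elim: J => [|J IH] /=; first by rewrite leqn0 => /eqP ->.
rewrite leq_eqVlt => /orP[/eqP -> -> //|]; rewrite ltnS => iJ ip /(_ iJ) pi.
rewrite leNgt (lt_le_trans pi) ?brk_le //=; exact: IH.
Qed.

Lemma stepf_extend J d p : (forall i, (J <= i)%N -> a i = a J) ->
  stepf (J + d) p = stepf J p.
Proof.
move=> h; elim: d => [|d IH]; first by rewrite addn0.
rewrite addnS /= IH; case: ifP => // hp; rewrite h -?addnS ?leq_addr //.
case: J h hp {IH} => // J h hp; rewrite /= ifT //; apply: le_trans hp.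
by apply: brk_le; rewrite -addnS leq_addr.
Qed.

Lemma measurable_stepf J : measurable_fun [set: R] (stepf J).
Proof.
elim: J => [|J IH] /=; first exact: measurable_cst.
by apply: measurable_fun_ifT => //; apply: measurable_fun_ler.
Qed.

End step_function.

(** On piece [i] the odds [p / (1 - p)] are at least [i], so a sensitivity proportional to [2 ^+ i]
    is covered by a noise scale that depends on [p] alone and is thus the same for both inputs. *)
Lemma stepf_dist a a' J c p : 0 <= c -> 0 <= p < 1 ->
  (forall i, `|a i - a' i| <= c * 2 ^+ i) ->
  `|stepf a J p - stepf a' J p| <= c * 2 `^ (p / (1 - p)).
Proof.
move=> c0 /andP[p0 p1] h.
have aux i : brk i <= p -> `|a i - a' i| <= c * 2 `^ (p / (1 - p)).
  rewrite brk_odds // => ip; apply: le_trans (h i) _; rewrite ler_wpM2l //.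
  by rewrite -powR_mulrn // ler_powR // ler1n.
elim: J => [|J IH] /=; first by apply: aux; rewrite brk0.
by case: ifP => // /aux.
Qed.

End selection.

(** * The mechanism *)

Section logistic.
Context {R : realType}.

(** The logit, quantile function of the standard logistic distribution. *)
Definition noise (v : R) : R := ln (v / (1 - v)).

Definition logistic (z : R) : R := (1 + expR (- z))^-1.

Lemma logistic01 z : 0 < logistic z < 1.
Proof.
have h := expR_gt0 (- z); rewrite /logistic invr_gt0 invf_lt1; lra.
Qed.

(** By the conventions that [ln] vanishes on nonpositive reals and that the inverse of 0 is 0. *)
Lemma noise_out v : ~~ (0 < v < 1) -> noise v = 0.
Proof.
rewrite negb_and -!leNgt /noise => /orP[v0|v1]; apply: ln0.
  by rewrite mulr_le0_ge0 // invr_ge0; lra.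
have [->|v1'] := eqVneq v 1; first by rewrite subrr invr0 mulr0.
by rewrite mulr_ge0_le0 ?invr_le0; lra.
Qed.

Lemma noise_quantile v z : 0 < v < 1 -> (noise v <= z) = (v <= logistic z).
Proof.
move=> /andP[v0 v1]; have q0 : 0 < v / (1 - v) by rewrite divr_gt0 // subr_gt0.
rewrite /noise -ler_expR lnK ?posrE // ler_pdivrMr ?subr_gt0 //.
have h := expR_gt0 z; have -> : logistic z = expR z / (1 + expR z).
  by rewrite /logistic expRN; field; rewrite !gt_eqF //; lra.
by rewrite ler_pdivlMr; [apply/idP/idP; lra|lra].
Qed.

Lemma logistic_nd : nondecreasing logistic.
Proof.
move=> x y xy; rewrite /logistic lef_pV2 ?posrE ?addr_gt0 ?expR_gt0 //.
by rewrite lerD2l ler_expR lerN2.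
Qed.

(** Privacy of logistic noise: a translation by at most [s] changes the density by a factor at most
    [expR s], here in integrated form. *)
Lemma logistic_shift z1 z2 t s : z1 <= z2 -> `|t| <= s ->
  logistic z2 - logistic z1 <= expR s * (logistic (z2 + t) - logistic (z1 + t)).
Proof.
move=> z12 ts; rewrite /logistic !opprD !expRD.
have E2 := expR_gt0 (- z2); have c0 := expR_gt0 (- t).
have E12 : expR (- z2) <= expR (- z1) by rewrite ler_expR lerN2.
have Sc : expR (- t) <= expR s.
  by rewrite ler_expR; apply: le_trans ts; rewrite -normrN ler_norm.
have cS : 1 <= expR s * expR (- t).
  rewrite -expRD -[leLHS]expR0 ler_expR subr_ge0; exact: le_trans (ler_norm _) ts.
have S0 := expR_gt0 s.
move: (expR (- z2)) (expR (- z1)) (expR (- t)) (expR s) E2 E12 c0 Sc cS S0.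
(* [a], [b], [c], [S] are the exponentials of [- z1], [- z2], [- t], [s]. Once [a - b] is factored
   out, the claim is [(1 + a c) (1 + b c) <= S c (1 + a) (1 + b)]. *)
move=> b a c S b0 ab c0 cS Sc S0.
have a0 : 0 < a by exact: lt_le_trans ab.
have ac : 0 < a * c by exact: mulr_gt0.
have bc : 0 < b * c by exact: mulr_gt0.
have -> : (1 + b)^-1 - (1 + a)^-1 = (a - b) * ((1 + a) * (1 + b))^-1.
  by field; rewrite !gt_eqF //; lra.
have -> : S * ((1 + b * c)^-1 - (1 + a * c)^-1) =
    (a - b) * (S * c / ((1 + a * c) * (1 + b * c))).
  by field; rewrite !gt_eqF //; lra.
rewrite ler_wpM2l ?subr_ge0 // ler_pdivlMr ?mulr_gt0 //; [|lra|lra].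
rewrite mulrC ler_pdivrMr; last by apply: mulr_gt0; lra.
have SS : 1 <= S.
  rewrite leNgt; apply/negP => S1; have : S * c < 1 by nra.
  lra.
(* The left side is at most [max(1, c)^2 (1 + a) (1 + b)], and both 1 and [c^2] are at most
   [S c]. *)
have [c1|c1] := leP 1 c.
  have h1 : 1 + a * c <= c * (1 + a) by lra.
  have h2 : 1 + b * c <= c * (1 + b) by lra.
  have h3 : (1 + a * c) * (1 + b * c) <= (c * (1 + a)) * (c * (1 + b)).
    by apply: ler_pM => //; lra.
  apply: le_trans h3 _; rewrite [leLHS](_ : _ = c * c * ((1 + a) * (1 + b))); last by ring.
  apply: ler_wpM2r; first by apply: mulr_ge0; lra.
  by rewrite ler_wpM2r // ltW.
apply: le_trans (_ : (1 + a) * (1 + b) <= _).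
  by apply: ler_pM; nra.
by rewrite ler_peMl //; apply: mulr_ge0; lra.
Qed.

Lemma measurable_noise : measurable_fun [set: R] noise.
Proof. exact: (quantile_measurable noise_out noise_quantile). Qed.

End logistic.

(** Away from 0 the inverse is, up to sign, the exponential of minus a logarithm. *)
Lemma measurable_invr {R : realType} : measurable_fun [set: R] (fun x : R => x^-1).
Proof.
have -> : (fun x : R => x^-1) = (fun x => if 0 <= x then
    (if x <= 0 then 0 else expR (- ln x)) else - expR (- ln (- x))).
  apply/funext => x; have [x0|x0|<-] := ltgtP 0 x; last by rewrite invr0.
    by rewrite expRN lnK ?posrE.
  by rewrite expRN lnK ?invrN ?opprK // posrE oppr_gt0.
have me (f : R -> R) : measurable_fun [set: R] f ->
    measurable_fun [set: R] (fun x => expR (- ln (f x))).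
  by move=> mf; do 3 ?[apply: measurableT_comp => //].
apply: measurable_fun_ifT; first exact: measurable_fun_ler.
  by apply: measurable_fun_ifT; [exact: measurable_fun_ler| |exact: me].
by apply: measurableT_comp => //; apply: me.
Qed.

(** * Privacy of a selection followed by noise *)

Section mechanism.
Context {R : realType}.
Let P : probability (measurableTypeR R) R := uniform_prob (@ltr01 R).

(** The constant 4 is twice the sensitivity 2 of a level in units of [2 ^ i], so the noise spends
    half of the privacy budget. *)
Definition scale (eps p : R) : R := 4 / eps * 2 `^ (p / (1 - p)).

Definition release (a : nat -> R) J (eps p v : R) : R :=
  stepf a J p + scale eps p * noise v.

Definition release_prob a J eps (A : set R) (p : R) : \bar R :=
  (\int[P]_v (\1_A (release a J eps p v))%:E)%E.

Definition mech_prob e a J eps (A : set R) : \bar R :=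
  (\int[P]_u release_prob a J eps A (pick e J u))%E.

Lemma scale_gt0 eps p : 0 < eps -> 0 < scale eps p.
Proof. by move=> e0; rewrite mulr_gt0 ?divr_gt0 ?powR_gt0. Qed.

Lemma measurable_scale eps : measurable_fun [set: R] (scale eps).
Proof.
apply: measurable_funM => //; apply: (measurableT_comp (measurable_powRr 2)).
apply: measurable_funM => //; apply: measurableT_comp; first exact: measurable_invr.
exact: measurable_funB.
Qed.

Section fixed_input.
Variables (a : nat -> R) (J : nat) (eps : R) (A : set R).
Hypothesis mA : measurable A.

Lemma release_prob_ge0 p : (0 <= release_prob a J eps A p)%E.
Proof. by apply: integral_ge0 => v _; rewrite lee_fin. Qed.

Lemma measurable_release_prob : measurable_fun [set: R] (release_prob a J eps A).
Proof.
pose f (x : R * R) : \bar R := (\1_A (release a J eps x.1 x.2))%:E.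
apply: (@measurable_fun_fubini_tonelli_F _ _ _ _ _ P f) => //; last first.
  by move=> x; rewrite lee_fin.
apply/measurable_EFinP; apply: measurableT_comp; first exact: measurable_indic.
apply: measurable_funD; first exact: measurableT_comp (measurable_stepf _ _) _.
by apply: measurable_funM; apply: measurableT_comp => //;
  [exact: measurable_scale|exact: measurable_noise].
Qed.

End fixed_input.

Lemma release_private a a' J J' eps (A : set R) p : 0 < eps -> measurable A ->
  `|stepf a J p - stepf a' J' p| <= 2 * 2 `^ (p / (1 - p)) ->
  (release_prob a J eps A p <= (expR (eps / 2))%:E * release_prob a' J' eps A p)%E.
Proof.
move=> e0 mA h.
have b0 := scale_gt0 p e0.
have K0 : 0 <= expR (eps / 2) by rewrite ltW // expR_gt0.
have q c v b : 0 < v < 1 ->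
    (c + scale eps p * noise v <= b) = (v <= logistic ((b - c) / scale eps p)).
  move=> v01; rewrite -noise_quantile // ler_pdivlMr //.
  by apply/idP/idP; lra.
have o c v : ~~ (0 < v < 1) -> c + scale eps p * noise v = c.
  by move=> /noise_out ->; rewrite mulr0 addr0.
have nd c : nondecreasing (fun b => logistic ((b - c) / scale eps p)).
  by move=> x y xy; apply: logistic_nd; rewrite ler_pM2r ?invr_gt0 // lerD2r.
have l01 c b : 0 <= logistic ((b - c) / scale eps p) <= 1.
  by have /andP[/ltW -> /ltW ->] := logistic01 ((b - c) / scale eps p).
apply: (@quantile_domination _ _ _ _ _ _ _ (NngNum K0)
  (o (stepf a J p)) (q (stepf a J p)) (o (stepf a' J' p)) (q (stepf a' J' p))
  _ _ _ _ _ (fun x => (\1_A x)%:E)) => //.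
- move=> x y xy /=.
  pose t := (stepf a J p - stepf a' J' p) / scale eps p.
  have E z : (z - stepf a' J' p) / scale eps p = (z - stepf a J p) / scale eps p + t.
    by rewrite /t -mulrDl; congr (_ / _); lra.
  rewrite !E; apply: logistic_shift.
    by rewrite ler_pM2r ?invr_gt0 // lerD2r.
  rewrite /t normrM normfV (gtr0_norm b0) ler_pdivrMr // (le_trans h) //.
  rewrite /scale mulrA [leRHS](_ : _ = 2 * 2 `^ (p / (1 - p))) //.
  by field; rewrite gt_eqF.
- by apply/measurable_EFinP; exact: measurable_indic.
Qed.

(** Selection and noise cost [eps / 2] each. In the selection, [eps / 4] pays for the weights and
    [eps / 4] for the total mass. The law of the selected point is exchanged first, then the law of
    the release at a common point. *)
Lemma mech_private e e' a a' J J' eps (A : set R) : 0 < eps -> measurable A ->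
  (forall i, 0 < e i) -> (forall i, 0 < e' i) ->
  (forall i, (J <= i)%N -> e i = e J) -> (forall i, (J' <= i)%N -> e' i = e' J') ->
  (forall i, (J <= i)%N -> a i = a J) -> (forall i, (J' <= i)%N -> a' i = a' J') ->
  (forall i, e i <= expR (eps / 4) * e' i) ->
  (forall i, e' i <= expR (eps / 4) * e i) ->
  (forall i, `|a i - a' i| <= 2 * 2 ^+ i) ->
  (mech_prob e a J eps A <= (expR eps)%:E * mech_prob e' a' J' eps A)%E.
Proof.
move=> e0 mA pe pe' ce ce' ca ca' ee' e'e aa'.
have K0 : 0 <= expR (eps / 2) by rewrite ltW // expR_gt0.
have mE p : mass e J p = mass e (J + J') p by rewrite mass_extend.
have mE' p : mass e' J' p = mass e' (J + J') p by rewrite addnC mass_extend.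
have Z0 := mass1_gt0 J pe; have Z0' := mass1_gt0 J' pe'.
have mech1 : (mech_prob e a J eps A <=
    (expR (eps / 2))%:E * \int[P]_u release_prob a J eps A (pick e' J' u))%E.
  apply: (@quantile_domination _ _ _ _ _ _ _ (NngNum K0)
    (@pick_out _ e J) (pick_quantile J pe)
    (@pick_out _ e' J') (pick_quantile J' pe')
    _ _ _ _ _ (release_prob a J eps A)).
  - by move=> x y xy; rewrite ler_pM2r ?invr_gt0 // mass_nd.
  - by move=> b; exact: mass_01.
  - by move=> x y xy; rewrite ler_pM2r ?invr_gt0 // mass_nd.
  - by move=> b; exact: mass_01.
  - move=> x y xy /=; rewrite -!mulrBl.
    have h1 := mass_dom (fun i (_ : (i <= J + J')%N) => ee' i) xy.
    have h2 := mass_dom (fun i (_ : (i <= J + J')%N) => e'e i) (@ler01 R).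
    move: h1 h2; rewrite -!mE -!mE' (@mass0 _ e J 0) // (@mass0 _ e' J' 0) // !subr0.
    have -> : expR (eps / 2) = expR (eps / 4) * expR (eps / 4).
      by rewrite -expRD; congr expR; lra.
    have k0 := expR_gt0 (eps / 4).
    have := mass_nd J pe xy; have := mass_nd J' pe' xy.
    move: (mass e J 1) (mass e' J' 1) Z0 Z0' (expR (eps / 4)) k0 => Z Z' Z0 Z0' k k0.
    move: (mass e J y) (mass e J x) (mass e' J' y) (mass e' J' x) => m2 m1 m2' m1'.
    move=> d' d h1 h2; rewrite ler_pdivrMr //.
    apply: le_trans h1 _.
    have -> : k * k * ((m2' - m1') / Z') * Z = k * (m2' - m1') * (k * Z / Z') by ring.
    rewrite ler_peMr // ?ler_pdivlMr ?mul1r //.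
    by rewrite mulr_ge0 ?subr_ge0 // ltW.
  - exact: measurable_release_prob.
  - by move=> x; exact: release_prob_ge0.
apply: le_trans mech1 _.
have -> : expR eps = expR (eps / 2) * expR (eps / 2).
  by rewrite -expRD; congr expR; lra.
rewrite EFinM -muleA lee_pmul2l ?lte_fin ?expR_gt0 // /mech_prob.
have mp : measurable_fun [set: R] (pick e' J').
  exact: (quantile_measurable (@pick_out _ e' J') (pick_quantile J' pe')).
rewrite -ge0_integralZl //=; first last.
- by move=> u _; exact: release_prob_ge0.
- by apply: measurableT_comp mp; exact: measurable_release_prob.
apply: ge0_le_integral => //=.
- by move=> u _; exact: release_prob_ge0.
- by apply: measurableT_comp mp; exact: measurable_release_prob.
- apply: measurable_funeM; apply: measurableT_comp mp; exact: measurable_release_prob.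
move=> u _; apply: release_private => //.
rewrite -(stepf_extend (a := a) J' (pick e' J' u) ca).
rewrite -(stepf_extend (a := a') J (pick e' J' u) ca') addnC.
apply: stepf_dist => //.
have [_ /andP[h1 ->] _ _] := pickP J' pe' u.
by rewrite (le_trans _ h1) // brk_ge0.
Qed.

End mechanism.

(** * Accuracy of the mechanism *)

Section accuracy.
Context {R : realType}.
Let P : probability (measurableTypeR R) R := uniform_prob (@ltr01 R).

Lemma uniform_ccitv (x y : R) : x <= y -> (P `[x, y]%classic <= (y - x)%:E)%E.
Proof.
move=> xy; change (\int[lebesgue_measure]_(t in `[x, y]) (uniform_pdf 0 1 t)%:E
  <= (y - x)%:E)%E.
apply: (@le_trans _ _ (\int[lebesgue_measure]_(t in `[x, y]) 1)%E).
  apply: ge0_le_integral => //=.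
  - by move=> t _; rewrite lee_fin uniform_pdf_ge0.
  - by apply/measurable_EFinP; apply: measurable_funTS; exact: measurable_uniform_pdf.
  - move=> t _; rewrite lee_fin /uniform_pdf subr0 invr1; by case: ifP.
rewrite integral_cst //= mul1e lebesgue_measure_itv /= lte_fin.
by case: ltgtP xy => // -> _; rewrite subrr.
Qed.

Variables (e a : nat -> R) (J : nat) (eps : R) (A : set R) (good : pred nat).
Variables (i0 : nat) (beta l : R).
Hypotheses (mA : measurable A) (e_gt0 : forall i, 0 < e i).
Hypotheses (i0J : (i0 <= J)%N) (e_i0 : 1 <= e i0) (l_ge0 : 0 <= l).
Hypothesis e_bad : forall i, (i <= J)%N -> ~~ good i -> e i <= beta.
Hypothesis A_good : forall i p v, (i <= J)%N -> good i -> brk i <= p < 1 ->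
  ((i < J)%N -> p < brk i.+1) -> `|noise v| <= l -> A (a i + scale eps p * noise v).
Hypothesis beta_ge0 : 0 <= beta.

Let Z := mass e J 1.
(** [w i] is the width of piece [i], the last one reaching 1, and [start i] the mass before it, so
    that [bad_itv i] contains the samples selecting a bad piece [i]. *)
Let w i : R := if (i < J)%N then brk i.+1 - brk i else 1 - brk J.
Let start i : R := \sum_(0 <= j < i) e j * (brk j.+1 - brk j).
Let bad_itv i : set R :=
  if good i then set0 else `[start i / Z, (start i + e i * w i) / Z]%classic.

Let Z_gt0 : 0 < Z. Proof. exact: mass1_gt0. Qed.

Let w_ge0 i : 0 <= w i.
Proof.
by rewrite /w; case: ifP => _; rewrite subr_ge0 ltW // ?brk_ltS ?brk_lt1.
Qed.

Let sum_w : \sum_(i < J.+1) w i = 1.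
Proof.
have := @mass_cst R 1 J 1; rewrite mul1r len_mid // ?ler01 // subr0 mass1E => <-.
rewrite big_ord_recr /= /w ltnn mul1r; congr (_ + _).
by apply: eq_bigr => i _; rewrite ltn_ord mul1r.
Qed.

(** The single piece [i0], of weight at least 1, already has this mass. *)
Let Z_ge : (i0.+1%:R * i0.+2%:R)^-1 <= Z.
Proof.
have key : (i0.+1%:R * i0.+2%:R)^-1 <= e i0 * w i0.
  rewrite -brkB; apply: le_trans (_ : w i0 <= _).
    rewrite /w; case: ltnP => // Ji; have -> : i0 = J by apply/eqP; rewrite eqn_leq i0J.
    by rewrite lerD2r ltW // brk_lt1.
  by rewrite ler_peMl.
apply: le_trans key _; rewrite /Z mass1E.
have -> : \sum_(i < J) e i * (brk i.+1 - brk i) + e J * (1 - brk J) =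
    \sum_(i < J.+1) e i * w i.
  rewrite big_ord_recr /= /w ltnn; congr (_ + _).
  by apply: eq_bigr => i _; rewrite ltn_ord.
have i0J' : (i0 < J.+1)%N by [].
rewrite (bigD1 (Ordinal i0J')) //= lerDl.
by apply: sumr_ge0 => i _; rewrite mulr_ge0 // ltW.
Qed.

Let bad_measurable i : measurable (bad_itv i).
Proof. by rewrite /bad_itv; case: ifP. Qed.

(** Union bound: as the widths sum to 1, the bad intervals have total length at most [beta / Z]. *)
Let bad_prob : (P (\big[setU/set0]_(i < J.+1) bad_itv i) <=
  (beta * (i0.+1%:R * i0.+2%:R))%:E)%E.
Proof.
apply: le_trans (Boole_inequality P (A := bad_itv) (n := J.+1) (fun i _ => bad_measurable i)) _.
apply: (@le_trans _ _ (\sum_(i < J.+1) (beta * w i / Z)%:E)%E).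
  apply: lee_sum => i _; rewrite /bad_itv; case: ifPn => [_|bi].
    by rewrite measure0 lee_fin divr_ge0 ?mulr_ge0 // ltW.
  have ew : 0 <= e i * w i by rewrite mulr_ge0 // ltW.
  apply: le_trans (uniform_ccitv _) _.
    by rewrite ler_pM2r ?invr_gt0 // lerDl.
  rewrite lee_fin -mulrBl ler_pM2r ?invr_gt0 // addrC addKr.
  by rewrite ler_wpM2r // e_bad // -ltnS.
rewrite sumEFin lee_fin -mulr_suml -mulr_sumr sum_w mulr1 ler_wpM2l //.
by rewrite -[leRHS]invrK lef_pV2 ?posrE // invr_gt0 mulr_gt0 ?ltr0n.
Qed.

Let U : set R := `]0, 1[%classic `\` \big[setU/set0]_(i < J.+1) bad_itv i.

Let mbad : measurable (\big[setU/set0]_(i < J.+1) bad_itv i).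
Proof. by apply: bigsetU_measurable => i _. Qed.

Let U_good u : U u -> good (pick_piece e J u).1.
Proof.
case=> /= u01 nb; apply: contra_notT nb => bi.
have [iJ _ _ _] := pickP J e_gt0 u.
rewrite -bigcup_mkord; exists (pick_piece e J u).1; first by rewrite /= ltnS.
rewrite /bad_itv (negbTE bi) /= in_itv /=.
move: u01; rewrite in_itv /= => u01.
have gE : guard u = u by rewrite /guard u01.
have uZ : 0 <= guard u * mass e J 1.
  by have /andP[/ltW h _] := guard01 u; rewrite mulr_ge0 // ltW.
have := selP e J 0 uZ; rewrite -/(pick_piece e J u) gE -/Z add0n.
case: (pick_piece e J u) iJ {bi} => i t /= iJ [_ t0 tlt tE].
rewrite ler_pdivrMr // ler_pdivlMr // tE -/(start i) lerDl t0 lerD2l /=.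
rewrite /w; case: ltnP => [/tlt /ltW //|Ji].
have iE : i = J by apply/eqP; rewrite eqn_leq iJ.
have uZZ : u * Z <= Z by rewrite ler_piMl // ltW //; case/andP: u01.
have ZE : Z = start J + e J * (1 - brk J) by rewrite /Z mass1E /start big_mkord.
by move: uZZ; rewrite tE iE -/(start J) ZE lerD2l.
Qed.

Let V : set R := `]logistic (- l), logistic l]%classic.

Let V_noise v : V v -> `|noise v| <= l.
Proof.
rewrite /V /= in_itv /= => /andP[h1 h2].
have /andP[p1 _] := logistic01 (- l); have /andP[_ p2] := logistic01 l.
have v01 : 0 < v < 1 by rewrite (lt_trans p1 h1) (le_lt_trans h2 p2).
by rewrite ler_norml (noise_quantile _ v01) h2 andbT ltW // ltNge noise_quantile // -ltNge.
Qed.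

(** Each tail of the logistic law beyond [l] has mass at most [expR (- l)]. *)
Let V_prob : ((1 - 2 * expR (- l))%:E <= P V)%E.
Proof.
have /andP[p1 _] := logistic01 (- l); have /andP[_ p2] := logistic01 l.
rewrite uniform_ocitv ?(ltW p1) ?(ltW p2) //=; last first.
  by apply: logistic_nd; rewrite ge0_cp.
rewrite lee_fin /logistic opprK.
have h := expR_gt0 l; have -> : expR (- l) = (expR l)^-1 by rewrite expRN.
have h1 : 1 <= expR l by rewrite -expR0 ler_expR.
move: (expR l) h h1 => E E0 E1.
have -> : (1 + E^-1)^-1 - (1 + E)^-1 = 1 - 2 * (1 + E)^-1.
  by field; rewrite !gt_eqF //; lra.
rewrite lerD2l lerN2 ler_pM2l // lef_pV2 ?posrE //; lra.
Qed.

Lemma mech_accurate :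
  ((1 - beta * (i0.+1%:R * i0.+2%:R) - 2 * expR (- l))%:E <= mech_prob e a J eps A)%E.
Proof.
have mU : measurable U by exact: measurableD.
have mp : measurable_fun [set: R] (pick e J).
  exact: (quantile_measurable (@pick_out _ e J) (pick_quantile J e_gt0)).
have mrp : measurable_fun [set: R] (fun u => release_prob a J eps A (pick e J u)).
  by apply: measurableT_comp mp; exact: measurable_release_prob.
have mV : measurable V by exact: measurable_itv.
have VP1 : (P V <= 1)%E by exact: (probability_le1 P mV).
have UP : ((1 - beta * (i0.+1%:R * i0.+2%:R))%:E <= P U)%E.
  rewrite measureD //=; last first.
    by rewrite (le_lt_trans (probability_le1 P _)) ?ltry.
  rewrite uniform_oointerval EFinB leeB // (le_trans _ bad_prob) //.
  apply: le_measure; rewrite ?inE //; exact: measurableI.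
have fU : P U \is a fin_num by rewrite fin_num_measure.
have fV : P V \is a fin_num by rewrite fin_num_measure.
apply: (@le_trans _ _ (\int[P]_u ((\1_U u)%:E * P V))%E); last first.
  apply: ge0_le_integral => //=.
  - by move=> u _; rewrite mule_ge0 // lee_fin.
  - apply: emeasurable_funM => //; apply/measurable_EFinP; exact: measurable_indic.
  - move=> u _; rewrite indicE; case: (boolP (u \in U)) => [|_]; last first.
      by rewrite mul0e release_prob_ge0.
    rewrite inE mul1e => Uu.
    apply: (@le_trans _ _ (\int[P]_v (\1_V v)%:E)%E).
      by rewrite integral_indic // setIT.
    apply: ge0_le_integral => //=.
    + by apply/measurable_EFinP; exact: measurable_indic.
    + apply/measurable_EFinP; apply: measurableT_comp; first exact: measurable_indic.
      apply: measurable_funD => //; apply: measurable_funM => //.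
      exact: measurable_noise.
    move=> v _; rewrite lee_fin !indicE; case: (boolP (v \in V)) => //.
    rewrite inE => /V_noise nv; rewrite mem_set //.
    have [iJ pb pl _] := pickP J e_gt0 u.
    have /andP[pb1 pb2] := pb.
    by rewrite /release (stepf_piece a iJ pb1 pl); apply: A_good => //; exact: U_good.
under eq_integral do rewrite muleC.
rewrite ge0_integralZl //=; last first.
- by apply/measurable_EFinP; exact: measurable_indic.
(* The samples being independent, it remains to bound a product of probabilities by one minus the
   sum of the failure probabilities. *)
rewrite integral_indic // setIT -[leRHS]/(P V * P U)%E -(fineK fU) -(fineK fV) -EFinM lee_fin.
have : 1 - beta * (i0.+1%:R * i0.+2%:R) <= fine (P U) by rewrite -lee_fin fineK.
have : 1 - 2 * expR (- l) <= fine (P V) by rewrite -lee_fin fineK.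
have : fine (P V) <= 1 by rewrite -lee_fin fineK.
have : 0 <= fine (P U) by rewrite fine_ge0.
have : fine (P U) <= 1 by rewrite -lee_fin fineK // (probability_le1 P mU).
move: (fine (P U)) (fine (P V)) => x y; nra.
Qed.

End accuracy.

(** * Executions of commands *)

Section execution.
Variable R : realType.
Implicit Types (s : state R) (c : cmd).

Definition setn s (l : loc) (v : nat) : state R :=
  State (upd (nmem s) l v) (rmem s) (nsamples s).

Definition setr s (l : loc) (v : R) : state R :=
  State (nmem s) (upd (rmem s) l v) (nsamples s).

(* [exec c s t s']: the sample-free command [c] leads from [s] to [s'] in [t]
   steps, whatever the random tape. *)
Inductive exec : cmd -> state R -> nat -> state R -> Prop :=
| exec_skip s : exec Skip s 1 s
| exec_nset a i j e s :
    exec (NSet a i j e) s 1 (setn s (a, neval s i, neval s j) (neval s e))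
| exec_rset a i j e s :
    exec (RSet a i j e) s 1 (setr s (a, neval s i, neval s j) (reval s e))
| exec_seq c1 c2 s t s' t' s'' : exec c1 s t s' -> exec c2 s' t' s'' ->
    exec (Seq c1 c2) s (t + t').+1 s''
| exec_if b c1 c2 s t s' : exec (if beval s b then c1 else c2) s t s' ->
    exec (If b c1 c2) s t.+1 s'
| exec_stop b c s : ~~ beval s b -> exec (While b c) s 1 s
| exec_loop b c s t s' t' s'' : beval s b -> exec c s t s' ->
    exec (While b c) s' t' s'' -> exec (While b c) s (t + t').+1 s''.

(** The arbitrary continuation [k] is what sequences and loops require. *)
Lemma exec_sound c s t s' : exec c s t s' ->
  forall u k, iter t (step u) (c :: k, s) = (k, s').
Proof.
elim=> {c s t s'} //.
- move=> c1 c2 s t s' t' s'' _ IH1 _ IH2 u k.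
  by rewrite iterSr addnC iterD /= IH1 IH2.
- by move=> b c1 c2 s t s' _ IH u k; rewrite iterSr /= IH.
- by move=> b c s /negbTE h u k /=; rewrite h.
- move=> b c s t s' t' s'' h _ IH1 _ IH2 u k.
  by rewrite iterSr addnC iterD /= h IH1 IH2.
Qed.

Fixpoint nwrites c : seq nat :=
  match c with
  | NSet a _ _ _ => [:: a]
  | Seq c1 c2 | If _ c1 c2 => nwrites c1 ++ nwrites c2
  | While _ c1 => nwrites c1
  | _ => [::]
  end.

Fixpoint rwrites c : seq nat :=
  match c with
  | RSet a _ _ _ => [:: a]
  | Seq c1 c2 | If _ c1 c2 => rwrites c1 ++ rwrites c2
  | While _ c1 => rwrites c1
  | _ => [::]
  end.

(** Most facts about a state survive a command because it does not write the array concerned; this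
    makes the argument syntactic. *)
Definition frame c s s' : Prop :=
  [/\ forall a i j, a \notin nwrites c -> nmem s' (a, i, j) = nmem s (a, i, j),
      forall a i j, a \notin rwrites c -> rmem s' (a, i, j) = rmem s (a, i, j)
    & nsamples s' = nsamples s].

Lemma frame_trans c s s' s'' : frame c s s' -> frame c s' s'' -> frame c s s''.
Proof.
by case=> a1 a2 a3 [b1 b2 b3]; split=> [a i j h|a i j h|];
  rewrite ?b1 ?a1 ?b2 ?a2 ?b3 ?a3.
Qed.

Lemma frame_sub c c' s s' :
  {subset nwrites c <= nwrites c'} -> {subset rwrites c <= rwrites c'} ->
  frame c s s' -> frame c' s s'.
Proof.
move=> hn hr [f1 f2 f3]; split=> // a i j h; [apply: f1|apply: f2].
  by apply: contra h; exact: hn.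
by apply: contra h; exact: hr.
Qed.

Lemma exec_frame c s t s' : exec c s t s' -> frame c s s'.
Proof.
elim=> {c s t s'} //.
- move=> a i j e s; split=> // a' i' j' /=; rewrite inE /upd xpair_eqE xpair_eqE.
  by move=> /negbTE ->.
- move=> a i j e s; split=> // a' i' j' /=; rewrite inE /upd xpair_eqE xpair_eqE.
  by move=> /negbTE ->.
- move=> c1 c2 s t s' t' s'' _ f1 _ f2; apply: (@frame_trans _ _ s').
    by apply: frame_sub f1 => x /=; rewrite mem_cat => ->.
  by apply: frame_sub f2 => x /=; rewrite mem_cat => ->; rewrite orbT.
- move=> b c1 c2 s t s' _; case: (beval s b); apply: frame_sub => x /=;
    by rewrite mem_cat => ->; rewrite ?orbT.
- move=> b c s t s' t' s'' _ _ f1 _ f2; exact: (@frame_trans _ _ s').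
Qed.

(** Total correctness within a time budget. Budgets are upper bounds, so that branches of different
    lengths can share one. *)
Definition wp c (t : nat) (Q : state R -> Prop) s : Prop :=
  exists t' s', [/\ (t' <= t)%N, exec c s t' s' & Q s'].

Lemma wp_weaken c t t' (Q Q' : state R -> Prop) s :
  wp c t Q s -> (t <= t')%N -> (forall s', frame c s s' -> Q s' -> Q' s') -> wp c t' Q' s.
Proof.
case=> t1 [s' [h1 h2 h3]] tt' QQ'; exists t1, s'; split=> //.
  exact: leq_trans tt'.
by apply: QQ' => //; exact: exec_frame h2.
Qed.

Lemma wp_skip (Q : state R -> Prop) s : Q s -> wp Skip 1 Q s.
Proof. by move=> h; exists 1%N, s; split=> //; constructor. Qed.

Lemma wp_nset a i j e (Q : state R -> Prop) s :
  Q (setn s (a, neval s i, neval s j) (neval s e)) -> wp (NSet a i j e) 1 Q s.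
Proof. by move=> h; eexists 1%N, _; split=> //; first by constructor. Qed.

Lemma wp_rset a i j e (Q : state R -> Prop) s :
  Q (setr s (a, neval s i, neval s j) (reval s e)) -> wp (RSet a i j e) 1 Q s.
Proof. by move=> h; eexists 1%N, _; split=> //; first by constructor. Qed.

(** Also the budget of a conditional, where the sum exceeds the cost of either branch, and of one
    turn of an unrolled loop. *)
Definition tseq (t1 t2 : nat) : nat := (t1 + t2).+1.

(** Each turn pays for the test, the sequencing and the increment. The final 3 covers the
    initialization, its sequencing and the failing test. *)
Definition tfor (N t : nat) : nat := (N * (t + 3) + 3)%N.

Lemma wp_seq c1 c2 t1 t2 (Q : state R -> Prop) s :
  wp c1 t1 (fun s' => wp c2 t2 Q s') s -> wp (Seq c1 c2) (tseq t1 t2) Q s.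
Proof.
case=> t [s' [h1 h2 [t' [s'' [h3 h4 h5]]]]]; exists (t + t').+1, s''; split=> //.
  by rewrite ltnS leq_add.
exact: exec_seq h2 h4.
Qed.

Lemma wp_if b c1 c2 t1 t2 (Q : state R -> Prop) s :
  (beval s b -> wp c1 t1 Q s) -> (~~ beval s b -> wp c2 t2 Q s) ->
  wp (If b c1 c2) (tseq t1 t2) Q s.
Proof.
move=> w1 w2; have [bs|bs] := boolP (beval s b).
  have [t [s' [h1 h2 h3]]] := w1 bs; exists t.+1, s'; split=> //.
    by rewrite ltnS (leq_trans h1) ?leq_addr.
  by constructor; rewrite bs.
have [t [s' [h1 h2 h3]]] := w2 bs; exists t.+1, s'; split=> //.
  by rewrite ltnS (leq_trans h1) ?leq_addl.
by constructor; rewrite (negbTE bs).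
Qed.

(** Scalars are kept in cell [(0, 0)] of an array, vectors in its column 0. *)
Definition nv a := NGet a (NConst 0) (NConst 0).
Definition n1 a i := NGet a i (NConst 0).
Definition rv a := RGet a (NConst 0) (NConst 0).
Definition r1 a i := RGet a i (NConst 0).
Definition sn a := NSet a (NConst 0) (NConst 0).
Definition sn1 a i := NSet a i (NConst 0).
Definition sr a := RSet a (NConst 0) (NConst 0).
Definition sr1 a i := RSet a i (NConst 0).
Definition rc (k : nat) := ROfNat (NConst k).
Definition nlt e1 e2 := NLe (NAdd e1 (NConst 1)) e2.
Definition neqb e1 e2 := BAnd (NLe e1 e2) (NLe e2 e1).

Definition incr i := sn i (NAdd (nv i) (NConst 1)).

Definition forw i b body := Seq (sn i (NConst 0)) (While b (Seq body (incr i))).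

(** The test need only agree with [k < N]. This admits loops whose bound is computed as a real,
    naturals having no multiplication. *)
Lemma wp_forw i b body N tb (Inv : nat -> state R -> Prop) (Q : state R -> Prop) s :
  i \notin nwrites body ->
  (forall s' k, frame (forw i b body) s s' -> nmem s' (i, 0, 0)%N = k -> (k <= N)%N ->
     Inv k s' -> beval s' b = (k < N)%N) ->
  Inv 0%N (setn s (i, 0, 0)%N 0%N) ->
  (forall k s', (k < N)%N -> frame (forw i b body) s s' -> nmem s' (i, 0, 0)%N = k ->
     Inv k s' -> wp body tb (fun s'' => Inv k.+1 (setn s'' (i, 0, 0)%N k.+1)) s') ->
  (forall s', frame (forw i b body) s s' -> Inv N s' -> Q s') ->
  wp (forw i b body) (tfor N tb) Q s.
Proof.
move=> ni hb h0 hs hq.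
suff H m k s' : (k + m = N)%N -> frame (forw i b body) s s' ->
    nmem s' (i, 0, 0)%N = k -> Inv k s' ->
    wp (While b (Seq body (incr i))) (m * (tb + 3) + 1) Q s'.
  rewrite (_ : tfor N tb = tseq 1 (N * (tb + 3) + 1)); last by rewrite /tfor /tseq; lia.
  apply: wp_seq; apply: wp_nset; apply: (H N 0%N) => //; last by rewrite /= /upd eqxx.
  apply: (@frame_sub (sn i (NConst 0))) => //.
    by move=> x /=; rewrite !inE => ->.
  by apply: (@exec_frame _ _ 1%N); constructor.
elim: m k s' => [|m IH] k s' km fr sk inv.
  have kN : k = N by lia.
  exists 1%N, s'; split=> //.
    by constructor; rewrite (hb _ k) // kN ?ltnn.
  by apply: hq => //; rewrite -kN.
have kN : (k < N)%N by lia.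
have [t1 [s1 [l1 e1 inv1]]] := hs k s' kN fr sk inv.
pose s2 := setn s1 (i, 0, 0)%N k.+1.
have f1 := exec_frame e1.
have k1 : nmem s1 (i, 0, 0)%N = k by case: f1 => -> // _ _.
have e2 : exec (incr i) s1 1 s2.
  rewrite /s2; have := @exec_nset i (NConst 0) (NConst 0) (NAdd (nv i) (NConst 1)) s1.
  by rewrite /= k1 addn1.
have f2 := exec_frame e2.
have fr2 : frame (forw i b body) s s2.
  apply: frame_trans fr _; apply: (@frame_trans _ _ s1).
    by apply: frame_sub f1 => x h; rewrite /= ?inE mem_cat h ?orbT.
  by apply: frame_sub f2 => x /=; rewrite !inE // => ->.
have [||||t3 [s3 [l3 e3 q3]]] := IH k.+1 s2; rewrite ?addSnnS //.
  by rewrite /s2 /= /upd eqxx.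
exists ((t1 + 1).+1 + t3).+1, s3; split=> //; first lia.
apply: exec_loop; [by rewrite (hb _ k) // ltnW| |exact: e3].
exact: exec_seq e1 e2.
Qed.

Definition for_ i bnd := forw i (nlt (nv i) bnd).

Lemma wp_for i bnd body N tb (Inv : nat -> state R -> Prop) (Q : state R -> Prop) s :
  i \notin nwrites body ->
  (forall s', frame (for_ i bnd body) s s' -> neval s' bnd = N) ->
  Inv 0%N (setn s (i, 0, 0)%N 0%N) ->
  (forall k s', (k < N)%N -> frame (for_ i bnd body) s s' -> nmem s' (i, 0, 0)%N = k ->
     Inv k s' -> wp body tb (fun s'' => Inv k.+1 (setn s'' (i, 0, 0)%N k.+1)) s') ->
  (forall s', frame (for_ i bnd body) s s' -> Inv N s' -> Q s') ->
  wp (for_ i bnd body) (tfor N tb) Q s.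
Proof.
move=> ni hb h0 hs hq; apply: wp_forw hs hq => // s' k fr sk _ _.
by rewrite /= sk (hb _ fr) addn1.
Qed.

Lemma wp_loop b c t1 t2 (Q : state R -> Prop) s : beval s b ->
  wp c t1 (fun s' => wp (While b c) t2 Q s') s -> wp (While b c) (tseq t1 t2) Q s.
Proof.
move=> bs [t [s' [h1 h2 [t' [s'' [h3 h4 h5]]]]]]; exists (t + t').+1, s''; split=> //.
  by rewrite ltnS leq_add.
exact: exec_loop bs h2 h4.
Qed.

Lemma wp_stop b c (Q : state R -> Prop) s : ~~ beval s b -> Q s -> wp (While b c) 1 Q s.
Proof. by move=> bs q; exists 1%N, s; split=> //; constructor. Qed.

End execution.

(** * The program *)

(** [aLAB] holds component labels, [aDEG] degrees in the current forest, [aBU] and [aBV] the best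
    edge found, [aLU] and [aLV] the labels of its ends, [aPOW] the degree bound [2 ^ i]. Among the
    reals, [rY] is the dual point, [rVAL] the weight of the forest, [rPHI] the Lagrangian, [rMIN]
    its least value so far, [rA] the level values, [rE] the level weights and [rZ] their total
    mass. *)
Local Notation aN := 0%N (only parsing).
Local Notation aADJ := 1%N (only parsing).
Local Notation aLAB := 2%N (only parsing).
Local Notation aDEG := 3%N (only parsing).
Local Notation aI := 4%N (only parsing).
Local Notation aJ := 5%N (only parsing).
Local Notation aROUND := 6%N (only parsing).
Local Notation aBU := 7%N (only parsing).
Local Notation aBV := 8%N (only parsing).
Local Notation aFOUND := 9%N (only parsing).
Local Notation aLU := 10%N (only parsing).
Local Notation aLV := 11%N (only parsing).
Local Notation aITER := 12%N (only parsing).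
Local Notation aPOW := 13%N (only parsing).
Local Notation aLEV := 14%N (only parsing).
Local Notation rEPS := 0%N (only parsing).
Local Notation rOUT := 1%N (only parsing).
Local Notation rY := 2%N (only parsing).
Local Notation rVAL := 3%N (only parsing).
Local Notation rBEST := 4%N (only parsing).
Local Notation rPHI := 5%N (only parsing).
Local Notation rMIN := 6%N (only parsing).
Local Notation rFSF := 7%N (only parsing).
Local Notation rA := 8%N (only parsing).
Local Notation rTAU := 9%N (only parsing).
Local Notation rPREV := 10%N (only parsing).
Local Notation rSLOPE := 11%N (only parsing).
Local Notation rE := 12%N (only parsing).
Local Notation rZ := 13%N (only parsing).
Local Notation rT := 14%N (only parsing).
Local Notation rU := 15%N (only parsing).
Local Notation rV := 16%N (only parsing).
Local Notation rP := 17%N (only parsing).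

Definition weight_exp : rexp :=
  RSub (RSub (rc 1) (r1 rY (nv aI))) (r1 rY (nv aJ)).

(** The best weight starts at 0, so only edges of positive weight are ever chosen. *)
Definition scan_test : bexp :=
  BAnd (BAnd (NLe (NConst 1) (NGet aADJ (nv aI) (nv aJ)))
             (BNot (neqb (n1 aLAB (nv aI)) (n1 aLAB (nv aJ)))))
       (BNot (RLe weight_exp (rv rBEST))).

Definition scan_body : cmd :=
  If scan_test
    (Seq (sn aFOUND (NConst 1)) (Seq (sr rBEST weight_exp)
      (Seq (sn aBU (nv aI)) (sn aBV (nv aJ)))))
    Skip.

Definition scan : cmd :=
  Seq (sn aFOUND (NConst 0)) (Seq (sr rBEST (rc 0))
    (for_ aI (nv aN) (for_ aJ (nv aN) scan_body))).

Definition relabel : cmd :=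
  for_ aI (nv aN)
    (If (neqb (n1 aLAB (nv aI)) (nv aLU)) (sn1 aLAB (nv aI) (nv aLV)) Skip).

(** Both labels are copied first, since [relabel] overwrites one of them in [aLAB]. *)
Definition contract : cmd :=
  Seq (sr rVAL (RAdd (rv rVAL) (rv rBEST)))
 (Seq (sn1 aDEG (nv aBU) (NAdd (n1 aDEG (nv aBU)) (NConst 1)))
 (Seq (sn1 aDEG (nv aBV) (NAdd (n1 aDEG (nv aBV)) (NConst 1)))
 (Seq (sn aLU (n1 aLAB (nv aBU))) (Seq (sn aLV (n1 aLAB (nv aBV))) relabel)))).

Definition kruskal : cmd :=
  Seq (for_ aI (nv aN) (Seq (sn1 aLAB (nv aI) (nv aI)) (sn1 aDEG (nv aI) (NConst 0))))
 (Seq (sr rVAL (rc 0))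
      (for_ aROUND (nv aN)
         (Seq scan (If (NLe (NConst 1) (nv aFOUND)) contract Skip)))).

(** * Correctness of the maximum weight forest *)

Section kruskal_correct.
Variables (R : realType) (n : nat) (G : graph n).
Implicit Types (s : state R).

Definition holds_graph s :=
  nmem s (aN, 0, 0)%N = n /\
  forall x z : 'I_n, nmem s (aADJ, val x, val z) = G x z :> nat.

Lemma holds_graph_frame c s s' : aN \notin nwrites c -> aADJ \notin nwrites c ->
  frame c s s' -> holds_graph s -> holds_graph s'.
Proof.
move=> h0 h1 [f _ _] [hn hG]; split=> [|x z]; first by rewrite f.
by rewrite f // hG.
Qed.

Definition wt (y : 'I_n -> R) (e : 'I_n * 'I_n) : R := 1 - y e.1 - y e.2.

Definition labels s (x : 'I_n) : nat := nmem s (aLAB, val x, 0%N).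

Section scan.
Variables (L : 'I_n -> nat) (y : 'I_n -> R).

Definition candidate s :=
  (nmem s (aFOUND, 0, 0)%N = 0%N /\ rmem s (rBEST, 0, 0)%N = 0) \/
  exists x z : 'I_n, [/\ nmem s (aFOUND, 0, 0)%N = 1%N,
    nmem s (aBU, 0, 0)%N = x /\ nmem s (aBV, 0, 0)%N = z, G x z && (L x != L z),
    rmem s (rBEST, 0, 0)%N = wt y (x, z) & 0 < wt y (x, z)].

Definition scanned (vis : 'I_n -> 'I_n -> bool) s :=
  candidate s /\ forall x z, vis x z -> G x z -> L x != L z ->
    wt y (x, z) <= rmem s (rBEST, 0, 0)%N.

Lemma candidate_ge0 s : candidate s -> 0 <= rmem s (rBEST, 0, 0)%N.
Proof. by case=> [[_ ->]//|[x [z [_ _ _ -> /ltW]]]]. Qed.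

Lemma wp_scan s : holds_graph s -> labels s =1 L ->
  (forall v : 'I_n, rmem s (rY, val v, 0%N) = y v) ->
  wp scan (tseq 1 (tseq 1 (tfor n (tfor n (tseq (tseq 1 (tseq 1 (tseq 1 1))) 1)))))
    (scanned (fun _ _ => true)) s.
Proof.
move=> hg hL hy.
apply: wp_seq; apply: wp_nset; apply: wp_seq; apply: wp_rset.
set s1 := setr _ _ _.
have hg1 : holds_graph s1 by case: hg => h1 h2; split.
apply: (wp_for (N := n) (Inv := fun k => scanned (fun x _ => (x < k)%N))) => //.
- by move=> s' [f _ _]; rewrite /= f //; case: hg1.
- by split; [left; split; rewrite /= /upd eqxx|].
- move=> k s2 kn fr2 k2 inv2.
  have hg2 : holds_graph s2 by apply: holds_graph_frame fr2 hg1.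
  (* Pairs are visited lexicographically: all rows before [k], then the first [m] entries of row
     [k]. *)
  apply: (wp_for (N := n)
    (Inv := fun m => scanned (fun x z => (x < k)%N || (x == k :> nat) && (z < m)%N))) => //.
  + by move=> s' [f _ _]; rewrite /= f //; case: hg2.
  + case: inv2 => c2 b2; split=> // x z; rewrite ltn0 andbF orbF; exact: b2.
  + move=> m s3 mn fr3 m3 inv3.
    have hg3 : holds_graph s3 by apply: holds_graph_frame fr3 hg2.
    case: inv3 => c3 b3.
    have k3 : nmem s3 (aI, 0, 0)%N = k by case: fr3 => -> //.
    have L3 x : nmem s3 (aLAB, val x, 0%N) = L x.
      by case: fr3 => -> // _ _; case: fr2 => -> // _ _; exact: hL.
    have y3 x : rmem s3 (rY, val x, 0%N) = y x.
      by case: fr3 => _ -> // _; case: fr2 => _ -> // _; exact: hy.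
    pose x0 := Ordinal kn; pose z0 := Ordinal mn.
    have testE : beval s3 scan_test =
        [&& G x0 z0, L x0 != L z0 & rmem s3 (rBEST, 0, 0)%N < wt y (x0, z0)].
      rewrite /= k3 m3 (hg3.2 x0 z0) (L3 x0) (L3 z0) (y3 x0) (y3 z0) -eqn_leq -ltNge.
      by rewrite /wt /= -andbA; case: (G x0 z0).
    have vis (x z : 'I_n) : (x < k)%N || (x == k :> nat) && (z < m.+1)%N ->
        (x < k)%N || (x == k :> nat) && (z < m)%N \/ x = x0 /\ z = z0.
      case: ltnP => //= [_|kx]; first by left.
      case/andP => /eqP xk; rewrite ltnS leq_eqVlt => /orP[/eqP zm|zm]; last first.
        by left; rewrite xk eqxx.
      by right; split; apply: ord_inj.
    apply: wp_if; rewrite testE.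
      case/and3P => g0 l0 w0.
      do 3 (apply: wp_seq; first [apply: wp_nset|apply: wp_rset]); apply: wp_nset.
      split.
        right; exists x0, z0.
        split; rewrite /= /upd /= ?k3 ?m3 ?(y3 x0) ?(y3 z0) ?g0 //.
        exact: le_lt_trans (candidate_ge0 c3) w0.
      move=> x z /vis[v|[-> ->]] gxz lxz; rewrite /= /upd /= k3 m3 (y3 x0) (y3 z0).
        exact: le_trans (b3 _ _ v gxz lxz) (ltW w0).
      by [].
    move=> nt; apply: wp_skip; split=> // x z /vis[v|[-> ->]] gxz lxz.
      exact: b3.
    by move: nt; rewrite gxz lxz /= -leNgt.
  + move=> s3 _ [c3 b3]; split=> // x z xk; apply: b3.
    by move: xk; rewrite ltnS leq_eqVlt ltn_ord andbT orbC.
by move=> s2 _ [c2 b2]; split=> // x z _; apply: b2.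
Qed.

End scan.

Lemma wp_relabel s lu lv : holds_graph s -> nmem s (aLU, 0, 0)%N = lu ->
  nmem s (aLV, 0, 0)%N = lv ->
  wp relabel (tfor n (tseq 1 1))
    (fun s' => forall x, labels s' x = if labels s x == lu then lv else labels s x) s.
Proof.
move=> hg hlu hlv.
apply: (wp_for (N := n) (Inv := fun k s' => forall x, labels s' x =
  if (x < k)%N && (labels s x == lu) then lv else labels s x)) => //.
- by move=> s' [f _ _]; rewrite /= f //; case: hg.
- move=> k s1 kn fr1 k1 inv1; pose x0 := Ordinal kn.
  have lu1 : nmem s1 (aLU, 0, 0)%N = lu by case: fr1 => -> //.
  have lv1 : nmem s1 (aLV, 0, 0)%N = lv by case: fr1 => -> //.
  have inv0 : nmem s1 (aLAB, k, 0)%N = labels s x0.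
    by rewrite -/(labels s1 x0) inv1 /= ltnn.
  have ltS (x : 'I_n) : (x < k.+1)%N = (x < k)%N || (x == x0).
    by rewrite ltnS leq_eqVlt orbC.
  apply: wp_if; rewrite /= k1 inv0 lu1 -eqn_leq.
    move=> xlu; apply: wp_nset => x; rewrite /= k1 lv1 /labels /= /upd ltS !xpair_eqE /=.
    rewrite andbT -[(val x == k)]/(x == x0); have [->|xx0] := eqVneq x x0.
      by rewrite orbT xlu.
    by rewrite orbF -/(labels s1 x) inv1.
  move=> xlu; apply: wp_skip => x; rewrite ltS -[LHS]/(labels s1 x) inv1.
  have [->|xx0] := eqVneq x x0; last by rewrite orbF.
  by rewrite orbT (negbTE xlu) andbF.
- by move=> s' _ inv x; rewrite inv ltn_ord.
Qed.

Lemma wp_contract s (x z : 'I_n) b : holds_graph s -> nmem s (aBU, 0, 0)%N = x ->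
  nmem s (aBV, 0, 0)%N = z -> rmem s (rBEST, 0, 0)%N = b ->
  wp contract (tseq 1 (tseq 1 (tseq 1 (tseq 1 (tseq 1 (tfor n (tseq 1 1)))))))
    (fun s' => [/\ rmem s' (rVAL, 0, 0)%N = rmem s (rVAL, 0, 0)%N + b,
       forall v : 'I_n, nmem s' (aDEG, val v, 0%N) =
         ((x == v) + (z == v) + nmem s (aDEG, val v, 0%N))%N &
       forall v, labels s' v =
         if labels s v == labels s x then labels s z else labels s v]) s.
Proof.
move=> hg hx hz hb.
apply: wp_seq; apply: wp_rset; do 4 (apply: wp_seq; apply: wp_nset).
set s1 := setn _ _ _.
have hg1 : holds_graph s1 by case: hg => h1 h2; split.
have L1 : labels s1 =1 labels s by [].
have lu1 : nmem s1 (aLU, 0, 0)%N = labels s x by rewrite /s1 /= /upd /= hx.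
have lv1 : nmem s1 (aLV, 0, 0)%N = labels s z by rewrite /s1 /= /upd /= hz.
apply: wp_weaken (wp_relabel hg1 lu1 lv1) (leqnn _) _ => s2 fr2 lab2; split.
- by case: fr2 => _ -> // _; rewrite /s1 /= /upd /= hb.
- move=> v; case: fr2 => -> // _ _.
  rewrite /s1 /= /upd /= !xpair_eqE /= hx hz !andbT.
  rewrite -[(val v == x)]/(v == x) -[(val v == z)]/(v == z) -[(val z == x)]/(z == x).
  rewrite (eq_sym x) (eq_sym z v).
  by case: (eqVneq v z) => [<-|_]; case: (eqVneq v x) => [<-|_]; rewrite /= ?eqxx; lia.
- by move=> v; rewrite lab2 !L1.
Qed.

Section kruskal.
Variable y : 'I_n -> R.

(** State after [r] rounds; by the last clause each round added an edge, unless no edge of positive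
    weight is left. *)
Definition growing (r : nat) s := exists f,
  [/\ edge_forest G f /\ (forall x z, (labels s x == labels s z) = joins eq_op f x z),
      rmem s (rVAL, 0, 0)%N = \sum_(e <- f) wt y e,
      forall v : 'I_n, nmem s (aDEG, val v, 0%N) = incidences f v,
      greedy_bound G (wt y) (joins eq_op f) (rmem s (rVAL, 0, 0)%N) &
      (r <= size f)%N \/
      forall e, G e.1 e.2 -> ~~ joins eq_op f e.1 e.2 -> wt y e <= 0].

Definition max_forest s := exists f,
  [/\ edge_forest G f, rmem s (rVAL, 0, 0)%N = \sum_(e <- f) wt y e,
      forall v : 'I_n, nmem s (aDEG, val v, 0%N) = incidences f v &
      forall f', edge_forest G f' -> \sum_(e <- f') wt y e <= \sum_(e <- f) wt y e].

(** A forest with [n] edges leaves nothing to join: one edge more would exceed the bound on the size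
    of forests. *)
Lemma growing_end s : growing n s -> max_forest s.
Proof.
case=> f [[ff lab] hv hd gb h]; exists f; split=> //.
rewrite -hv; apply: greedy_end gb; case: h => // nf e ge je; exfalso.
have : edge_forest G (rcons f e).
  have /andP[aG ac] := ff.
  by rewrite /edge_forest all_rcons ge aG acyclic_rcons ac je.
move=> /edge_forest_size; rewrite size_rcons /fsf => h.
have := leq_subr (fcc G) n; have := leq_trans h (leq_subr _ _); lia.
Qed.

Definition tround : nat :=
  tseq (tseq 1 (tseq 1 (tfor n (tfor n (tseq (tseq 1 (tseq 1 (tseq 1 1))) 1)))))
    (tseq (tseq 1 (tseq 1 (tseq 1 (tseq 1 (tseq 1 (tfor n (tseq 1 1))))))) 1).

Definition tkruskal : nat :=
  tseq (tfor n (tseq 1 1)) (tseq 1 (tfor n tround)).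

Lemma wp_kruskal s : holds_graph s ->
  (forall v : 'I_n, rmem s (rY, val v, 0%N) = y v) ->
  wp kruskal tkruskal max_forest s.
Proof.
move=> hg hy; apply: wp_seq.
apply: (wp_for (N := n) (Inv := fun k s' => forall x : 'I_n, (x < k)%N ->
  nmem s' (aLAB, val x, 0%N) = x /\ nmem s' (aDEG, val x, 0%N) = 0%N)) => //.
- by move=> s' [f _ _]; rewrite /= f //; case: hg.
- move=> k s1 kn fr1 k1 inv1; apply: wp_seq; apply: wp_nset; apply: wp_nset => x.
  rewrite ltnS leq_eqVlt /= /upd /= !xpair_eqE /= k1 !andbT.
  by case: eqP => [->//|_ /inv1].
move=> s1 fr1 inv1; apply: wp_seq; apply: wp_rset; set s2 := setr _ _ _.
have hg1 : holds_graph s1 by apply: holds_graph_frame fr1 hg.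
have hg2 : holds_graph s2 by case: hg1.
have y2 v : rmem s2 (rY, val v, 0%N) = y v.
  by case: fr1 => _ h _; rewrite -hy -h.
apply: (wp_for (N := n) (Inv := growing)) => //.
- by move=> s' [f _ _]; rewrite /= f //; case: hg2.
- exists [::]; split; rewrite ?big_nil //=.
  + split=> // x z; rewrite /labels /=.
    by rewrite /upd /= !(inv1 _ (ltn_ord _)).1.
  + by move=> v; rewrite /upd /= (inv1 v (ltn_ord v)).2 /incidences big_nil.
  + rewrite /upd /=; exact: greedy_init.
  + by left.
- move=> k s3 kn fr3 k3 [f [[ff lab] hv hd gb h]].
  have hg3 : holds_graph s3 by apply: holds_graph_frame fr3 hg2.
  have y3 v : rmem s3 (rY, val v, 0%N) = y v by case: fr3 => _ -> // _; exact: y2.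
  apply: wp_seq; apply: wp_weaken (wp_scan hg3 (fun _ => erefl) y3) (leqnn _) _.
  move=> s4 fr4 [c4 b4].
  have hg4 : holds_graph s4 by apply: holds_graph_frame fr4 hg3.
  have L4 x : labels s4 x = labels s3 x by case: fr4 => h4 _ _; rewrite /labels h4.
  have v4 : rmem s4 (rVAL, 0, 0)%N = rmem s3 (rVAL, 0, 0)%N by case: fr4 => _ -> //.
  have d4 v : nmem s4 (aDEG, val v, 0%N) = incidences f v by case: fr4 => -> // _ _.
  case: c4 => [[found best]|[x [z [found [bu bv] /andP[gxz lxz] best w0]]]].
    apply: wp_if; rewrite /= found // => _; apply: wp_skip; exists f; split=> //=.
    + by split=> // x z; rewrite -lab -!L4.
    + by rewrite v4.
    + by rewrite v4.
    + right=> -[x z] /= gxz jxz; rewrite -best; apply: b4 => //.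
      by rewrite lab.
  apply: wp_if; rewrite /= found // => _.
  apply: wp_weaken (wp_contract hg4 bu bv best) (leqnn _) _ => s5 fr5 [v5 d5 lab5].
  have jxz : ~~ joins eq_op f x z by rewrite -lab.
  have /andP[aG ac] := ff.
  exists (rcons f (x, z)); split=> /=.
  + split; first by rewrite /edge_forest all_rcons aG /= gxz acyclic_rcons ac.
    move=> p q; rewrite joins_rcons.
    transitivity (labels s5 p == labels s5 q); first by [].
    rewrite !lab5 !L4 /=.
    have := same_label_relabel (labels s3) x z p q; rewrite /same_label /= => ->.
    by rewrite /join !lab.
  + by rewrite v5 v4 hv big_rcons /= addrC.
  + move=> v; transitivity (nmem s5 (aDEG, val v, 0%N)); first by [].
    by rewrite d5 d4 /incidences big_rcons /= addnC.
  + rewrite v5 v4 joins_rcons /=; apply: greedy_step => //.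
    * exact/joins_equiv/eqop_equiv.
    * exact: ltW.
    * by move=> [p q] /= gpq jpq; rewrite -best; apply: b4; rewrite ?lab.
  + case: h => [h|h]; first by left; rewrite size_rcons ltnS.
    by have := h (x, z) gxz jxz; rewrite leNgt w0.
- by move=> s' _; exact: growing_end.
Qed.

End kruskal.
End kruskal_correct.

Definition rn : rexp := ROfNat (nv aN).

(** This is [256 n ^ 6], formed among the reals for want of a product of naturals. *)
Definition iterations : rexp :=
  RMul (rc 256) (RMul rn (RMul rn (RMul rn (RMul rn (RMul rn rn))))).

Definition step_size : rexp :=
  RDiv (rc 1) (RMul (rc 16) (RMul rn (RMul rn (RMul rn rn)))).

Definition penalize : cmd :=
  for_ aI (nv aN)
    (sr rPHI (RAdd (rv rPHI) (RMul (ROfNat (nv aPOW)) (r1 rY (nv aI))))).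

Definition project : cmd :=
  for_ aI (nv aN)
   (Seq (sr rT (RSub (r1 rY (nv aI)) (RMul step_size
           (RSub (ROfNat (nv aPOW)) (ROfNat (n1 aDEG (nv aI)))))))
        (If (RLe (rv rT) (rc 0)) (sr1 rY (nv aI) (rc 0))
        (If (RLe (rc 1) (rv rT)) (sr1 rY (nv aI) (rc 1))
            (sr1 rY (nv aI) (rv rT))))).

Definition descend_body : cmd :=
  Seq kruskal (Seq (sr rPHI (rv rVAL)) (Seq penalize
 (Seq (If (RLe (rv rPHI) (rv rMIN)) (sr rMIN (rv rPHI)) Skip) project))).

Definition zero_duals : cmd := for_ aI (nv aN) (sr1 rY (nv aI) (rc 0)).

(** The minimum starts at [f_sf], a dual bound given by [y = 0]. *)
Definition descend : cmd :=
  Seq zero_duals (Seq (sr rMIN (rv rFSF))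
    (forw aITER (BNot (RLe iterations (ROfNat (nv aITER)))) descend_body)).

(** * Convergence of the descent *)

Section descend_correct.
Variables (R : realType) (n : nat) (G : graph n).
Implicit Types (s : state R) (y : 'I_n -> R).

Definition holds_dual s y := forall v : 'I_n, rmem s (rY, val v, 0%N) = y v.

Lemma wp_zero_duals s : holds_graph G s ->
  wp zero_duals (tfor n 1) (fun s' => holds_dual s' (fun=> 0)) s.
Proof.
move=> hg; apply: (wp_for (N := n)
  (Inv := fun k s' => forall v : 'I_n, (v < k)%N -> rmem s' (rY, val v, 0%N) = 0)) => //.
- by move=> s' [f _ _]; rewrite /= f //; case: hg.
- move=> k s1 kn fr1 k1 inv1; apply: wp_rset => v.
  rewrite ltnS leq_eqVlt /= /upd /= !xpair_eqE /= k1 andbT.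
  by case: eqP => // _ /inv1.
- by move=> s' _ inv v; apply: inv.
Qed.

Lemma wp_penalize s y D : holds_graph G s -> holds_dual s y ->
  nmem s (aPOW, 0, 0)%N = D ->
  wp penalize (tfor n 1) (fun s' => rmem s' (rPHI, 0, 0)%N =
    rmem s (rPHI, 0, 0)%N + D%:R * \sum_v y v) s.
Proof.
move=> hg hy hD.
apply: (wp_for (N := n) (Inv := fun k s' => rmem s' (rPHI, 0, 0)%N =
    rmem s (rPHI, 0, 0)%N + D%:R * \sum_(v < n | (v < k)%N) y v)) => //.
- by move=> s' [f _ _]; rewrite /= f //; case: hg.
- by rewrite big_pred0 // mulr0 addr0.
- move=> k s1 kn fr1 k1 inv1; apply: wp_rset; pose x0 := Ordinal kn.
  have D1 : nmem s1 (aPOW, 0, 0)%N = D by case: fr1 => -> //.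
  have y1 : rmem s1 (rY, k, 0%N) = y x0 by case: fr1 => _ -> // _; exact: (hy x0).
  rewrite /= /upd /= k1 D1 y1 inv1 -addrA -mulrDr; congr (_ + _ * _).
  rewrite [RHS](bigD1 x0) //= addrC; congr (_ + _); apply: eq_bigl => v.
  by rewrite ltnS ltn_neqAle andbC.
- move=> s' _ ->; congr (_ + _ * _); apply: eq_bigl => v; exact: ltn_ord.
Qed.

(* A squared subgradient norm is at most [n ^ 3].  While the value is not optimal
   within [eta], a step of length [rate] thus decreases the squared distance to
   an optimum, initially at most [n], by
   [rate * (2 * eta - rate * n ^ 3) = (256 * n ^ 5)^-1]. *)
Definition eta : R := (16 * n%:R)^-1.
Definition rate : R := 1 / (16 * (n%:R * (n%:R * (n%:R * n%:R)))).

Lemma wp_project s y D (d : 'I_n -> nat) : holds_graph G s -> holds_dual s y ->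
  nmem s (aPOW, 0, 0)%N = D -> (forall v : 'I_n, nmem s (aDEG, val v, 0%N) = d v) ->
  wp project (tfor n (tseq 1 (tseq 1 (tseq 1 1))))
    (fun s' => holds_dual s' (fun v => clip (y v - rate * (D%:R - (d v)%:R)))) s.
Proof.
move=> hg hy hD hd; set y' := fun v => clip _.
apply: (wp_for (N := n) (Inv := fun k s' => forall v : 'I_n,
  rmem s' (rY, val v, 0%N) = if (v < k)%N then y' v else y v)) => //.
- by move=> s' [f _ _]; rewrite /= f //; case: hg.
- move=> k s1 kn fr1 k1 inv1; pose x0 := Ordinal kn.
  have D1 : nmem s1 (aPOW, 0, 0)%N = D by case: fr1 => -> //.
  have n1 : nmem s1 (aN, 0, 0)%N = n by case: fr1 => -> // _ _; case: hg.
  have d1 : nmem s1 (aDEG, k, 0%N) = d x0 by case: fr1 => -> // _ _; exact: (hd x0).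
  have y1 : rmem s1 (rY, k, 0%N) = y x0 by have := inv1 x0; rewrite /= ltnn.
  apply: wp_seq; apply: wp_rset; set s2 := setr _ _ _.
  have T2 : rmem s2 (rT, 0, 0)%N = y x0 - rate * (D%:R - (d x0)%:R).
    by rewrite /s2 /= /upd /= k1 D1 n1 d1 y1.
  have k2 : nmem s2 (aI, 0, 0)%N = k by [].
  have upd2 (x : R) : x = y' x0 -> forall v : 'I_n,
      upd (rmem s2) (rY, k, 0%N) x (rY, val v, 0%N) =
      if (v < k.+1)%N then y' v else y v.
    move=> -> v; rewrite /upd !xpair_eqE /= andbT ltnS leq_eqVlt.
    rewrite -[(val v == k)]/(v == x0); have [->//|vx0] := eqVneq v x0.
    exact: inv1.
  set x := y x0 - _ in T2.
  have y'E : y' x0 = clip x by [].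
  have b0 : beval s2 (RLe (rv rT) (rc 0)) = (x <= 0) by rewrite -T2.
  have b1 : beval s2 (RLe (rc 1) (rv rT)) = (1 <= x) by rewrite -T2.
  apply: wp_if; rewrite b0 => x0'.
    by apply: wp_rset; rewrite /= k1; apply: upd2; rewrite y'E /clip x0'.
  have T3 : reval s2 (rv rT) = x by exact: T2.
  apply: wp_if; rewrite b1 => x1; apply: wp_rset; rewrite ?T3 /= k1; apply: upd2.
    by rewrite y'E /clip (negbTE x0') x1.
  by rewrite y'E /clip (negbTE x0') (negbTE x1).
- by move=> s' _ inv v; rewrite inv ltn_ord.
Qed.

Definition near_optimal (D : nat) (g : R) :=
  dual_bound G D%:R g /\ forall M, dual_bound G D%:R M -> g <= M + eta.

(** Sum of the inequalities of [subgradient_step] over [k] steps from [y = 0], against any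
    competitor [z] of value [M]; each value met is replaced by the current minimum, which is no
    larger. *)
Definition progress D k s := exists y,
  [/\ in_box y, holds_dual s y, dual_bound G D%:R (rmem s (rMIN, 0, 0)%N) &
    forall z M, in_box z -> (forall f, edge_forest G f -> lagr D%:R z f <= M) ->
    2 * rate * k%:R * (rmem s (rMIN, 0, 0)%N - M) + \sum_v (y v - z v) ^+ 2 <=
    \sum_v z v ^+ 2 + k%:R * (rate ^+ 2 * n%:R ^+ 3)].

Lemma progress_end D s : (0 < n)%N -> progress D (256 * n ^ 6) s ->
  near_optimal D (rmem s (rMIN, 0, 0)%N).
Proof.
move=> n0 [y [yb hy ub H]]; split=> // M [z zb zM].
have n1 : 1 <= n%:R :> R by rewrite ler1n.
have := H z M zb zM; rewrite natrM natrX.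
have s0 : 0 <= \sum_v (y v - z v) ^+ 2 by apply: sumr_ge0 => v _; exact: sqr_ge0.
have s1 : \sum_v z v ^+ 2 <= n%:R.
  apply: (@le_trans _ _ (\sum_(v < n) (1 : R))); last by rewrite sumr_const card_ord.
  by apply: ler_sum => v _; have /andP[z0 z1] := zb v; nra.
move: (rmem s _) s0 s1 => g s0 s1 h.
have {}h : 2 * rate * (256 * n%:R ^+ 6) * (g - M) <=
    n%:R + 256 * n%:R ^+ 6 * (rate ^+ 2 * n%:R ^+ 3) by lra.
have n0' : n%:R != 0 :> R by rewrite gt_eqF //; lra.
(* For this number of steps both sides carry the factor [32 n ^ 2], leaving [g - M <= eta]. *)
have e1 : 2 * rate * (256 * n%:R ^+ 6) = 32 * n%:R ^+ 2 by rewrite /rate; field.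
have e2 : n%:R + 256 * n%:R ^+ 6 * (rate ^+ 2 * n%:R ^+ 3) = 32 * n%:R ^+ 2 * eta.
  by rewrite /rate /eta; field.
move: h; rewrite e1 e2 ler_pM2l; first lra.
by rewrite mulr_gt0 // exprn_gt0 // ltr0n.
Qed.

Definition tbody : nat := tseq (tkruskal n) (tseq 1 (tseq (tfor n 1)
  (tseq (tseq 1 1) (tfor n (tseq 1 (tseq 1 (tseq 1 1))))))).

Lemma wp_descend_body s D k : (D <= n)%N -> holds_graph G s ->
  nmem s (aPOW, 0, 0)%N = D -> progress D k s ->
  wp descend_body tbody (progress D k.+1) s.
Proof.
move=> Dn hg hD [y [yb hy ub H]]; apply: wp_seq.
apply: wp_weaken (wp_kruskal hg hy) (leqnn _) _.
move=> s1 fr1 [f [ff hv hd hmax]].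
have hg1 : holds_graph G s1 by apply: holds_graph_frame fr1 hg.
apply: wp_seq; apply: wp_rset; set s2 := setr _ _ _.
have hg2 : holds_graph G s2 by case: hg1.
have y1 : holds_dual s1 y by move=> v; case: fr1 => _ -> //.
have y2 : holds_dual s2 y by [].
have D1 : nmem s1 (aPOW, 0, 0)%N = D by case: fr1 => -> //.
have D2 : nmem s2 (aPOW, 0, 0)%N = D by [].
apply: wp_seq; apply: wp_weaken (wp_penalize hg2 y2 D2) (leqnn _) _ => s3 fr3.
rewrite {1}/s2 /= {1}/upd /= hv => phi3.
have {}phi3 : rmem s3 (rPHI, 0, 0)%N = lagr D%:R y f by rewrite phi3 addrC.
have min3 : rmem s3 (rMIN, 0, 0)%N = rmem s (rMIN, 0, 0)%N.
  by case: fr3 => _ -> // _; rewrite /s2 /= /upd /=; case: fr1 => _ -> //.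
have opt f' : edge_forest G f' -> lagr D%:R y f' <= lagr D%:R y f.
  by move=> /hmax h; rewrite /lagr lerD2l.
pose g' := Num.min (lagr D%:R y f) (rmem s (rMIN, 0, 0)%N).
have hg3 : holds_graph G s3 by apply: holds_graph_frame fr3 hg2.
have y3 : holds_dual s3 y by move=> v; case: fr3 => _ -> //.
have D3 : nmem s3 (aPOW, 0, 0)%N = D by case: fr3 => -> //.
have d3 (v : 'I_n) : nmem s3 (aDEG, val v, 0%N) = incidences f v.
  by case: fr3 => -> // _ _; exact: hd.
apply: wp_seq.
have wmin : wp (If (RLe (rv rPHI) (rv rMIN)) (sr rMIN (rv rPHI)) Skip) (tseq 1 1)
    (fun s4 => rmem s4 (rMIN, 0, 0)%N = g') s3.
  apply: wp_if => /=; rewrite phi3 min3 /g'.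
    by move=> h; apply: wp_rset; rewrite /= /upd /= phi3 min_l.
  by rewrite -ltNge => /ltW h; apply: wp_skip; rewrite min3 min_r.
apply: wp_weaken wmin (leqnn _) _ => s4 fr4 min4.
have hg4 : holds_graph G s4 by apply: holds_graph_frame fr4 hg3.
have y4 : holds_dual s4 y by move=> v; case: fr4 => _ -> //.
have D4 : nmem s4 (aPOW, 0, 0)%N = D by case: fr4 => -> //.
have d4 (v : 'I_n) : nmem s4 (aDEG, val v, 0%N) = incidences f v.
  by case: fr4 => -> // _ _; exact: d3.
apply: wp_weaken (wp_project hg4 y4 D4 d4) (leqnn _) _ => s5 fr5 y5.
have min5 : rmem s5 (rMIN, 0, 0)%N = g' by case: fr5 => _ -> //.
eexists; split; [|exact: y5| |].
- by move=> v; exact: clip_box.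
- rewrite min5 /g'; case: leP => _ //; exists y => //.
move=> z M zb zM; rewrite min5.
have r0 : 0 <= rate by rewrite /rate divr_ge0 // !mulr_ge0.
have Dn' : 0 <= (D%:R : R) <= n%:R by rewrite ler0n ler_nat.
have /andP[_ ac] := ff.
have := subgradient_step y r0 Dn' ac zb.
have := H z M zb zM; have := zM _ ff.
have gl : g' <= lagr D%:R y f by rewrite /g' ge_min lexx.
have gm : g' <= rmem s (rMIN, 0, 0)%N by rewrite /g' ge_min lexx orbT.
move: (rmem s _) (lagr D%:R y f) (lagr D%:R z f) gl gm => m ly lz gl gm h1 h2 h3.
have k0 : 0 <= k%:R :> R by rewrite ler0n.
(* The new minimum is below the old one, which updates the [k] old terms, and below the Lagrangian
   at [y], which yields the new term. *)
have : 2 * rate * k%:R * (g' - M) <= 2 * rate * k%:R * (m - M).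
  by rewrite ler_wpM2l ?lerD2r // !mulr_ge0.
have : 2 * rate * (g' - M) <= 2 * rate * (ly - lz).
  by rewrite ler_wpM2l ?lerB // mulr_ge0.
rewrite -natr1; lra.
Qed.

Definition tdescend : nat :=
  tseq (tfor n 1) (tseq 1 (tfor (256 * n ^ 6) tbody)).

Lemma wp_descend s D : (D < n)%N -> holds_graph G s ->
  nmem s (aPOW, 0, 0)%N = D -> rmem s (rFSF, 0, 0)%N = (fsf G)%:R ->
  wp descend tdescend (fun s' => near_optimal D (rmem s' (rMIN, 0, 0)%N)) s.
Proof.
move=> Dn hg hD hF; apply: wp_seq.
apply: wp_weaken (wp_zero_duals hg) (leqnn _) _ => s1 fr1 y1.
have hg1 : holds_graph G s1 by apply: holds_graph_frame fr1 hg.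
apply: wp_seq; apply: wp_rset; set s2 := setr _ _ _.
have hg2 : holds_graph G s2 by case: hg1.
have D1 : nmem s1 (aPOW, 0, 0)%N = D by case: fr1 => -> //.
have D2 : nmem s2 (aPOW, 0, 0)%N = D by [].
have F1 : rmem s1 (rFSF, 0, 0)%N = (fsf G)%:R by case: fr1 => _ -> //.
apply: (wp_forw (N := (256 * n ^ 6)%N) (Inv := progress D)) => //.
- move=> s' k fr k' _ _; rewrite /= k'.
  have -> : nmem s' (aN, 0, 0)%N = n by case: fr => -> // _ _; case: hg2.
  by rewrite -!natrM ler_nat -ltnNge !expnS expn0 muln1.
- exists (fun=> 0); split.
  + by move=> v; rewrite lexx ler01.
  + by [].
  + by rewrite /= /upd /= F1; exact: dual_bound_fsf.
  + move=> z M _ _; rewrite mulr0 mul0r add0r mul0r addr0.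
    by apply: ler_sum => v _; rewrite sub0r sqrrN.
- move=> k s3 kN fr3 k3 inv3.
  have hg3 : holds_graph G s3 by apply: holds_graph_frame fr3 hg2.
  have D3 : nmem s3 (aPOW, 0, 0)%N = D by case: fr3 => -> //.
  apply: wp_weaken (wp_descend_body (ltnW Dn) hg3 D3 inv3) (leqnn _) _.
  by move=> s4 _ [y [h1 h2 h3 h4]]; exists y.
- by move=> s' _; apply: progress_end; apply: leq_ltn_trans Dn.
Qed.

End descend_correct.

(** The margin also ensures that a level which is not rounded misses [f_sf] by more than 1/4; this
    later absorbs the error of the descent. *)
Definition round_level : cmd :=
  If (RLe (RSub (rv rFSF) (RDiv (rc 1) (rc 4))) (rv rMIN))
     (sr1 rA (nv aLEV) (rv rFSF)) (sr1 rA (nv aLEV) (rv rMIN)).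

(** A degree bound of at least [n] constrains no forest, so the descent is skipped there. The slopes
    of the levels up to [n + 1] require [n + 3] values. *)
Definition levels : cmd :=
  for_ aLEV (NAdd (nv aN) (NConst 3))
    (Seq (If (NLe (nv aN) (nv aPOW)) (sr1 rA (nv aLEV) (rv rFSF))
             (Seq descend round_level))
         (sn aPOW (NAdd (nv aPOW) (nv aPOW)))).

Definition tau_exp : rexp :=
  RDiv (RMul (rc 144)
    (RLn (RLn (RAdd (RAdd (ROfNat (nv aN)) (RDiv (rc 48) (rv rEPS))) (rc 3)))))
    (rv rEPS).

Definition weigh_body : cmd :=
  Seq (sr rSLOPE (RDiv (RSub (r1 rA (NAdd (nv aLEV) (NConst 1))) (r1 rA (nv aLEV)))
                       (ROfNat (nv aPOW))))
 (Seq (sr rT (rc 0))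
 (Seq (If (RLe (rv rSLOPE) (rv rTAU)) Skip (sr rT (RSub (rv rSLOPE) (rv rTAU))))
 (Seq (If (RLe (rv rTAU) (rv rPREV)) Skip
          (sr rT (RAdd (rv rT) (RSub (rv rTAU) (rv rPREV)))))
 (Seq (sr1 rE (nv aLEV)
          (RExp (RSub (rc 0) (RMul (RDiv (rv rEPS) (rc 48)) (rv rT)))))
 (Seq (sr rPREV (rv rSLOPE)) (sn aPOW (NAdd (nv aPOW) (nv aPOW)))))))).

(** Level 0 has no predecessor; starting [rPREV] at [rTAU] cancels its second penalty. *)
Definition weigh : cmd :=
  Seq (sr rTAU tau_exp) (Seq (sn aPOW (NConst 1)) (Seq (sr rPREV (rv rTAU))
    (for_ aLEV (NAdd (nv aN) (NConst 2)) weigh_body))).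

Definition brk_exp (e : nexp) : rexp :=
  RDiv (ROfNat e) (ROfNat (NAdd e (NConst 1))).

Definition piece_exp (e : nexp) : rexp :=
  RMul (r1 rE e) (RSub (brk_exp (NAdd e (NConst 1))) (brk_exp e)).

Definition normalize : cmd :=
  Seq (sr rZ (rc 0))
 (Seq (for_ aLEV (NAdd (nv aN) (NConst 1)) (sr rZ (RAdd (rv rZ) (piece_exp (nv aLEV)))))
      (sr rZ (RAdd (rv rZ) (RMul (r1 rE (NAdd (nv aN) (NConst 1)))
         (RSub (rc 1) (brk_exp (NAdd (nv aN) (NConst 1)))))))).

(** With all duals at 0 every edge weighs 1, so the first call of [kruskal] computes [f_sf]. *)
Definition prepare : cmd :=
  Seq zero_duals (Seq kruskal (Seq (sr rFSF (rv rVAL)) (Seq (sn aPOW (NConst 1))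
 (Seq levels (Seq weigh normalize))))).

Definition clamp_sample : cmd :=
  If (BAnd (BNot (RLe (rv rU) (rc 0))) (BNot (RLe (rc 1) (rv rU)))) Skip
     (sr rU (RDiv (rc 1) (rc 2))).

Definition walk : cmd :=
  While (BAnd (nlt (nv aLEV) (NAdd (nv aN) (NConst 1)))
              (RLe (piece_exp (nv aLEV)) (rv rT)))
    (Seq (sr rT (RSub (rv rT) (piece_exp (nv aLEV)))) (incr aLEV)).

Definition output_exp : rexp :=
  RAdd (r1 rA (nv aLEV))
   (RMul (RMul (RDiv (rc 4) (rv rEPS))
      (RExp (RMul (RDiv (rv rP) (RSub (rc 1) (rv rP))) (RLn (rc 2)))))
      (RLn (RDiv (rv rV) (RSub (rc 1) (rv rV))))).

Definition select : cmd :=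
  Seq clamp_sample (Seq (sr rT (RMul (rv rU) (rv rZ))) (Seq (sn aLEV (NConst 0))
 (Seq walk (Seq (sr rP (RAdd (brk_exp (nv aLEV)) (RDiv (rv rT) (r1 rE (nv aLEV)))))
      (sr rOUT output_exp))))).

Definition estimator : cmd :=
  Seq prepare (Seq (Sample rU (NConst 0) (NConst 0))
    (Seq (Sample rV (NConst 0) (NConst 0)) select)).

(** * Correctness of the whole program *)

Section estimator_correct.
Variables (R : realType) (n : nat) (G : graph n) (eps : R).
Implicit Types (s : state R) (a : nat -> R).

Definition slope a i : R := (a i.+1 - a i) / (2 ^ i)%:R.

(* Between neighbors [tau] changes by at most 3 and each of the two terms of
   [penalty] by at most 6; hence [level_weight] by a factor [expR (eps / 4)],
   and its normalization by another one.  A level of penalty [tau] has weight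
   [(ln (n + 48 / eps + 3)) ^- 3]. *)
Definition tau : R := 144 * ln (ln (n%:R + 48 / eps + 3)) / eps.

Definition prev_slope a i : R := if i is j.+1 then slope a j else tau.

Definition penalty a i : R :=
  (if slope a i <= tau then 0 else slope a i - tau) +
  (if tau <= prev_slope a i then 0 else tau - prev_slope a i).

Definition level_weight a i : R := expR (0 - eps / 48 * penalty a i).

(** A specification rather than a value: privacy and accuracy rest on near optimality only, not on
    the trajectory of the descent. *)
Definition is_level i (x : R) : Prop :=
  if (n <= 2 ^ i)%N then x = (fsf G)%:R else
  exists2 g, near_optimal G (2 ^ i) g &
    x = if (fsf G)%:R - 1 / 4 <= g then (fsf G)%:R else g.

Definition tlevels : nat :=
  tfor (n + 3) (tseq (tseq 1 (tseq (tdescend n) (tseq 1 1))) 1).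

Lemma wp_levels s : holds_graph G s -> rmem s (rFSF, 0, 0)%N = (fsf G)%:R ->
  nmem s (aPOW, 0, 0)%N = 1%N ->
  wp levels tlevels (fun s' => forall i, (i < n + 3)%N -> is_level i (rmem s' (rA, i, 0%N))) s.
Proof.
move=> hg hF h1.
apply: (wp_for (N := (n + 3)%N) (Inv := fun k s' => nmem s' (aPOW, 0, 0)%N = (2 ^ k)%N /\
  forall i, (i < k)%N -> is_level i (rmem s' (rA, i, 0%N)))) => //.
- by move=> s' [f _ _]; rewrite /= f //; case: hg => ->.
- move=> k s1 kn fr1 k1 [p1 lev1].
  have hg1 : holds_graph G s1 by apply: holds_graph_frame fr1 hg.
  have F1 : rmem s1 (rFSF, 0, 0)%N = (fsf G)%:R by case: fr1 => _ -> //.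
  have step1 s2 (x : R) : nmem s2 (aPOW, 0, 0)%N = (2 ^ k)%N ->
      nmem s2 (aLEV, 0, 0)%N = k -> is_level k x ->
      (forall i, rmem s2 (rA, i, 0%N) = rmem s1 (rA, i, 0%N)) ->
      let s3 := setr s2 (rA, k, 0%N) x in
      wp (sn aPOW (NAdd (nv aPOW) (nv aPOW))) 1 (fun s'' =>
        nmem (setn s'' (aLEV, 0, 0)%N k.+1) (aPOW, 0, 0)%N = (2 ^ k.+1)%N /\
        forall i, (i < k.+1)%N ->
          is_level i (rmem (setn s'' (aLEV, 0, 0)%N k.+1) (rA, i, 0%N))) s3.
    move=> p2 k2 lx h2 s3; apply: wp_nset; split.
      by rewrite /= /upd /= p2 addnn -mul2n expnS.
    move=> i; rewrite ltnS leq_eqVlt /= /upd !xpair_eqE /= andbT.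
    by case: eqP => [->//|_ /=] ik; rewrite h2; apply: lev1.
  apply: wp_seq; apply: wp_if; rewrite /= p1.
    case: hg1 => -> _ np; apply: wp_rset; rewrite /= k1; apply: step1 => //.
    by rewrite /is_level np.
  have -> : nmem s1 (aN, 0, 0)%N = n by case: hg1.
  rewrite -ltnNge => pn; apply: wp_seq.
  apply: wp_weaken (wp_descend pn hg1 p1 F1) (leqnn _) _ => s2 fr2 opt2.
  have F2 : rmem s2 (rFSF, 0, 0)%N = (fsf G)%:R by case: fr2 => _ -> //.
  have k2 : nmem s2 (aLEV, 0, 0)%N = k by case: fr2 => -> //.
  have p2 : nmem s2 (aPOW, 0, 0)%N = (2 ^ k)%N by case: fr2 => -> //.
  have A2 i : rmem s2 (rA, i, 0%N) = rmem s1 (rA, i, 0%N) by case: fr2 => _ -> //.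
  apply: wp_if; rewrite /= F2 => h; apply: wp_rset; rewrite /= k2; apply: step1 => //.
    by rewrite /is_level leqNgt pn /= F2; eexists; [exact: opt2|rewrite h].
  by rewrite /is_level leqNgt pn /=; eexists; [exact: opt2|rewrite (negbTE h)].
- by move=> s' _ [].
Qed.

Definition tweigh : nat :=
  tseq 1 (tseq 1 (tseq 1 (tfor (n + 2) (tseq 1 (tseq 1 (tseq (tseq 1 1)
    (tseq (tseq 1 1) (tseq 1 (tseq 1 1))))))))).

Lemma wp_weigh s a : holds_graph G s -> rmem s (rEPS, 0, 0)%N = eps ->
  (forall i, (i < n + 3)%N -> rmem s (rA, i, 0%N) = a i) ->
  wp weigh tweigh (fun s' => forall i, (i < n + 2)%N ->
    rmem s' (rE, i, 0%N) = level_weight a i) s.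
Proof.
move=> hg he ha.
have hn : nmem s (aN, 0, 0)%N = n by case: hg.
apply: wp_seq; apply: wp_rset; apply: wp_seq; apply: wp_nset; apply: wp_seq.
apply: wp_rset; set s1 := setr _ _ _.
have tau1 : rmem s1 (rTAU, 0, 0)%N = tau by rewrite /s1 /= /upd /= he hn.
have prev1 : rmem s1 (rPREV, 0, 0)%N = tau by rewrite /s1 /= /upd /= he hn.
have pow1 : nmem s1 (aPOW, 0, 0)%N = 1%N by [].
have n1 : nmem s1 (aN, 0, 0)%N = n by [].
have e1 : rmem s1 (rEPS, 0, 0)%N = eps by [].
have a1 i : (i < n + 3)%N -> rmem s1 (rA, i, 0%N) = a i by exact: ha.
clearbody s1.
apply: (wp_for (N := (n + 2)%N) (Inv := fun k s' => [/\
   nmem s' (aPOW, 0, 0)%N = (2 ^ k)%N, rmem s' (rPREV, 0, 0)%N = prev_slope a k &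
   forall i, (i < k)%N -> rmem s' (rE, i, 0%N) = level_weight a i])) => //.
- by move=> s' [f _ _]; rewrite /= f // n1.
- move=> k s2 kn fr2 k2 [p2 prev2 E2].
  have tau2 : rmem s2 (rTAU, 0, 0)%N = tau by case: fr2 => _ -> //.
  have e2 : rmem s2 (rEPS, 0, 0)%N = eps by case: fr2 => _ -> //.
  have a2 i : (i < n + 3)%N -> rmem s2 (rA, i, 0%N) = a i.
    by case: fr2 => _ h _ /a1 <-; exact: h.
  have ak : rmem s2 (rA, k, 0%N) = a k by rewrite a2 //; lia.
  have ak1 : rmem s2 (rA, k.+1, 0%N) = a k.+1 by rewrite a2 //; lia.
  apply: wp_seq; apply: wp_rset; rewrite /= k2 addn1 ak ak1 p2 -/(slope a k).
  apply: wp_seq; apply: wp_rset; rewrite /=; set s3 := setr _ _ _.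
  have S3 : rmem s3 (rSLOPE, 0, 0)%N = slope a k by [].
  have T3 : rmem s3 (rT, 0, 0)%N = 0 by [].
  have tau3 : rmem s3 (rTAU, 0, 0)%N = tau by [].
  have e3 : rmem s3 (rEPS, 0, 0)%N = eps by [].
  have prev3 : rmem s3 (rPREV, 0, 0)%N = prev_slope a k by [].
  have k3 : nmem s3 (aLEV, 0, 0)%N = k by [].
  have p3 : nmem s3 (aPOW, 0, 0)%N = (2 ^ k)%N by [].
  have E3 i : (i < k)%N -> rmem s3 (rE, i, 0%N) = level_weight a i by exact: E2.
  clearbody s3; apply: wp_seq.
  set c1 := If _ _ _.
  have w1 : wp c1 (tseq 1 1) (fun s4 => rmem s4 (rT, 0, 0)%N =
      if slope a k <= tau then 0 else slope a k - tau) s3.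
    apply: wp_if; rewrite /= S3 tau3 => h.
      by apply: wp_skip; rewrite h T3.
    by apply: wp_rset; rewrite /= /upd /= S3 tau3 (negbTE h).
  apply: wp_weaken w1 (leqnn _) _ => s4 fr4 T4.
  have S4 : rmem s4 (rSLOPE, 0, 0)%N = slope a k by case: fr4 => _ -> //.
  have tau4 : rmem s4 (rTAU, 0, 0)%N = tau by case: fr4 => _ -> //.
  have e4 : rmem s4 (rEPS, 0, 0)%N = eps by case: fr4 => _ -> //.
  have prev4 : rmem s4 (rPREV, 0, 0)%N = prev_slope a k by case: fr4 => _ -> //.
  have k4 : nmem s4 (aLEV, 0, 0)%N = k by case: fr4 => -> //.
  have p4 : nmem s4 (aPOW, 0, 0)%N = (2 ^ k)%N by case: fr4 => -> //.
  have E4 i : (i < k)%N -> rmem s4 (rE, i, 0%N) = level_weight a i.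
    by case: fr4 => _ h _ /E3 <-; exact: h.
  apply: wp_seq; set c2 := If _ _ _.
  have w2 : wp c2 (tseq 1 1) (fun s5 => rmem s5 (rT, 0, 0)%N = penalty a k) s4.
    apply: wp_if; rewrite /= tau4 prev4 => h.
      by apply: wp_skip; rewrite /penalty h addr0.
    by apply: wp_rset; rewrite /= /upd /= T4 tau4 prev4 /penalty (negbTE h).
  apply: wp_weaken w2 (leqnn _) _ => s5 fr5 T5.
  have S5 : rmem s5 (rSLOPE, 0, 0)%N = slope a k by case: fr5 => _ -> //.
  have e5 : rmem s5 (rEPS, 0, 0)%N = eps by case: fr5 => _ -> //.
  have k5 : nmem s5 (aLEV, 0, 0)%N = k by case: fr5 => -> //.
  have p5 : nmem s5 (aPOW, 0, 0)%N = (2 ^ k)%N by case: fr5 => -> //.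
  have E5 i : (i < k)%N -> rmem s5 (rE, i, 0%N) = level_weight a i.
    by case: fr5 => _ h _ /E4 <-; exact: h.
  apply: wp_seq; apply: wp_rset; rewrite /= k5 e5 T5 -/(level_weight a k).
  apply: wp_seq; apply: wp_rset; apply: wp_nset; split.
  + by rewrite /= /upd /= p5 addnn -mul2n expnS.
  + by rewrite /= /upd /= S5.
  + move=> i; rewrite ltnS leq_eqVlt /= /upd !xpair_eqE /= andbT.
    by case: eqP => [->//|_ /=] ik; apply: E5.
- by move=> s' _ [].
Qed.

Definition tnormalize : nat := tseq 1 (tseq (tfor n.+1 1) 1).

Lemma wp_normalize s e : holds_graph G s ->
  (forall i, (i < n + 2)%N -> rmem s (rE, i, 0%N) = e i) ->
  wp normalize tnormalize (fun s' => rmem s' (rZ, 0, 0)%N = mass e n.+1 1) s.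
Proof.
move=> hg hE; have hn : nmem s (aN, 0, 0)%N = n by case: hg.
apply: wp_seq; apply: wp_rset; set s1 := setr _ _ _; apply: wp_seq.
apply: (wp_for (N := n.+1) (Inv := fun k s' => rmem s' (rZ, 0, 0)%N =
   \sum_(0 <= i < k) e i * (brk i.+1 - brk i))) => //.
- by move=> s' [f _ _]; rewrite /= f //= hn addn1.
- by rewrite big_geq.
- move=> k s2 kn fr2 k2 Z2; apply: wp_rset.
  have E2 : rmem s2 (rE, k, 0%N) = e k.
    by case: fr2 => _ -> // _; apply: hE; lia.
  by rewrite /= /upd /= Z2 k2 E2 !addn1 big_nat_recr //= /brk.
- move=> s2 fr2 Z2; apply: wp_rset; rewrite /= /upd /= Z2 mass1E big_mkord.
  have -> : nmem s2 (aN, 0, 0)%N = n by case: fr2 => -> //.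
  have E2 : rmem s2 (rE, n.+1, 0%N) = e n.+1.
    by case: fr2 => _ -> // _; apply: hE; lia.
  by rewrite !addn1 E2 /brk.
Qed.

Definition tprepare : nat :=
  tseq (tfor n 1) (tseq (tkruskal n) (tseq 1 (tseq 1 (tseq tlevels (tseq tweigh tnormalize))))).

Definition prepared a s :=
  [/\ nmem s (aN, 0, 0)%N = n, rmem s (rEPS, 0, 0)%N = eps,
      forall i, (i < n + 2)%N -> rmem s (rA, i, 0%N) = a i,
      forall i, (i < n + 2)%N -> rmem s (rE, i, 0%N) = level_weight a i &
      rmem s (rZ, 0, 0)%N = mass (level_weight a) n.+1 1].

Lemma wp_prepare s : holds_graph G s -> rmem s (rEPS, 0, 0)%N = eps ->
  wp prepare tprepare (fun s' => exists2 a, forall i, is_level i (a i) & prepared a s') s.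
Proof.
move=> hg he; apply: wp_seq.
apply: wp_weaken (wp_zero_duals hg) (leqnn _) _ => s1 fr1 y1.
have hg1 : holds_graph G s1 by apply: holds_graph_frame fr1 hg.
have e1 : rmem s1 (rEPS, 0, 0)%N = eps by case: fr1 => _ -> //.
apply: wp_seq; apply: wp_weaken (wp_kruskal hg1 y1) (leqnn _) _.
move=> s2 fr2 [f [ff hv _ hmax]].
have hg2 : holds_graph G s2 by apply: holds_graph_frame fr2 hg1.
have e2 : rmem s2 (rEPS, 0, 0)%N = eps by case: fr2 => _ -> //.
have F2 : rmem s2 (rVAL, 0, 0)%N = (fsf G)%:R.
  have w1 q : \sum_(e <- q) wt (fun=> 0 : R) e = (size q)%:R.
    by rewrite sum_incidences big1 ?subr0 // => v _; rewrite mulr0.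
  rewrite hv w1; congr (_%:R); apply/eqP; rewrite eqn_leq edge_forest_size //=.
  have [g [_ fg <-]] := @spanning_edge_forest n G G (fun _ _ => id) (fun _ _ => erefl).
  by have := hmax g fg; rewrite !w1 ler_nat.
apply: wp_seq; apply: wp_rset; apply: wp_seq; apply: wp_nset; set s3 := setn _ _ _.
have hg3 : holds_graph G s3 by case: hg2.
have e3 : rmem s3 (rEPS, 0, 0)%N = eps by [].
have F3 : rmem s3 (rFSF, 0, 0)%N = (fsf G)%:R by [].
have p3 : nmem s3 (aPOW, 0, 0)%N = 1%N by [].
apply: wp_seq; apply: wp_weaken (wp_levels hg3 F3 p3) (leqnn _) _ => s4 fr4 lev4.
have hg4 : holds_graph G s4 by apply: holds_graph_frame fr4 hg3.
have e4 : rmem s4 (rEPS, 0, 0)%N = eps by case: fr4 => _ -> //.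
(* The analysis uses infinite sequences; beyond the computed range the values continue by [f_sf]. *)
pose a i := if (i < n + 3)%N then rmem s4 (rA, i, 0%N) else (fsf G)%:R.
have a4 i : (i < n + 3)%N -> rmem s4 (rA, i, 0%N) = a i by rewrite /a => ->.
have leva i : is_level i (a i).
  rewrite /a; case: ltnP => [/lev4 //|h]; rewrite /is_level ifT //.
  by apply: leq_trans (ltnW (ltn_expl i (isT : (1 < 2)%N))); lia.
apply: wp_seq; apply: wp_weaken (wp_weigh hg4 e4 a4) (leqnn _) _ => s5 fr5 E5.
have hg5 : holds_graph G s5 by apply: holds_graph_frame fr5 hg4.
have e5 : rmem s5 (rEPS, 0, 0)%N = eps by case: fr5 => _ -> //.
apply: wp_weaken (wp_normalize hg5 E5) (leqnn _) _ => s6 fr6 Z6; exists a => //.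
split=> //.
- by case: fr6 => -> // _ _; case: hg5.
- by case: fr6 => _ -> //.
- move=> i ni; rewrite -a4; last by lia.
  by case: fr6 => _ -> // _; case: fr5 => _ -> //.
- by move=> i ni; case: fr6 => _ -> // _; exact: E5.
Qed.

Fixpoint twalk (m : nat) : nat :=
  if m is m'.+1 then tseq (tseq 1 1) (twalk m') else 1.

Lemma twalk_gt0 m : (0 < twalk m)%N. Proof. by case: m. Qed.

Lemma wp_walk (e : nat -> R) m i t s : (i + m = n.+1)%N ->
  nmem s (aN, 0, 0)%N = n -> (forall i, (i < n + 2)%N -> rmem s (rE, i, 0%N) = e i) ->
  nmem s (aLEV, 0, 0)%N = i -> rmem s (rT, 0, 0)%N = t ->
  wp walk (twalk m)
    (fun s' => (nmem s' (aLEV, 0, 0)%N, rmem s' (rT, 0, 0)%N) = sel e m i t) s.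
Proof.
elim: m i t s => [|m IH] i t s im hn hE hi ht.
  apply: wp_stop => /=; last by rewrite hi ht.
  by rewrite hn hi (_ : i = n.+1) ?addn1 ?ltnn //; lia.
have piece : reval s (piece_exp (nv aLEV)) = e i * (brk i.+1 - brk i).
  by rewrite /= hi hE ?addn1 //; lia.
have cond : beval s (BAnd (nlt (nv aLEV) (NAdd (nv aN) (NConst 1)))
    (RLe (piece_exp (nv aLEV)) (rv rT))) = (e i * (brk i.+1 - brk i) <= t).
  rewrite -[LHS]/((nmem s (aLEV, 0, 0)%N + 1 <= nmem s (aN, 0, 0)%N + 1)%N &&
    (reval s (piece_exp (nv aLEV)) <= rmem s (rT, 0, 0)%N)).
  by rewrite piece ht hn hi (_ : (i + 1 <= n + 1)%N) //; lia.
rewrite /=; case: leP => h; last first.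
  apply: (@wp_weaken _ _ 1); [|exact: twalk_gt0 m.+1|by move=> s' _ q; exact: q].
  by apply: wp_stop; rewrite ?cond -?ltNge // hi ht.
apply: wp_loop; first by rewrite cond.
apply: wp_seq; apply: wp_rset; apply: wp_nset; apply: IH => //.
- lia.
- by rewrite /= /upd /= hi addn1.
- by rewrite -piece -ht.
Qed.

Definition tselect : nat :=
  tseq (tseq 1 1) (tseq 1 (tseq 1 (tseq (twalk n.+1) (tseq 1 1)))).

Lemma wp_select a s u v : prepared a s ->
  rmem s (rU, 0, 0)%N = u -> rmem s (rV, 0, 0)%N = v ->
  wp select tselect (fun s' => rmem s' (rOUT, 0, 0)%N =
    release a n.+1 eps (pick (level_weight a) n.+1 u) v) s.
Proof.
case=> hn he hA hE hZ hu hv; set e := level_weight a in hE hZ *.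
apply: wp_seq; set c1 := clamp_sample.
have w1 : wp c1 (tseq 1 1) (fun s' => rmem s' (rU, 0, 0)%N = guard u) s.
  have cond : beval s (BAnd (BNot (RLe (rv rU) (rc 0))) (BNot (RLe (rc 1) (rv rU)))) =
      (0 < u < 1) by rewrite /= hu -!ltNge.
  apply: wp_if; rewrite cond /guard => h; first by apply: wp_skip; rewrite h.
  by apply: wp_rset; rewrite (negbTE h) /= /upd /= mul1r.
apply: wp_weaken w1 (leqnn _) _ => s1 fr1 u1.
have n1 : nmem s1 (aN, 0, 0)%N = n by case: fr1 => -> //.
have e1 : rmem s1 (rEPS, 0, 0)%N = eps by case: fr1 => _ -> //.
have A1 i : (i < n + 2)%N -> rmem s1 (rA, i, 0%N) = a i.
  by case: fr1 => _ h _ /hA <-; exact: h.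
have E1 i : (i < n + 2)%N -> rmem s1 (rE, i, 0%N) = e i.
  by case: fr1 => _ h _ /hE <-; exact: h.
have Z1 : rmem s1 (rZ, 0, 0)%N = mass e n.+1 1 by case: fr1 => _ -> //.
have v1 : rmem s1 (rV, 0, 0)%N = v by case: fr1 => _ -> //.
apply: wp_seq; apply: wp_rset; rewrite /= u1 Z1; apply: wp_seq; apply: wp_nset.
rewrite /=; set s2 := setn _ _ _.
have n2 : nmem s2 (aN, 0, 0)%N = n by [].
have e2 : rmem s2 (rEPS, 0, 0)%N = eps by [].
have A2 i : (i < n + 2)%N -> rmem s2 (rA, i, 0%N) = a i by exact: A1.
have E2 i : (i < n + 2)%N -> rmem s2 (rE, i, 0%N) = e i by exact: E1.
have v2 : rmem s2 (rV, 0, 0)%N = v by [].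
have T2 : rmem s2 (rT, 0, 0)%N = guard u * mass e n.+1 1 by [].
have L2 : nmem s2 (aLEV, 0, 0)%N = 0%N by [].
clearbody s2; apply: wp_seq.
apply: wp_weaken (wp_walk (add0n _) n2 E2 L2 T2) (leqnn _) _.
rewrite -/(pick_piece e n.+1 u) => s3 fr3 sel3.
have egt0 i : 0 < e i by exact: expR_gt0.
have [iJ /andP[p1 _] p2 _] := pickP n.+1 egt0 u.
rewrite -[(pick_piece _ _ _).1]/((pick_piece e n.+1 u).1) -sel3 /= in iJ p1 p2.
have e3 : rmem s3 (rEPS, 0, 0)%N = eps by case: fr3 => _ -> //.
have v3 : rmem s3 (rV, 0, 0)%N = v by case: fr3 => _ -> //.
have A3 i : (i < n + 2)%N -> rmem s3 (rA, i, 0%N) = a i.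
  by case: fr3 => _ h _ /A2 <-; exact: h.
have E3 i : (i < n + 2)%N -> rmem s3 (rE, i, 0%N) = e i.
  by case: fr3 => _ h _ /E2 <-; exact: h.
have pE : pick e n.+1 u = brk (nmem s3 (aLEV, 0, 0)%N) +
    rmem s3 (rT, 0, 0)%N / e (nmem s3 (aLEV, 0, 0)%N) by rewrite /pick -sel3.
have i3 : (nmem s3 (aLEV, 0, 0)%N < n + 2)%N by lia.
apply: wp_seq; apply: wp_rset; rewrite /= addn1 (E3 _ i3) -/(brk _) -pE.
apply: wp_rset; rewrite /= /upd /= (A3 _ i3) e3 v3 /release (stepf_piece a iJ p1 p2).
by rewrite /scale /noise /powR gt_eqF.
Qed.

Definition testimator : nat :=
  (tprepare + (tselect + 5)).+1.

(** The preparation runs before any sample is read, so one sequence [a] serves all tapes. *)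
Lemma run_estimator : exists2 a, forall i, is_level i (a i) &
  forall u, halts_within estimator G eps u testimator /\
    output estimator G eps u testimator =
    release a n.+1 eps (pick (level_weight a) n.+1 (u 0%N)) (u 1%N).
Proof.
pose s0 := State (init_nmem G) (init_rmem eps) 0.
have hg0 : holds_graph G s0.
  by split=> // x z; rewrite /= !valK.
have e0 : rmem s0 (rEPS, 0, 0)%N = eps by rewrite /= /init_rmem eqxx.
have [t1 [s1 [l1 x1 [a leva prep]]]] := wp_prepare hg0 e0; exists a => // u.
have [_ _ ns1] := exec_frame x1.
pose s2 := State (nmem s1) (upd (rmem s1) (rU, 0, 0)%N (u 0%N)) 1.
pose s3 := State (nmem s2) (upd (rmem s2) (rV, 0, 0)%N (u 1%N)) 2.
have prep3 : prepared a s3 by case: prep => *; split.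
have [t2 [s4 [l2 x2 out4]]] := wp_select prep3 erefl erefl.
(* One step opens the outer sequence; after the preparation, 4 steps are spent on two more sequences
   and the two samples. *)
have run1 : iter (t2 + (4 + (t1 + 1))) (step u) ([:: estimator], s0) = ([::], s4).
  rewrite iterD [iter (4 + _) _ _]iterD [iter (t1 + _) _ _]iterD.
  rewrite [iter 1 _ _]/= (exec_sound x1) /= ns1 /=; exact: (exec_sound x2).
have fin t : iter t (step u) ([::], s4) = ([::], s4) by elim: t => //= t ->.
have runT : run estimator G eps u testimator = ([::], s4).
  rewrite /run -/s0 (_ : testimator =
    ((testimator - (t2 + (4 + (t1 + 1)))) + (t2 + (4 + (t1 + 1))))%N).
    by rewrite iterD run1 fin.
  by rewrite subnK // /testimator; lia.
by rewrite /halts_within /output runT.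
Qed.

End estimator_correct.

(** * Privacy and accuracy *)

Section levels.
Variables (R : realType) (n : nat) (G : graph n).
Implicit Types (a : nat -> R).

Lemma is_level_dual i (x : R) : is_level G i x -> dual_bound G (2 ^ i)%:R x.
Proof.
rewrite /is_level; case: ifP => [_ ->|_ [g [ub _] ->]]; first exact: dual_bound_fsf.
by case: ifP => // _; exact: dual_bound_fsf.
Qed.

(** Rounding adds at most 1/4 and the descent at most [eta <= 1 / 16]. For large [i] weak duality
    applies with [G] itself as the subgraph. *)
Lemma is_level_lower i (x M : R) : is_level G i x -> dual_bound G (2 ^ i)%:R M ->
  x <= M + 1 / 2.
Proof.
rewrite /is_level; case: leqP => [ni ->|ni [g [_ lb] ->]] dM.
  suff : (fsf G)%:R <= M by lra.
  apply: (@dual_bound_ge _ _ G G _ _ _ _ _ dM) => //; rewrite ler_nat.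
  exact: leq_trans (max_degree_le G) ni.
have := lb _ dM; have : eta R n <= 1 / 16.
  have n1 : 1 <= n%:R :> R by rewrite ler1n; apply: leq_ltn_trans ni.
  by rewrite /eta -div1r ler_pdivrMr; lra.
by case: ifP => h; lra.
Qed.

Lemma is_level_le i (x : R) : is_level G i x -> x <= (fsf G)%:R.
Proof.
rewrite /is_level; case: ifP => [_ ->//|_ [g _ ->]].
by case: ifP => // /negbT; rewrite -ltNge; lra.
Qed.

Lemma is_level_exact i (x : R) (F : graph n) : subrel F G -> connect F =2 connect G ->
  (max_degree F <= 2 ^ i)%N -> is_level G i x -> x = (fsf G)%:R.
Proof.
move=> FG FGc dF; rewrite /is_level; case: ifP => [_ //|_ [g [ub _] ->]].
have : (fsf G)%:R <= g by apply: (dual_bound_ge FG FGc _ ub); rewrite ler_nat.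
by move=> h; rewrite ifT //; lra.
Qed.

Lemma is_level_large a i : (forall i, is_level G i (a i)) -> (n <= i)%N ->
  a i = (fsf G)%:R.
Proof.
move=> la ni; have := la i; rewrite /is_level ifT // (leq_trans ni) //.
exact: ltnW (ltn_expl _ _).
Qed.

Lemma slope_large a i : (forall i, is_level G i (a i)) -> (n <= i)%N -> slope a i = 0.
Proof.
by move=> la ni; rewrite /slope !(is_level_large la) ?subrr ?mul0r // ltnW.
Qed.

Lemma level_weight_large eps a i : (forall i, is_level G i (a i)) -> (n.+1 <= i)%N ->
  level_weight n eps a i = level_weight n eps a n.+1.
Proof.
case: i => // i la; rewrite ltnS => ni; rewrite /level_weight /penalty /=.
by rewrite !(slope_large la) // ltnW.
Qed.

End levels.

(** * Sensitivity to the removal of a vertex *)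

Section sensitivity.
Variable R : realType.

(** From [expR (- (1 / 8)) >= 7 / 8], e is at most [(8 / 7) ^ 8], about 2.91. *)
Lemma expR1_le3 : expR 1 <= 3 :> R.
Proof.
have h : expR (1 / 8) <= 8 / 7 :> R.
  have h0 : 7 / 8 <= expR (- (1 / 8)) :> R.
    by have := @expR_ge1Dx R (- (1 / 8)); lra.
  rewrite -[leLHS]invrK -expRN -[leRHS]invf_div lef_pV2 ?posrE ?expR_gt0 //.
have -> : 1 = 8%:R * (1 / 8) :> R by rewrite mulrCA divff ?mulr1.
rewrite expRM_natl; apply: (@le_trans _ _ ((8 / 7) ^+ 8)).
  by apply: lerXn2r; rewrite ?nnegrE ?expR_ge0 // divr_ge0.
rewrite !exprS expr0; lra.
Qed.

Lemma ln_ge1 (x : R) : 3 <= x -> 1 <= ln x.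
Proof.
move=> x3; rewrite -ler_expR lnK ?posrE; last lra.
exact: le_trans expR1_le3 x3.
Qed.

(** The derivative of [ln (ln x)] is [1 / (x ln x)], at most [1 / x] once [ln x >= 1];
    [ln (1 + x) <= x] is applied to both logarithms. *)
Lemma lnlnS (m : R) : 3 <= m -> 0 <= ln (ln (m + 1)) - ln (ln m) <= m^-1.
Proof.
move=> m3; have m0 : 0 < m by lra. have m1 : 0 < m + 1 by lra.
have l1 := ln_ge1 m3; have l0 : 0 < ln m by lra.
have inc : ln m <= ln (m + 1) by rewrite ler_ln ?posrE //; lra.
have up : ln (m + 1) <= ln m + m^-1.
  have -> : m + 1 = m * (1 + m^-1) by field; rewrite gt_eqF.
  have i0 : 0 < m^-1 by rewrite invr_gt0.
  rewrite lnM ?posrE //; last by lra.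
  by rewrite lerD2l; apply: le_ln1Dx; lra.
have l0' : 0 < ln (m + 1) by lra.
apply/andP; split; first by rewrite subr_ge0 ler_ln ?posrE.
rewrite -ln_div ?posrE //.
have -> : ln (m + 1) / ln m = 1 + (ln (m + 1) - ln m) / ln m by field; rewrite gt_eqF.
have d0 : 0 <= (ln (m + 1) - ln m) / ln m by rewrite divr_ge0 ?subr_ge0 // ltW.
apply: le_trans (le_ln1Dx _) _; first lra.
rewrite ler_pdivrMr // (_ : ln (m + 1) = ln m + (ln (m + 1) - ln m)); last by ring.
have i0 : 0 < m^-1 by rewrite invr_gt0.
have : m^-1 <= m^-1 * ln m by rewrite ler_peMr // ltW.
lra.
Qed.

(** The shift by [48 / eps] inside [tau] serves this bound: it makes the increment of the iterated
    logarithm at most [eps / 48], and [144 / 48 = 3]. *)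
Lemma tau_step n (eps : R) : 0 < eps -> 0 <= tau n.+1 eps - tau n eps <= 3.
Proof.
move=> e0; rewrite /tau -mulrBl -mulrBr.
have -> : n.+1%:R + 48 / eps + 3 = (n%:R + 48 / eps + 3) + 1 :> R by rewrite -natr1; ring.
have q0 : 0 < 48 / eps by rewrite divr_gt0.
have n0 : 0 <= n%:R :> R by rewrite ler0n.
have m3 : 3 <= n%:R + 48 / eps + 3 by lra.
have /andP[l0 l1] := lnlnS m3.
have mi : (n%:R + 48 / eps + 3)^-1 <= eps / 48.
  rewrite -[leRHS]invf_div lef_pV2 ?posrE //; lra.
rewrite divr_ge0 ?mulr_ge0 ?(ltW e0) //= ler_pdivrMr //.
move: (le_trans l1 mi) => h; lra.
Qed.

Section neighbors.
Variables (n : nat) (G : graph n.+1) (G' : graph n) (v : 'I_n.+1) (f : 'I_n -> 'I_n.+1).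
Hypotheses (f_inj : injective f) (f_codom : forall x, (x \in codom f) = (x != v))
  (f_edge : forall x y, G' x y = G (f x) (f y)).
Variables (a a' : nat -> R) (eps : R).
Hypotheses (eps0 : 0 < eps) (la : forall i, is_level G i (a i))
  (la' : forall i, is_level G' i (a' i)).

(** Removing a vertex lowers [f_D] by at least 0 and at most [D = 2 ^ i]; the halves cover
    approximation and rounding. *)
Lemma level_sensitivity i : - (1 / 2) <= a i - a' i <= 2 ^+ i + 1 / 2.
Proof.
have h1 := is_level_lower (la' i)
  (dual_bound_remove f_inj f_codom f_edge (ler0n _ _) (is_level_dual (la i))).
have h2 := is_level_lower (la i)
  (dual_bound_insert f_inj f_codom f_edge (is_level_dual (la' i))).
move: h2; rewrite natrX; lra.
Qed.

Lemma level_dist i : `|a i - a' i| <= 2 * 2 ^+ i.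
Proof.
have /andP[h1 h2] := level_sensitivity i.
have : 1 <= 2 ^+ i :> R by rewrite exprn_ege1 // ler1n.
rewrite ler_norml; lra.
Qed.

(** The level differences at [i] and [i + 1] are of order [2 ^ i], which the division cancels; their
    additive halves sum to 1, at most [2 ^ i]. *)
Lemma slope_sensitivity i : - 2 <= slope a i - slope a' i <= 3.
Proof.
have /andP[h1 h2] := level_sensitivity i; have /andP[h3 h4] := level_sensitivity i.+1.
have p1 : 1 <= 2 ^+ i :> R by rewrite exprn_ege1 // ler1n.
move: h4; rewrite exprS => h4.
rewrite /slope -mulrBl natrX ler_pdivlMr ?ler_pdivrMr; lra.
Qed.

(** Each term is the positive part of a difference between a slope and [tau], hence moves by at most
    6. At level 0 the second term vanishes. *)
Lemma penalty_sensitivity i :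
  `|penalty n.+1 eps a i - penalty n eps a' i| <= 12.
Proof.
have /andP[t1 t2] := tau_step n eps0; have /andP[s1 s2] := slope_sensitivity i.
rewrite ler_norml /penalty.
case: i s1 s2 => [|i] s1 s2 /=.
  rewrite !lexx; case: (leP (slope a 0) _) => h1; case: (leP (slope a' 0) _) => h2; lra.
have /andP[s3 s4] := slope_sensitivity i.
case: (leP (slope a i.+1) _) => h1; case: (leP (slope a' i.+1) _) => h2;
  case: (leP (tau n.+1 eps) (slope a i)) => h3;
  case: (leP (tau n eps) (slope a' i)) => h4; lra.
Qed.

Lemma level_weight_sensitivity i :
  level_weight n.+1 eps a i <= expR (eps / 4) * level_weight n eps a' i /\
  level_weight n eps a' i <= expR (eps / 4) * level_weight n.+1 eps a i.
Proof.
have := penalty_sensitivity i; rewrite ler_norml /level_weight => /andP[h1 h2].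
move: (penalty _ _ _ _) (penalty _ _ _ _) h1 h2 => x y h1 h2.
have : 0 <= eps * (x - y + 12) by rewrite mulr_ge0 ?(ltW eps0) //; lra.
have : 0 <= eps * (12 - (x - y)) by rewrite mulr_ge0 ?(ltW eps0) //; lra.
by rewrite -!expRD !ler_expR => p1 p2; split; lra.
Qed.

End neighbors.

Lemma node_removal_size n n' (G : graph n) (G' : graph n') :
  node_removal G G' -> n = n'.+1.
Proof.
case=> v [f [fi fc _]].
have : #|codom f| = n.-1.
  by rewrite (eq_card fc) cardC1 card_ord.
rewrite card_codom // card_ord => ->; rewrite prednK //.
by case: n v {G f fi fc} => // -[].
Qed.

Lemma levels_private n n' (G : graph n) (G' : graph n') (a a' : nat -> R) eps
    (A : set R) : 0 < eps -> measurable A -> node_neighbors G G' ->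
  (forall i, is_level G i (a i)) -> (forall i, is_level G' i (a' i)) ->
  (mech_prob (level_weight n eps a) a n.+1 eps A <=
   (expR eps)%:E * mech_prob (level_weight n' eps a') a' n'.+1 eps A)%E.
Proof.
move=> e0 mA nb la la'.
have ca m (H : graph m) (b : nat -> R) : (forall i, is_level H i (b i)) ->
    forall i, (m.+1 <= i)%N -> b i = b m.+1.
  by move=> lb i mi; rewrite !(is_level_large lb) // ltnW.
have gt0 m (b : nat -> R) i : 0 < level_weight m eps b i by exact: expR_gt0.
apply: mech_private => //.
- by move=> i; exact: (level_weight_large eps la).
- by move=> i; exact: (level_weight_large eps la').
- exact: ca la.
- exact: ca la'.
- case: nb => /[dup] /node_removal_size E; subst => -[v [f [fi fc fe]]] i.
    by have [] := level_weight_sensitivity fi fc fe e0 la la' i.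
  by have [] := level_weight_sensitivity fi fc fe e0 la' la i.
- case: nb => /[dup] /node_removal_size E; subst => -[v [f [fi fc fe]]] i.
    by have [] := level_weight_sensitivity fi fc fe e0 la la' i.
  by have [] := level_weight_sensitivity fi fc fe e0 la' la i.
- case: nb => /[dup] /node_removal_size E; subst => -[v [f [fi fc fe]]] i.
    exact: (level_dist fi fc fe la la').
  by rewrite distrC; exact: (level_dist fi fc fe la' la).
Qed.

End sensitivity.

(** * Bias of a selected level *)

Section level_accuracy.
Variables (R : realType) (n : nat) (G F : graph n) (D : nat) (a : nat -> R).
Hypotheses (FG : subrel F G) (FGc : connect F =2 connect G) (dF : max_degree F = D).
Hypothesis la : forall i, is_level G i (a i).

Let D_le : (D <= n)%N. Proof. by rewrite -dF max_degree_le. Qed.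

Lemma is_level_cases i (x : R) : is_level G i x ->
  x = (fsf G)%:R \/ [/\ (2 ^ i < n)%N, near_optimal G (2 ^ i) x & x < (fsf G)%:R - 1 / 4].
Proof.
rewrite /is_level; case: leqP => [_ ->|ni [g opt ->]]; first by left.
have [h|h] := leP ((fsf G)%:R - 1 / 4) g; first by left.
by right; split.
Qed.

Lemma level_exact i : (D <= 2 ^ i)%N -> a i = (fsf G)%:R.
Proof. by move=> Di; apply: (is_level_exact FG FGc _ (la i)); rewrite dF. Qed.

(** By concavity the values beyond level [i + 1] climb no faster, up to [eta], than between [i] and
    [i + 1]. Going on to [D], where the value is [f_sf], thus gains little more than [2 t D]. *)
Lemma level_gap i (t : R) : 0 < t -> slope a i <= 2 * t ->
  (fsf G)%:R - a i <= 4 * t * D%:R.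
Proof.
move=> t0; have D0 : 0 <= D%:R :> R by rewrite ler0n.
have tD : 0 <= t * D%:R by rewrite mulr_ge0 // ltW.
case: (is_level_cases (la i)) => [->|[ni [_ lb] gap]]; first by lra.
have P1 : 1 <= 2 ^+ i :> R by rewrite exprn_ege1 // ler1n.
have P0 : 0 < 2 ^+ i :> R by lra.
have PD : 2 ^+ i <= D%:R :> R.
  rewrite -natrX ler_nat ltnW // ltnNge; apply/negP => /level_exact h.
  by move: gap; rewrite h; lra.
rewrite /slope natrX ler_pdivrMr // => sl.
have tP : t * 2 ^+ i <= t * D%:R by rewrite ler_pM2l.
case: (is_level_cases (la i.+1)) => [h|[_ [ub _] gap1]]; first by lra.
have PD1 : 2 * 2 ^+ i <= D%:R :> R.
  rewrite -exprS -natrX ler_nat ltnW // ltnNge; apply/negP => /level_exact h.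
  by move: gap1; rewrite h; lra.
(* The line of slope [sigma] through level [i + 1] bounds [f_sf] at [D], and at [2 ^ i] it is
   compared with [a i] by near optimality. *)
have [sigma s0 hs] := dual_bound_slope ub.
have dF' : (max_degree F)%:R <= D%:R :> R by rewrite dF.
have h1 := dual_bound_ge FG FGc dF' (hs D%:R).
have := lb _ (hs (2 ^ i)%:R); move: h1; rewrite !natrX exprS => h1 h2.
have nD : D%:R <= n%:R :> R by rewrite ler_nat.
have etaD : D%:R * eta R n <= 1 / 16.
  have n1 : 1 <= n%:R :> R by rewrite ler1n; apply: leq_ltn_trans ni.
  by rewrite /eta ler_pdivrMr; lra.
have eta0 : 0 <= eta R n by rewrite /eta invr_ge0 mulr_ge0.
move: (fsf G)%:R (a i) (a i.+1) (2 ^+ i) (D%:R : R) (eta R n) D0 tD gap P1 P0 PD sl tP gap1 PD1 h1 h2 nD etaD eta0 {ub lb hs dF'}.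
move=> f x y P d h D0 tD gap P1 P0 PD sl tP gap1 PD1 h1 h2 nD etaD eta0.
have h3 : P * sigma <= y - x + h by lra.
have h4 : (d - 2 * P) * (P * sigma) <= (d - 2 * P) * (y - x + h).
  by rewrite ler_wpM2l //; lra.
have h5 : P * (f - x) <= P * (y - x) + (d - 2 * P) * (y - x + h).
  have : P * f <= P * (y + (d - 2 * P) * sigma) by rewrite ler_pM2l.
  lra.
have h6 : (d - P) * (y - x) <= (d - P) * (2 * t * P).
  by rewrite ler_wpM2l //; lra.
have h7 : d * h <= P * (d * h) by rewrite ler_peMl // mulr_ge0.
have h8 : 0 <= P * h by rewrite mulr_ge0 // ltW.
have h9 : P * (f - x) <= P * (2 * t * d + d * h).
  have : 0 <= t * P * P by rewrite !mulr_ge0 // ltW.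
  lra.
(* The error [d h] is at most 1/16, less than a quarter of [f - x]; passing from [2 t d] to [4 t d]
   absorbs it. *)
by move: h9; rewrite ler_pM2l //; lra.
Qed.

End level_accuracy.

Lemma half_le_ln2 (R : realType) : 1 / 2 <= ln 2 :> R.
Proof.
have h : 1 / 2 <= expR (- (1 / 2)) :> R.
  by have := @expR_ge1Dx R (- (1 / 2)); lra.
rewrite -ler_expR lnK ?posrE // -[leLHS]invrK -expRN -[leRHS]invrK.
rewrite lef_pV2 ?posrE ?expR_gt0 //; lra.
Qed.

Lemma le_ln_of_exp2 (R : realType) (i n : nat) : (0 < n)%N -> (2 ^ i < 2 * n)%N ->
  i%:R <= 1 + 2 * ln n%:R :> R.
Proof.
move=> n0 h; have n1 : 1 <= n%:R :> R by rewrite ler1n.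
have l2 := half_le_ln2 R; have ln0 : 0 <= ln n%:R :> R by exact: ln_ge0.
have : ln (2 ^+ i) <= ln (2 * n%:R) :> R.
  rewrite ler_ln ?posrE ?exprn_gt0 ?mulr_gt0 ?ltr0n // -natrX -natrM ler_nat.
  exact: ltnW.
rewrite lnXn // lnM ?posrE ?ltr0n // => {}h.
have {}h : i%:R * ln 2 <= ln 2 + ln n%:R :> R by rewrite mulr_natl.
have [i1|i1] := leP i%:R (1 : R); first lra.
have : (i%:R - 1) * (1 / 2) <= (i%:R - 1) * ln 2 :> R.
  by rewrite ler_wpM2l // subr_ge0 ltW.
lra.
Qed.

(** * Accuracy of the estimate *)

Section estimate_accuracy.
Variables (R : realType) (n : nat) (G F : graph n) (D : nat) (a : nat -> R) (eps : R).
Hypotheses (FG : subrel F G) (FGc : connect F =2 connect G) (dF : max_degree F = D).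
Hypotheses (la : forall i, is_level G i (a i)) (eps0 : 0 < eps).
Hypotheses (n27 : (27 <= n)%N) (D1 : (0 < D)%N).

Let m : R := n%:R + 48 / eps + 3.
Let lnlnn : R := ln (ln n%:R).

Let n_ge : 27 <= n%:R :> R. Proof. by rewrite ler_nat. Qed.

Let q0 : 0 < 48 / eps. Proof. by rewrite divr_gt0. Qed.

(** The threshold 27 is [3 ^ 3], above the cube of e. *)
Let ln_n_ge : 3 <= ln n%:R :> R.
Proof.
have -> : 3 = ln (expR 3) :> R by rewrite expRK.
rewrite ler_ln ?posrE ?expR_gt0 ?ltr0n //; last exact: leq_trans n27.
apply: le_trans n_ge; have -> : 3 = 3%:R * 1 :> R by rewrite mulr1.
rewrite expRM_natl; apply: le_trans (_ : 3 ^+ 3 <= _).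
  by apply: lerXn2r; rewrite ?nnegrE ?expR_ge0 ?expR1_le3.
by rewrite !exprS expr0; lra.
Qed.

Let lnlnn_ge1 : 1 <= lnlnn. Proof. exact: ln_ge1. Qed.

Let ln_m_ge : ln n%:R <= ln m.
Proof. by have n0 := n_ge; have q := q0; rewrite ler_ln ?posrE /m; lra. Qed.

Let tau_gt0 : 0 < tau n eps.
Proof.
rewrite /tau -/m divr_gt0 // mulr_gt0 //; apply: ln_gt0.
by have := ln_m_ge; have := ln_n_ge; lra.
Qed.

Let ln_cubic (x : R) : 27 <= x -> ln (52 * x) <= 3 * ln x.
Proof.
move=> x27; have x0 : 0 < x by lra.
have -> : 3 * ln x = ln (x ^+ 3) by rewrite lnXn // mulr_natl.
rewrite ler_ln ?posrE ?exprn_gt0 ?mulr_gt0 //; rewrite !exprS expr0 mulr1; nra.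
Qed.

Let ln2_ge : 1 / 2 <= ln (2 + lnlnn / eps).
Proof.
have l1 := lnlnn_ge1.
have x0 : 0 <= lnlnn / eps by rewrite divr_ge0 ?(ltW eps0) //; lra.
apply: le_trans (half_le_ln2 R) _; rewrite ler_ln ?posrE //; lra.
Qed.

(** If [1 / eps <= n], then [m <= 52 n] and [ln (ln m)] exceeds [ln (ln n)] by at most [ln 3].
    Otherwise [m <= 52 / eps] and [ln (ln m)] is below [3 ln (1 / eps)], which the polylogarithmic
    factor absorbs. *)
Let lnln_m : ln (ln m) <= 11 * lnlnn * ln (2 + lnlnn / eps).
Proof.
have h2 := ln2_ge; have l1 := lnlnn_ge1; have n0 := n_ge; have q := q0.
have qE : 48 / eps = 48 * (1 / eps) by rewrite mulrA mulr1.
set y := ln (2 + _) in h2 *.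
have lny : lnlnn <= 2 * lnlnn * y by nra.
have yl : y <= lnlnn * y by nra.
have lm : 3 <= ln m by have := ln_m_ge; have := ln_n_ge; lra.
have [en|en] := leP (1 / eps) n%:R.
  have mn : m <= 52 * n%:R.
    by rewrite /m qE; lra.
  have h3 : ln m <= 3 * ln n%:R.
    apply: le_trans (ln_cubic n_ge); rewrite ler_ln ?posrE //; rewrite /m; lra.
  have h4 : ln (ln m) <= ln (3 * ln n%:R).
    have := ln_n_ge; move=> ln0; rewrite ler_ln ?posrE //; lra.
  have l3 : ln 3 < 3 :> R by apply: ln_sublinear.
  move: h4; rewrite lnM ?posrE // -/lnlnn; last by have := ln_n_ge; lra.
  lra.
have e27 : 27 <= 1 / eps by lra.
have mn : m <= 52 * (1 / eps).
  by rewrite /m qE; lra.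
have h3 : ln m <= 3 * ln (1 / eps).
  apply: le_trans (ln_cubic e27); rewrite ler_ln ?posrE //; rewrite /m; lra.
have h4 : ln (ln m) < ln m by apply: ln_sublinear; lra.
have h5 : ln (1 / eps) <= y.
  have : 1 / eps <= lnlnn / eps by rewrite ler_pM2r ?invr_gt0.
  move=> h; rewrite /y ler_ln ?posrE; lra.
lra.
Qed.

(** The bias is at most [4 tau D] by [level_gap]. As [p / (1 - p) < i + 1] and [2 ^ (i + 1) < 4 D],
    the noise scale is at most [16 D / eps]. *)
Let error_bound (p z : R) (i : nat) : (2 ^ i < 2 * D)%N -> p < brk i.+1 -> p < 1 ->
  slope a i <= 2 * tau n eps -> `|z| <= lnlnn ->
  `|a i + scale eps p * z - (fsf G)%:R| <= D%:R * softO 6400 1 (lnlnn / eps).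
Proof.
move=> iD pi p1 sl zl.
have gap := level_gap FG FGc dF la tau_gt0 sl; have le := is_level_le (la i).
have s0 := scale_gt0 p eps0.
have sc : scale eps p <= 16 * D%:R / eps.
  rewrite /scale; apply: le_trans (_ : 4 / eps * (2 * (2 * D%:R)) <= _); last first.
    by rewrite le_eqVlt; apply/orP; left; apply/eqP; field; rewrite gt_eqF.
  rewrite ler_pM2l ?divr_gt0 //; apply: le_trans (_ : 2 ^+ i.+1 <= _).
    rewrite -powR_mulrn // ler_powR ?ler1n // leNgt.
    by apply/negP => /ltW; rewrite -brk_odds // leNgt pi.
  by rewrite exprS ler_pM2l // -natrX -natrM ler_nat ltnW.
have h1 : `|a i - (fsf G)%:R| <= 4 * tau n eps * D%:R.
  by rewrite distrC ger0_norm ?subr_ge0.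
have h2 : `|scale eps p * z| <= 16 * D%:R / eps * lnlnn.
  by rewrite normrM (gtr0_norm s0) ler_pM // ltW.
apply: le_trans (_ : 4 * tau n eps * D%:R + 16 * D%:R / eps * lnlnn <= _).
  rewrite addrAC; apply: le_trans (ler_normD _ _) _; exact: lerD.
rewrite /softO expr1 /tau -/m.
have hm := lnln_m; have h3 := ln2_ge; have l1 := lnlnn_ge1.
have De : 0 <= D%:R / eps by rewrite divr_ge0 // ltW.
set y := ln (2 + _) in hm h3 *.
have ly : lnlnn <= 2 * lnlnn * y by nra.
(* Here [576 = 4 * 144], and [lnln_m] with [ly] gives [576 * 11 + 32 = 6368]. *)
have key : 576 * ln (ln m) + 16 * lnlnn <= 6400 * lnlnn * y by lra.
have := ler_wpM2l De key.
have -> : D%:R / eps * (576 * ln (ln m) + 16 * lnlnn) =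
  4 * (144 * ln (ln m) / eps) * D%:R + 16 * D%:R / eps * lnlnn by ring.
by have -> : D%:R / eps * (6400 * lnlnn * y) = D%:R * (6400 * (lnlnn / eps) * y) by ring.
Qed.

(** [i1] is the first level with [D <= 2 ^ i1], from which on the values are exact, and [i0] the
    first one with slope at most [tau], which has no penalty. Levels that are not good have penalty
    at least [tau], hence weight at most [(ln m) ^- 3], while piece [i0] has mass of order at least
    [(ln n) ^- 2]. *)
Lemma estimate_accuracy :
  ((1 - 22 / ln n%:R)%:E <= mech_prob (level_weight n eps a) a n.+1 eps
     [set x | (`|x - (fsf G)%:R| <= D%:R * softO 6400 1 (lnlnn / eps))%R])%E.
Proof.
have Dn : (D <= n)%N by rewrite -dF max_degree_le.
have ex1 : exists i, (D <= 2 ^ i)%N by exists D; exact: ltnW (ltn_expl _ _).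
case: (ex_minnP ex1) => i1 Di1 min1.
have i1D : (2 ^ i1 < 2 * D)%N.
  case: i1 Di1 min1 => [|j] Di1 min1; first by rewrite expn0; exact: leq_pmulr.
  rewrite expnS ltn_pmul2l // ltnNge; apply/negP => /min1; by rewrite ltnn.
have exact_i i : (i1 <= i)%N -> a i = (fsf G)%:R.
  move=> ii; apply: (level_exact FG FGc dF la); apply: leq_trans Di1 _.
  by rewrite leq_exp2l.
have slope0 i : (i1 <= i)%N -> slope a i = 0.
  by move=> ii; rewrite /slope !exact_i ?subrr ?mul0r // ltnW.
have ex0 : exists i, slope a i <= tau n eps by exists i1; rewrite slope0 // ltW.
case: (ex_minnP ex0) => i0 sl0 min0.
have i01 : (i0 <= i1)%N by apply: min0; rewrite slope0 // ltW.
have i1n : (i1 < n.+1)%N.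
  rewrite ltnS leqNgt; apply/negP => ni.
  have h : (2 ^ n.+1 <= 2 ^ i1)%N by rewrite leq_exp2l.
  have := leq_ltn_trans h i1D; rewrite expnS ltn_pmul2l // ltnNge.
  by rewrite (leq_trans Dn) // ltnW // ltn_expl.
pose good i := (i <= i1)%N && (slope a i <= 2 * tau n eps).
pose beta : R := (ln m) ^- 3.
have lm0 : 0 < ln m by have := ln_m_ge; have := ln_n_ge; lra.
have betaE : beta = expR (- (eps / 48 * tau n eps)).
  rewrite /tau -/m (_ : eps / 48 * (144 * ln (ln m) / eps) = 3%:R * ln (ln m)).
    by rewrite expRN expRM_natl lnK // posrE.
  by field; rewrite gt_eqF.
have weight_bad i : (i <= n.+1)%N -> ~~ good i -> level_weight n eps a i <= beta.
  move=> _ bad; rewrite betaE /level_weight sub0r ler_expR lerN2 ler_pM2l ?divr_gt0 //.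
  have t0 := tau_gt0; rewrite /penalty.
  have pos1 : 0 <= (if slope a i <= tau n eps then 0 else slope a i - tau n eps).
    by have [//|h] := leP (slope a i) (tau n eps); rewrite subr_ge0 ltW.
  have pos2 : 0 <= (if tau n eps <= prev_slope n eps a i then 0
      else tau n eps - prev_slope n eps a i).
    have [//|h] := leP (tau n eps) (prev_slope n eps a i).
    by rewrite subr_ge0 ltW.
  (* Beyond [i1] the previous slope is 0 and the second term alone is [tau]; otherwise the slope
     exceeds [2 tau] and the first term is at least [tau]. *)
  move: bad; rewrite negb_and -ltnNge => /orP[|].
    case: i pos1 {pos2} => // i pos1; rewrite ltnS /= => ii.
    have -> : (tau n eps <= slope a i) = false by rewrite slope0 // leNgt t0.
    by rewrite (slope0 i ii) subr0 lerDr.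
  rewrite -ltNge => h.
  have -> : (slope a i <= tau n eps) = false by apply/negbTE; rewrite -ltNge; lra.
  by rewrite -[leLHS]addr0 lerD //; lra.
have weight0 : 1 <= level_weight n eps a i0.
  suff pen0 : penalty n eps a i0 = 0 by rewrite /level_weight pen0 mulr0 subr0 expR0.
  rewrite /penalty sl0 add0r ifT //.
  case: i0 sl0 min0 {i01} => [|j] sl0 min0 /=; first exact: lexx.
  by rewrite leNgt; apply/negP => /ltW /min0; rewrite ltnn.
have mA : measurable [set x : R |
    (`|x - (fsf G)%:R| <= D%:R * softO 6400 1 (lnlnn / eps))%R].
  set r := _ * _.
  have -> : [set x : R | `|x - (fsf G)%:R| <= r] = `[(fsf G)%:R - r, (fsf G)%:R + r]%classic.
    apply/seteqP; split=> x /=; rewrite in_itv /= ler_norml; lra.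
  exact: measurable_itv.
have gt0 i : 0 < level_weight n eps a i by exact: expR_gt0.
have beta0 : 0 <= beta by rewrite betaE expR_ge0.
have l0 : 0 <= lnlnn by have := lnlnn_ge1; lra.
have i0n : (i0 <= n.+1)%N by rewrite (leq_trans i01) // ltnW.
have good_ok i p v : (i <= n.+1)%N -> good i -> brk i <= p < 1 ->
    ((i < n.+1)%N -> p < brk i.+1) -> `|noise v| <= lnlnn ->
    [set x | (`|x - (fsf G)%:R| <= D%:R * softO 6400 1 (lnlnn / eps))%R]
      (a i + scale eps p * noise v).
  move=> _ /andP[ii sl] /andP[_ p1] pi nv /=; apply: error_bound => //.
    by apply: leq_ltn_trans i1D; rewrite leq_exp2l.
  by apply: pi; exact: leq_ltn_trans i1n.
have := mech_accurate mA gt0 i0n weight0 l0 weight_bad good_ok beta0.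
apply: le_trans; rewrite lee_fin.
have ln0 := ln_n_ge; have ln0' : 0 < ln n%:R :> R by lra.
have -> : expR (- lnlnn) = (ln n%:R)^-1 by rewrite expRN lnK.
have i0l : i0%:R <= 1 + 2 * ln n%:R :> R.
  apply: le_trans (_ : i1%:R <= _); first by rewrite ler_nat.
  apply: le_ln_of_exp2; rewrite ?(leq_trans _ n27) //.
  by apply: leq_trans i1D _; rewrite leq_mul2l.
have bl : beta <= (ln n%:R) ^- 3.
  rewrite /beta lef_pV2 ?posrE ?exprn_gt0 // lerXn2r ?nnegrE ?(ltW lm0) ?(ltW ln0') //.
(* As [i0] is logarithmic in [n], a bad selection has probability at most [20 / ln n]; large noise
   adds [2 / ln n]. *)
have prod : i0.+1%:R * i0.+2%:R <= 20 * (ln n%:R) ^+ 2 :> R.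
  have h1 : i0.+1%:R <= 4 * ln n%:R :> R by rewrite -natr1; lra.
  have h2 : i0.+2%:R <= 5 * ln n%:R :> R by rewrite -!natr1; lra.
  have -> : 20 * (ln n%:R) ^+ 2 = 4 * ln n%:R * (5 * ln n%:R) :> R by ring.
  exact: ler_pM.
have p0 : 0 <= i0.+1%:R * i0.+2%:R :> R by rewrite mulr_ge0.
have : beta * (i0.+1%:R * i0.+2%:R) <= (ln n%:R) ^- 3 * (20 * (ln n%:R) ^+ 2).
  exact: ler_pM.
have -> : (ln n%:R) ^- 3 * (20 * (ln n%:R) ^+ 2) = 20 / ln n%:R :> R.
  by field; rewrite gt_eqF.
move=> h; rewrite -!addrA lerD2l -opprD lerN2.
apply: le_trans (lerD h (lexx _)) _.
by rewrite le_eqVlt; apply/orP; left; apply/eqP; ring.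
Qed.

End estimate_accuracy.

(** * The output law as a double integral *)

Section tape.
Variable R : realType.
Let P : probability (measurableTypeR R) R := uniform_prob (@ltr01 R).

Lemma tape_prob_cst m (x : R) (S : set R) :
  tape_prob m [set _ | S x] = ((\1_S x)%:E : \bar R).
Proof.
elim: m => [|m IH] /=.
  by rewrite !indicE; congr (_%:R%:E); apply/idP/idP; rewrite !inE.
rewrite (eq_integral (fun=> (\1_S x)%:E)); last by move=> u _; exact: IH.
rewrite integral_cst //= -[X in (_ * X)%E]/(P setT) probability_setT mule1 //.
Qed.

(** The tape is as long as the time bound, but only two entries matter; the others integrate to
    1. *)
Lemma tape_prob2 m (f : R -> R -> R) (S : set R) :
  tape_prob m.+2 [set s | S (f (nth 0 s 0%N) (nth 0 s 1%N))] =
  (\int[P]_u \int[P]_v (\1_S (f u v))%:E)%E.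
Proof.
by apply: eq_integral => u _; apply: eq_integral => v _ /=; exact: tape_prob_cst.
Qed.

Lemma law_estimator n (G : graph n) (eps : R) :
  exists2 a, forall i, is_level G i (a i) &
  forall S, law estimator (testimator n) eps G S =
    mech_prob (level_weight n eps a) a n.+1 eps S.
Proof.
have [a la run] := run_estimator G eps; exists a => // S.
have [m tE] : exists m, testimator n = m.+2.
  by rewrite /testimator !addnS; eexists.
rewrite /law {1}tE.
have -> : [set s | S (output estimator G eps (nth 0 s) (testimator n))] =
  [set s | S (release a n.+1 eps (pick (level_weight n eps a) n.+1 (nth 0 s 0%N)) (nth 0 s 1%N))].
  by apply/funext => s /=; rewrite (run _).2.
exact: tape_prob2.
Qed.

End tape.

(** * Polynomial running time *)

Section polynomial_bounds.
Implicit Types f g : nat -> nat.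

Lemma polynomially_bounded_cst k : polynomially_bounded (fun=> k).
Proof. by exists k, 0%N => n; rewrite expn0; lia. Qed.

Lemma polynomially_bounded_id : polynomially_bounded id.
Proof. by exists 1%N, 1%N => n; rewrite expn1; lia. Qed.

(** The added 1 covers [n = 0], where [0 ^ 0 = 1]. *)
Let pow_le n k k' : (n ^ k <= n ^ (k + k') + 1)%N.
Proof.
case: n => [|n]; last by rewrite (leq_trans _ (leq_addr _ _)) // leq_pexp2l // leq_addr.
by case: k => [|k]; [rewrite expn0 addn1|rewrite exp0n].
Qed.

Lemma polynomially_bounded_add f g : polynomially_bounded f ->
  polynomially_bounded g -> polynomially_bounded (fun n => f n + g n)%N.
Proof.
move=> [c [k hf]] [c' [k' hg]]; exists (2 * (c + c'))%N, (k + k')%N => n.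
have h1 := hf n; have h2 := hg n.
have p1 := pow_le n k k'; have p2 := pow_le n k' k; rewrite (addnC k' k) in p2.
have := leq_mul (leqnn c) p1; have := leq_mul (leqnn c') p2; lia.
Qed.

Lemma polynomially_bounded_mul f g : polynomially_bounded f ->
  polynomially_bounded g -> polynomially_bounded (fun n => f n * g n)%N.
Proof.
move=> [c [k hf]] [c' [k' hg]]; exists (4 * (c * c'))%N, (k + k')%N => n.
have h := leq_mul (hf n) (hg n); apply: leq_trans h _.
have p1 := pow_le n k k'; have p2 := pow_le n k' k.
rewrite !expnD in p1 p2 *.
move: (n ^ k)%N (n ^ k')%N p1 p2 => x y p1 p2.
have -> : ((c * x + c) * (c' * y + c') = (c * c') * (x * y + x + y + 1))%N by ring.
have -> : (4 * (c * c') * (x * y) + 4 * (c * c') = (c * c') * (4 * (x * y) + 4))%N by ring.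
rewrite leq_mul2l; apply/orP; right; lia.
Qed.

Lemma polynomially_bounded_exp f k : polynomially_bounded f ->
  polynomially_bounded (fun n => f n ^ k)%N.
Proof.
move=> hf; elim: k => [|k IH]; first exact: polynomially_bounded_cst.
have [c [l h]] := polynomially_bounded_mul hf IH.
by exists c, l => n; rewrite expnS.
Qed.

Lemma polynomially_bounded_tseq f g : polynomially_bounded f ->
  polynomially_bounded g -> polynomially_bounded (fun n => tseq (f n) (g n)).
Proof.
move=> hf hg; have h := polynomially_bounded_add (polynomially_bounded_cst 1)
  (polynomially_bounded_add hf hg); exact: h.
Qed.

Lemma polynomially_bounded_tfor f g : polynomially_bounded f ->
  polynomially_bounded g -> polynomially_bounded (fun n => tfor (f n) (g n)).
Proof.
move=> hf hg; apply: polynomially_bounded_add; last exact: polynomially_bounded_cst.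
apply: polynomially_bounded_mul => //; apply: polynomially_bounded_add => //.
exact: polynomially_bounded_cst.
Qed.

Lemma twalkE m : twalk m = (4 * m + 1)%N.
Proof. by elim: m => //= m ->; rewrite /tseq; lia. Qed.

Lemma polynomially_bounded_testimator : polynomially_bounded testimator.
Proof.
have hs := @polynomially_bounded_tseq; have hl := @polynomially_bounded_tfor.
have hc := polynomially_bounded_cst; have hi := polynomially_bounded_id.
have ha := @polynomially_bounded_add; have hm := @polynomially_bounded_mul.
have hn k : polynomially_bounded (fun n => n + k)%N by apply: (ha); [exact: (hi)|exact: (hc)].
have hr : polynomially_bounded tround.
  by rewrite /tround; do ![exact: (hc)|exact: (hi)|apply: (hs)|apply: (hl)].
have hk : polynomially_bounded tkruskal.
  by rewrite /tkruskal; do ![exact: (hc)|exact: (hi)|exact: (hr)|apply: (hs)|apply: (hl)].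
have hb : polynomially_bounded tbody.
  by rewrite /tbody; do ![exact: (hc)|exact: (hi)|exact: (hk)|apply: (hs)|apply: (hl)].
have hd : polynomially_bounded tdescend.
  apply: (hs); first by apply: (hl); [exact: (hi)|exact: (hc)].
  apply: (hs); first exact: hc.
  apply: (hl); last exact: hb.
  by apply: (hm); [exact: (hc)|exact: polynomially_bounded_exp hi].
have hv : polynomially_bounded tlevels.
  by rewrite /tlevels; do ![exact: (hc)|exact: (hn)|exact: (hd)|apply: (hs)|apply: (hl)].
have he : polynomially_bounded tweigh.
  by rewrite /tweigh; do ![exact: (hc)|exact: (hn)|apply: (hs)|apply: (hl)].
have ho : polynomially_bounded tnormalize.
  apply: (hs); first exact: hc.
  apply: (hs); last exact: hc.
  by apply: (hl); [exact: (ha _ _ (hc 1%N) hi)|exact: (hc)].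
have hp : polynomially_bounded tprepare.
  by rewrite /tprepare; do ![exact: (hc)|exact: (hi)|exact: (hk)|exact: (hv)|exact: (he)|exact: (ho)|apply: (hs)|apply: (hl)].
have hw : polynomially_bounded (fun n => twalk n.+1).
  have [c [k h]] := ha _ _ (hm _ _ (hc 4%N) (ha _ _ (hc 1%N) hi)) (hc 1%N).
  by exists c, k => n; rewrite twalkE; exact: h.
have hsel : polynomially_bounded tselect by rewrite /tselect; do ![exact: (hw)|apply: (hs)|exact: (hc)].
have h := ha _ _ (hc 1%N) (ha _ _ hp (ha _ _ hsel (hc 5%N))); exact: h.
Qed.

End polynomial_bounds.

(** The ends of an edge of [G] are distinct and connected in [F]; the first step of a path between
    them gives a positive degree. *)
Lemma edges_max_degree n (G F : graph n) : edges G != finset.set0 ->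
  connect F =2 connect G -> (0 < max_degree F)%N.
Proof.
case/set0Pn => A; rewrite inE => /existsP[x /existsP[y /andP[gxy _]]] FGc.
have : connect F x y by rewrite FGc connect1.
case/connectP => -[|z p] /=; first by move=> _ E; move: gxy; rewrite E adj_irr.
case/andP => Fxz _ _; apply: leq_trans (leq_bigmax x); rewrite card_gt0.
by apply/set0Pn; exists z; rewrite inE.
Qed.

Lemma cvg_inv_ln (R : realType) :
  (if (n < 27)%N then 1 else 22 / ln n%:R : R) @[n --> \oo] --> (0 : R).
Proof.
apply/cvgrPdist_lt => e e0; near=> n.
have n27 : (27 <= n)%N by near: n; exact: nbhs_infty_ge.
have ne : expR (22 / e) < n%:R by near: n; exact: nbhs_infty_gtr.
have n0 : 0 < n%:R :> R by rewrite ltr0n; apply: leq_trans n27.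
have ln0 : 22 / e < ln n%:R by rewrite -ltr_expR lnK.
have l0 : 0 < ln n%:R :> R by apply: lt_trans ln0; rewrite divr_gt0.
rewrite ltnNge n27 sub0r normrN ger0_norm ?divr_ge0 ?(ltW l0) //.
by rewrite ltr_pdivrMr // mulrC -ltr_pdivrMr.
Unshelve. all: by end_near. Qed.

Theorem theorem1p3 (R : realType) :
  exists (A : cmd) (T : nat -> nat),
    [/\ polynomially_bounded T,
        runs_in_time R A T,
        forall eps : R, 0 < eps ->
          node_private eps (fun n (G : graph n) => law A (T n) eps G) &
        exists (C : R) (k : nat) (delta : nat -> R),
          delta n @[n --> \oo] --> 0 /\
          forall (n : nat) (G : graph n) (eps : R) (D : nat),
            0 < eps -> edges G != finset.set0 ->
            min_spanning_forest_degree G D ->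
            ((1 - delta n)%:E <=
               law A (T n) eps G
                 [set x : R | (`|x - (fsf G)%:R| <=
                            D%:R * softO C k (ln (ln n%:R) / eps))%R])%E].
Proof.
exists estimator, testimator; split.
- exact: polynomially_bounded_testimator.
- by move=> n G eps u _ _; have [a _ run] := run_estimator G eps; case: (run u).
- move=> eps e0 n n' G G' nb S mS.
  have [a la ->] := law_estimator G eps; have [a' la' ->] := law_estimator G' eps.
  exact: levels_private nb la la'.
exists 6400, 1%N, (fun n => if (n < 27)%N then 1 else 22 / ln n%:R).
split; first exact: cvg_inv_ln.
move=> n G eps D e0 eG [[F [FG _ FGc] dF] _].
have [a la ->] := law_estimator G eps.
have D0 : (0 < D)%N by rewrite -dF; exact: edges_max_degree eG FGc.
(* For [n < 27] the failure bound is 1 and only nonnegativity is left to prove. *)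
case: ltnP => n27; last exact: (estimate_accuracy FG FGc dF).
rewrite subrr; apply: integral_ge0 => u _; exact: release_prob_ge0.
Qed.
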